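(* Let $k\ge2$, $\alpha,\beta>0$. For $u,v\in[-1,1]$ and $z,w\in\mathbb{C}$ put $\tilde z^k:=v\,\mathrm{Re}(z^k)+iu\,\mathrm{Im}(z^k)$, $R:=\mathrm{Re}(\tilde z^k\,\overline{w^k})$, $D:=\sqrt{|zw|^{2k}-R^2}\ge0$, and for $t=(t_0,\dots,t_{k-1})$ $$h_{u,v,t}(z,w)=\exp\Big(\sum_{j=0}^{k-1}t_j\,\mathrm{Re}\big(\sqrt[k]{R+iD}\big)_j\Big)+\exp\Big(\sum_{j=0}^{k-1}t_j\,\mathrm{Re}\big(\sqrt[k]{-R+iD}\big)_j\Big),$$ where $(\sqrt[k]{\zeta})_j$, $j=0,\dots,k-1$, are the $k$ complex $k$-th roots of $\zeta$ (in any order). Then the generalized Bessel function of $I_{2k}$ with multiplicity $(\alpha,\beta)$ is $$\mathcal J_\kappa(z,w)=\frac{\Gamma(k(\alpha+\beta))}{2\Gamma(\alpha+\beta)^k}\int_{-1}^1\int_{-1}^1\int_{T^{k-1}}h_{u,v,t}(z,w)\prod_{j=0}^{k-1}t_j^{\alpha+\beta-1}\,dt_1\cdots dt_{k-1}\,d\nu^\alpha(u)\,d\nu^\beta(v),\qquad t_0=1-\sum_{j=1}^{k-1}t_j.$$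
   Context: Identify $\mathbb{R}^2$ with $\mathbb{C}$, $\langle z,w\rangle=\mathrm{Re}(z\bar w)$. The dihedral group $I_{2k}$ (order $4k$) contains the reflections $z\mapsto\bar ze^{ij\pi/k}$, $j=0,\dots,2k-1$, forming two conjugacy classes ($j$ even, containing $z\mapsto\bar z$; $j$ odd); $\kappa=(\alpha,\beta)$ is $\alpha$ on the class with $j$ even and $\beta$ on the class with $j$ odd. The Dunkl kernel $E_\kappa$ is the joint eigenfunction of the Dunkl operators normalized by $E_\kappa(0,y)=1$, and $\mathcal J_\kappa(x,y)=\frac1{|G|}\sum_{g\in G}E_\kappa(x,gy)$. $d\nu^\alpha(u)=\frac{\Gamma(\alpha+1/2)}{\sqrt\pi\Gamma(\alpha)}(1-u^2)^{\alpha-1}du$ on $[-1,1]$. $T^{k-1}$ is the open unit simplex $\{t_j>0,\sum_{j=1}^{k-1}t_j<1\}$. *)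

(* Defs.v *)
From HB Require Import structures.
From mathcomp Require Import all_boot all_order all_algebra all_fingroup.
From mathcomp Require Import all_classical all_reals all_analysis.
Set Implicit Arguments. Unset Strict Implicit. Unset Printing Implicit Defensive.
Import Order.TTheory GRing.Theory Num.Theory.
Import numFieldNormedType.Exports.
Local Open Scope classical_set_scope.
Local Open Scope ring_scope.

Section Defs.
Variable R : realType.

Definition cplx := (R * R)%type.
Definition cre (z : cplx) : R := z.1.
Definition cim (z : cplx) : R := z.2.
Definition cmul (z w : cplx) : cplx := (z.1 * w.1 - z.2 * w.2, z.1 * w.2 + z.2 * w.1).
Definition cconj (z : cplx) : cplx := (z.1, - z.2).
Definition cexpn (z : cplx) (n : nat) : cplx := iter n (cmul z) (1, 0).
Definition cnorm (z : cplx) : R := Num.sqrt (z.1 ^+ 2 + z.2 ^+ 2).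
Definition cdot (z w : cplx) : R := cre (cmul z (cconj w)).
Definition cexpi (theta : R) : cplx := (cos theta, sin theta).
(* principal argument in (-pi, pi] (arbitrary 0 at z = 0) *)
Definition carg (z : cplx) : R :=
  if cnorm z == 0 then 0
  else if 0 <= z.2 then acos (z.1 / cnorm z) else - acos (z.1 / cnorm z).
Definition croot (k : nat) (zeta : cplx) (j : nat) : cplx :=
  let r := powR (cnorm zeta) (k%:R^-1) in
  let th := (carg zeta + 2 * pi * j%:R) / k%:R in
  (r * cos th, r * sin th).

(* The dihedral group I_{2k} (order 4k): rotations z |-> z e^{i j pi/k}
   and reflections z |-> conj(z) e^{i j pi/k}, j = 0 .. 2k-1. *)
Definition rot (k j : nat) (z : cplx) : cplx := cmul z (cexpi (j%:R * pi / k%:R)).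
Definition refl (k j : nat) (z : cplx) : cplx := cmul (cconj z) (cexpi (j%:R * pi / k%:R)).
(* a root (normal vector) of the reflection refl k j *)
Definition root_vec (k j : nat) : cplx := cmul (0, 1) (cexpi (j%:R * pi / (2 * k%:R))).
Definition kappa (al be : R) (j : nat) : R := if odd j then be else al.

(* Dunkl operator T_xi f (x), at points x off the reflecting lines *)
Definition dunkl (k : nat) (al be : R) (xi : cplx) (f : cplx -> R) (x : cplx) : R :=
  ('D_xi f x) + \sum_(j < 2 * k)
     kappa al be j * cdot (root_vec k j) xi * (f x - f (refl k j x)) / cdot (root_vec k j) x.

Definition regular (k : nat) (x : cplx) : Prop := forall j, (j < 2 * k)%N -> cdot (root_vec k j) x != 0.

Definition is_dunkl_kernel (k : nat) (al be : R) (E : cplx -> cplx -> R) : Prop :=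
  forall y : cplx,
    (forall x : cplx, differentiable (E^~ y) x) /\
    (forall v : cplx, continuous (fun x => 'D_v (E^~ y) x)) /\
    (forall (xi x : cplx), regular k x -> dunkl k al be xi (E^~ y) x = cdot xi y * E x y) /\
    E (0, 0) y = 1.

(* generalized Bessel function J_kappa(x,y) = 1/|G| sum_g E(x, g y) *)
Definition bessel (k : nat) (E : cplx -> cplx -> R) (x y : cplx) : R :=
  (4 * k%:R)^-1 * \sum_(j < 2 * k) (E x (rot k j y) + E x (refl k j y)).

Definition Gamma (x : R) : R :=
  fine (\int[lebesgue_measure]_(t in `]0%R, +oo[) (powR t (x - 1) * expR (- t))%:E)%E.

Definition nu_dens (a u : R) : R :=
  Gamma (a + 2^-1) / (Num.sqrt pi * Gamma a) * powR (1 - u ^+ 2) (a - 1).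

(* integral over the simplex {t_1..t_n >= 0, t_1 + ... + t_n <= s}, written as
   iterated Lebesgue integrals (Tonelli) in the variables t_1, ..., t_n *)
Fixpoint simplex_int (n : nat) (s : R) (F : seq R -> \bar R) : \bar R :=
  match n with
  | O => F [::]
  | n'.+1 => (\int[lebesgue_measure]_(x in `[0%R, s])
               simplex_int n' (s - x) (fun l => F (cons x l)))%E
  end.

Definition tvec (l : seq R) (j : nat) : R :=
  if j == 0%N then 1 - \sum_(x <- l) x else nth 0 l j.-1.

(* h_{u,v,t}(z,w); s1, s2 fix the (arbitrary) orderings of the k-th roots *)
Definition hfun (k : nat) (s1 s2 : 'S_k) (u v : R) (t : nat -> R) (z w : cplx) : R :=
  let zk := cexpn z k in
  let zt : cplx := (v * cre zk, u * cim zk) in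
  let Rr := cre (cmul zt (cconj (cexpn w k))) in
  let D := Num.sqrt ((cnorm z * cnorm w) ^+ (2 * k) - Rr ^+ 2) in
  expR (\sum_(j < k) t j * cre (croot k (Rr, D) (s1 j)))
  + expR (\sum_(j < k) t j * cre (croot k (- Rr, D) (s2 j))).

End Defs.

(* Main.v *)
Require Import Defs.
From HB Require Import structures.
From mathcomp Require Import all_boot all_order all_algebra all_fingroup.
From mathcomp Require Import all_classical all_reals all_analysis.
From mathcomp Require Import measurable_realfun ring lra.
Import Order.TTheory GRing.Theory Num.Theory.
Import numFieldNormedType.Exports.
Local Open Scope classical_set_scope.
Local Open Scope ring_scope.
Set Implicit Arguments.
Unset Strict Implicit.
Unset Printing Implicit Defensive.

(* In polar coordinates z = r e^(i th), w = r' e^(i ph), the function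
   e^(r r') E(z, w) is the power series sum_n (r r')^n K_n(th, ph), where K_n is
   the integral of an explicit trigonometric polynomial in th - ph, with
   coefficients polynomial in xi = v cos(k th) cos(k ph) + u sin(k th) sin(k ph),
   against (1 + u)(1 + v) dnu^al(u) dnu^be(v).  Integration by parts in u and v
   yields (n + M) K_n = (1 + cos (th - ph)) K_(n-1), M being the difference part of
   the radial Dunkl operator.  As M is positive semidefinite on each orbit, an energy
   estimate along rays shows that any Dunkl kernel has this expansion.

   Averaging over the group leaves only the zeroth Fourier mode, a polynomial in xi
   whose value at cos t is the n-th Taylor coefficient of the Dirichlet average of
   exp over the points 1 + cos ((t + 2 pi j) / k), 0 <= j < k.  The factor e^(r r')
   makes these points, hence all the coefficients, nonnegative, so that Tonelli's
   theorem turns the series into the stated integral. *)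

(** The hypothesis on E supplies no series and no uniqueness, only regularity, the value at the
    origin and the Dunkl equations off the mirrors; the expansion has to be forced by an estimate.
    Only the radial equation is used: in it the quotients of root products do not depend on the
    root, so M has no singularity at the mirrors and acts on each finite orbit.

    K_n originates in the gradient of the Dirichlet average over c_j = 1 + cos phi_j, where k phi_j
    = theta modulo 2 pi. Discrete Fourier inversion writes k times the derivative in c_j as a cosine
    polynomial in phi_j whose amplitudes are polynomials in cos theta. The construction frees cos
    theta from the angle: the angle becomes th - ph, and cos theta becomes xi, which agrees with cos
    (k (th - ph)) at u = v = 1. The price is a defect, xi - cos (k (th - ph)) times the top
    amplitude. That amplitude is k times the derivative of the next zeroth one, which lets
    integration by parts absorb the defect.

    Integrals over u and v first appear as formal moments of polynomials; the singular densities are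
    met only when these moments are identified. *)

(** * Cauchy products of coefficient sequences *)

Section Convolution.
Variable R : realType.
Implicit Types p q r : nat -> R.

Definition conv p q (n : nat) : R := \sum_(i < n.+1) p i * q (n - i)%N.

Lemma conv_coef N p q n : (n < N)%N ->
  conv p q n = ((\poly_(i < N) p i) * (\poly_(i < N) q i))`_n.
Proof.
move=> nN; rewrite coefM; apply: eq_bigr => i _.
by rewrite !coef_poly (leq_ltn_trans (leq_subr _ _) nN) (leq_ltn_trans _ nN) // -ltnS.
Qed.

Lemma convC p q : conv p q = conv q p.
Proof. by apply/funext => n; rewrite !(@conv_coef n.+1) // mulrC. Qed.

Lemma convA p q r : conv p (conv q r) = conv (conv p q) r.
Proof.
apply/funext => n; set N := n.+1.
set pN := \poly_(i < N) p i; set qN := \poly_(i < N) q i.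
set rN := \poly_(i < N) r i.
have hL : conv p (conv q r) n = (pN * (qN * rN))`_n.
  rewrite coefM; apply: eq_bigr => i _; rewrite coef_poly ltn_ord; congr (_ * _).
  by rewrite (@conv_coef N) // ltnS leq_subr.
have hR : conv (conv p q) r n = (pN * qN * rN)`_n.
  rewrite coefM; apply: eq_bigr => i _.
  rewrite [rN`_ _]coef_poly ltnS leq_subr; congr (_ * _).
  by rewrite (@conv_coef N).
by rewrite hL hR mulrA.
Qed.

Lemma convCA p q r : conv p (conv q r) = conv q (conv p r).
Proof. by rewrite convA (convC p) -convA. Qed.

Definition sshift p (n : nat) : R := if n is n'.+1 then p n' else 0.

Lemma conv_shiftl p q : conv (sshift p) q = sshift (conv p q).
Proof.
apply/funext => -[|n]; rewrite /conv; first by rewrite big_ord1 mul0r.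
by rewrite big_ord_recl mul0r add0r; apply: eq_bigr => i _; rewrite /= subSS.
Qed.

Lemma conv_shiftr p q : conv p (sshift q) = sshift (conv p q).
Proof. by rewrite convC conv_shiftl convC. Qed.

Lemma convZl a p q n : conv (fun i => a * p i) q n = a * conv p q n.
Proof. by rewrite mulr_sumr; apply: eq_bigr => i _; rewrite mulrA. Qed.

Lemma convZr a p q n : conv p (fun i => a * q i) n = a * conv p q n.
Proof. by rewrite convC convZl convC. Qed.

Lemma conv_sumr (I : Type) (s : seq I) (F : I -> nat -> R) p n :
  conv p (fun i => \sum_(j <- s) F j i) n = \sum_(j <- s) conv p (F j) n.
Proof.
rewrite exchange_big; apply: eq_bigr => i _ /=.
by rewrite mulr_sumr.
Qed.

Definition geo (c : R) (n : nat) : R := c ^+ n.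

(** Multiplication by 1 - c s undoes the convolution with [geo c]; [dirP_sumH] and [dirF_rec] rest
    on this recursion. *)
Lemma conv_geoS c p n : conv (geo c) p n.+1 = p n.+1 + c * conv (geo c) p n.
Proof.
rewrite /conv big_ord_recl /= /geo expr0 mul1r subn0; congr (_ + _).
rewrite mulr_sumr; apply: eq_bigr => i _.
by rewrite /bump /= add1n subSS exprS mulrA.
Qed.

Lemma conv_geo0 c p : conv (geo c) p 0%N = p 0%N.
Proof. by rewrite /conv big_ord1 /geo expr0 mul1r. Qed.

End Convolution.

(** * Taylor coefficients of Dirichlet averages of exp *)

Section DirichletCoefficients.
Variables (R : realType) (lam : R).

Definition poch (x : R) (n : nat) : R := \prod_(i < n) (x + i%:R).

Lemma poch0 x : poch x 0 = 1. Proof. by rewrite /poch big_ord0. Qed.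

Lemma pochS x n : poch x n.+1 = poch x n * (x + n%:R).
Proof. by rewrite /poch big_ord_recr. Qed.

Lemma pochSl x n : poch x n.+1 = x * poch (x + 1) n.
Proof.
rewrite /poch big_ord_recl addr0; congr (_ * _); apply: eq_bigr => i _.
by rewrite /= /bump /= natrD addrA.
Qed.

Lemma poch_gt0 x n : 0 < x -> 0 < poch x n.
Proof. by move=> x0; apply: prodr_gt0 => i _; rewrite ltr_pwDl. Qed.

(* Coefficients of (1 - c s)^(-lam). *)
Definition bcoef (c : R) (n : nat) : R := poch lam n / n`!%:R * c ^+ n.

Lemma bcoef0 c : bcoef c 0 = 1.
Proof. by rewrite /bcoef poch0 fact0 divr1 mulr1. Qed.

(** Compare coefficients in (1 - s)^(-lam) / (1 - s) = (1 - s)^(-(lam + 1)). *)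
Lemma sum_poch_fact n :
  \sum_(i < n.+1) poch lam i / i`!%:R = poch (lam + 1) n / n`!%:R.
Proof.
elim: n => [|n IH]; first by rewrite big_ord1 !poch0.
rewrite big_ord_recr /= IH pochSl (pochS (lam + 1)) factS natrM.
have h1 : n`!%:R != 0 :> R by rewrite pnatr_eq0 -lt0n fact_gt0.
have h2 : n.+1%:R != 0 :> R by rewrite pnatr_eq0.
have h3 : (1 + n%:R) != 0 :> R by rewrite addrC natr1.
rewrite -natr1; field; rewrite h1 /=; rewrite -nat1r in h2; done.
Qed.

Lemma conv_geo_bcoef c n :
  conv (geo c) (bcoef c) n = c ^+ n * (poch (lam + 1) n / n`!%:R).
Proof.
rewrite convC -sum_poch_fact mulr_sumr; apply: eq_bigr => i _.
by rewrite /bcoef /geo -mulrA -exprD subnKC 1?mulrC // -ltnS.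
Qed.

(** Applying s d/ds to (1 - c s)^(-lam) gives lam c s (1 - c s)^(-1) (1 - c s)^(-lam). *)
Lemma bcoefS c n : n.+1%:R * bcoef c n.+1 = lam * c * conv (geo c) (bcoef c) n.
Proof.
rewrite conv_geo_bcoef /bcoef pochSl factS natrM exprS.
have h1 : n`!%:R != 0 :> R by rewrite pnatr_eq0 -lt0n fact_gt0.
have h2 : n.+1%:R != 0 :> R by rewrite pnatr_eq0.
move: h2; rewrite -natr1 => h2.
by field; rewrite h1 h2.
Qed.

Lemma is_derive_bcoef (c : R -> R) (d x : R) n : is_derive x 1 c d ->
  is_derive x 1 (fun y => bcoef (c y) n)
    (lam * d * sshift (conv (geo (c x)) (bcoef (c x))) n).
Proof.
move=> cd; rewrite [X in is_derive _ _ X _](_ : _ = (poch lam n / n`!%:R) *: (c ^+ n)).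
  2: by apply/funext => y; rewrite !fctE.
apply: (@is_derive_eq _ _ _ _ _ _ _ _
  (is_deriveZ (poch lam n / n`!%:R) (is_deriveX n cd))).
case: n => [|n]; first by rewrite mul0r scale0r scaler0 mulr0.
rewrite /= conv_geo_bcoef pochSl factS natrM /GRing.scale /=.
have h1 : n`!%:R != 0 :> R by rewrite pnatr_eq0 -lt0n fact_gt0.
have h2 : n.+1%:R != 0 :> R by rewrite pnatr_eq0.
move: h2; move: (n.+1%:R) => N h2.
by field; rewrite h1 h2.
Qed.

Variable I : Type.
Implicit Type s : seq I.

(* Coefficients of prod_j (1 - c_j s)^(-lam). *)
Fixpoint dirP (c : I -> R) s : nat -> R :=
  if s is j :: s' then conv (bcoef (c j)) (dirP c s') else fun n => (n == 0%N)%:R.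

(* The logarithmic derivation sending [c_j] to [d_j]; [d = c] is the Euler operator. *)
Fixpoint dirD (c d : I -> R) s : nat -> R :=
  if s is j :: s' then
    fun n => conv (fun i => lam * d j * sshift (conv (geo (c j)) (bcoef (c j))) i)
                  (dirP c s') n + conv (bcoef (c j)) (dirD c d s') n
  else fun=> 0.

(** Coefficients of (1 - c_j s)^(-1) times the product; when j occurs once in the list, lam s times
    this series is the derivative of the product in c_j. *)
Definition dirH (c : I -> R) s (j : I) : nat -> R := conv (geo (c j)) (dirP c s).

Lemma dirDE c d s n :
  dirD c d s n = lam * \sum_(j <- s) d j * sshift (dirH c s j) n.
Proof.
elim: s n => [|j s IH] n /=; first by rewrite big_nil mulr0.
rewrite (_ : dirD c d s = fun i => lam * \sum_(l <- s) d l * sshift (dirH c s l) i);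
  last exact/funext.
rewrite convZr conv_sumr convZl big_cons mulrDr; congr (_ + _).
  by rewrite -mulrA conv_shiftl -convA.
congr (_ * _); apply: eq_bigr => l _.
by rewrite convZr conv_shiftr convCA.
Qed.

Lemma dirD_id c s n : dirD c c s n = n%:R * dirP c s n.
Proof.
elim: s n => [|j s IH] n /=; first by case: n => [|n]; rewrite ?mul0r ?mulr0.
rewrite /conv mulr_sumr -big_split /=; apply: eq_bigr => i _.
have iln : (i <= n)%N by rewrite -ltnS.
rewrite IH; have -> : lam * c j * sshift (conv (geo (c j)) (bcoef (c j))) i
   = i%:R * bcoef (c j) i.
  by case: (nat_of_ord i) => [|m]; rewrite ?mul0r ?mulr0 // bcoefS.
rewrite -[in X in _ = X * _](subnKC iln) natrD; ring.
Qed.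

Lemma is_derive_dirP (c : I -> R -> R) (d : I -> R) s n (x : R) :
  (forall j, is_derive x 1 (c j) (d j)) ->
  is_derive x 1 (fun y => dirP (c^~ y) s n) (dirD (c^~ x) d s n).
Proof.
move=> cd; elim: s n => [|j s IH] n /=; first exact: is_derive_cst.
rewrite /conv -big_split /=.
rewrite [X in is_derive _ _ X _](_ : _ = \sum_(i < n.+1)
    (fun y => bcoef (c j y) i * dirP (c^~ y) s (n - i))); last first.
  by apply/funext => y; rewrite fct_sumE.
apply: is_derive_sum => i.
apply: (@is_derive_eq _ _ _ _ _ _ _ _ (is_deriveM (is_derive_bcoef i (cd j)) (IH _))).
rewrite -!/(conv _ _ _) addrC; congr (_ + _); exact: mulrC.
Qed.

Lemma dirP0 c s : dirP c s 0%N = 1.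
Proof.
by elim: s => //= j s IH; rewrite /conv big_ord1 IH bcoef0 mulr1.
Qed.

Lemma dirP_ge0 c s n : 0 < lam -> (forall j, 0 <= c j) -> 0 <= dirP c s n.
Proof.
move=> lam0 c0; elim: s n => [|j s IH] n /=; first exact: ler0n.
apply: sumr_ge0 => i _; rewrite mulr_ge0 // /bcoef mulr_ge0 ?exprn_ge0 //.
by rewrite divr_ge0 // ltW // poch_gt0.
Qed.

Lemma dirP_euler c s n :
  n.+1%:R * dirP c s n.+1 = lam * \sum_(j <- s) c j * dirH c s j n.
Proof. by rewrite -dirD_id dirDE. Qed.

(** Sum 1 / (1 - c_j s) = 1 + c_j s / (1 - c_j s) over j: the ones give [size s] copies of the
    product, the rest is Euler's identity [dirP_euler]. *)
Lemma dirP_sumH c s n :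
  (n%:R + (size s)%:R * lam) * dirP c s n = lam * \sum_(j <- s) dirH c s j n.
Proof.
case: n => [|n].
  under eq_bigr do rewrite /dirH conv_geo0.
  by rewrite big_const_seq count_predT iter_addr_0 add0r -mulr_natl; ring.
under eq_bigr do rewrite /dirH conv_geoS.
rewrite big_split /= big_const_seq count_predT iter_addr_0 mulrDr -dirP_euler.
by rewrite -[in RHS]mulr_natl; ring.
Qed.

(* Taylor coefficients of the Dirichlet average of exp, [dirG], and of its
   partial derivative in [c_j], [dirF]. *)
Definition dirF (c : I -> R) s j n : R :=
  lam * dirH c s j n / poch ((size s)%:R * lam) n.+1.
Definition dirG (c : I -> R) s n : R := dirP c s n / poch ((size s)%:R * lam) n.

Hypothesis lam0 : 0 < lam.

(** Translating every c_j by h multiplies the average of exp by e^h, so its partial derivatives add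
    up to the average itself. *)
Lemma dirF_sum c s n : (0 < size s)%N -> \sum_(j <- s) dirF c s j n = dirG c s n.
Proof.
move=> s0; have h0 : 0 < (size s)%:R * lam by rewrite mulr_gt0 // ltr0n.
rewrite /dirF -mulr_suml -mulr_sumr -dirP_sumH /dirG pochS.
have h1 := lt0r_neq0 (poch_gt0 n h0).
have h2 : (size s)%:R * lam + n%:R != 0 by rewrite lt0r_neq0 // ltr_pwDl.
by field; rewrite h1 h2.
Qed.

(** The inhomogeneous term lam [dirG] is the same for all j, so it will vanish in every nonzero
    discrete Fourier mode. *)
Lemma dirF_rec c s j n : (0 < size s)%N ->
  (n.+1%:R + (size s)%:R * lam) * dirF c s j n.+1
  = c j * dirF c s j n + lam * dirG c s n.+1.
Proof.
move=> s0; have h0 : 0 < (size s)%:R * lam by rewrite mulr_gt0 // ltr0n.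
rewrite /dirF /dirG pochS /dirH conv_geoS.
have h1 := lt0r_neq0 (poch_gt0 n.+1 h0).
have h2 : (size s)%:R * lam + n.+1%:R != 0 by rewrite lt0r_neq0 // ltr_pwDl.
move: h2; move: (n.+1%:R) => N h2.
by field; rewrite h1 h2.
Qed.

(** Euler's identity for [dirG] in degree n + 1, homogeneous in the c_j. *)
Lemma dirG_rec c s n : (0 < size s)%N ->
  n.+1%:R * dirG c s n.+1 = \sum_(j <- s) c j * dirF c s j n.
Proof.
move=> s0; rewrite /dirG mulrA dirP_euler mulr_sumr mulr_suml.
by apply: eq_bigr => j _; rewrite /dirF; ring.
Qed.

Lemma dirF0 c s j : (0 < size s)%N -> dirF c s j 0 = (size s)%:R^-1.
Proof.
move=> s0; rewrite /dirF /dirH conv_geo0 dirP0 pochS poch0 addr0 mul1r mulr1.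
by rewrite invfM mulrCA divff ?mulr1 // lt0r_neq0.
Qed.

End DirichletCoefficients.

(** * Trigonometric sums over roots of unity *)

Section TrigSums.
Variable R : realType.

Lemma sinD2pin (x : R) n : sin (x + 2 * pi * n%:R) = sin x.
Proof.
rewrite (_ : 2 * pi * n%:R = pi *+ 2 *+ n) ?(periodicn (@sinD2pi R)) //.
by rewrite -[RHS]mulr_natr -[pi *+ 2]mulr_natl.
Qed.

Lemma cosD2pin (x : R) n : cos (x + 2 * pi * n%:R) = cos x.
Proof.
rewrite (_ : 2 * pi * n%:R = pi *+ 2 *+ n) ?(periodicn (@cosD2pi R)) //.
by rewrite -[RHS]mulr_natr -[pi *+ 2]mulr_natl.
Qed.

Lemma sinDpin (x : R) n : sin (x + n%:R * pi) = (-1) ^+ n * sin x.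
Proof. by rewrite mulr_natl (alternatingn (@sinDpi R)). Qed.

Lemma cosDpin (x : R) n : cos (x + n%:R * pi) = (-1) ^+ n * cos x.
Proof. by rewrite mulr_natl (alternatingn (@cosDpi R)). Qed.

Lemma sum_cos_roots (k m : nat) (x : R) : (0 < m < k)%N ->
  \sum_(j < k) cos (x + m%:R * (2 * pi * j%:R / k%:R)) = 0.
Proof.
move=> /andP[m0 mk]; have k0 : 0 < k%:R :> R by rewrite ltr0n (ltn_trans m0).
(* Half the angular step: multiplication by 2 sin d makes the sum telescope, and 0 < m < k puts d
   strictly between 0 and pi. *)
pose d : R := m%:R * pi / k%:R.
have sd : 0 < sin d.
  apply: sin_gt0_pi; apply/andP; split.
    by rewrite /d divr_gt0 // mulr_gt0 ?ltr0n ?pi_gt0.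
  by rewrite /d ltr_pdivrMr // mulrC ltr_pM2l ?pi_gt0 // ltr_nat.
apply: (mulIf (lt0r_neq0 sd)); rewrite mul0r mulr_suml.
apply: (@mulfI _ 2); first by rewrite pnatr_eq0.
rewrite mulr0 mulr_sumr.
pose g (j : nat) := sin (x - d + 2 * d * j%:R).
rewrite (eq_bigr (fun j : 'I_k => g j.+1 - g j)); last first.
  move=> j _; rewrite /g.
  have -> : x - d + 2 * d * j.+1%:R = x + 2 * d * j%:R + d.
    by rewrite -natr1; ring.
  have -> : x - d + 2 * d * j%:R = x + 2 * d * j%:R - d by ring.
  have -> : m%:R * (2 * pi * j%:R / k%:R) = 2 * d * j%:R by rewrite /d; ring.
  rewrite sinD sinB; ring.
rewrite -(big_mkord xpredT (fun j => g j.+1 - g j)) telescope_sumr // /g.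
have -> : 2 * d * k%:R = 2 * pi * m%:R.
  by rewrite /d; field; exact: lt0r_neq0.
by rewrite sinD2pin mulr0 addr0 subrr.
Qed.

Lemma sum_sin_roots (k m : nat) (x : R) : (0 < m < k)%N ->
  \sum_(j < k) sin (x + m%:R * (2 * pi * j%:R / k%:R)) = 0.
Proof.
move=> mk; rewrite -[RHS](sum_cos_roots (x - pi / 2) mk).
by apply: eq_bigr => j _; rewrite -cosBpihalf addrAC.
Qed.

(** Even and odd indices are the two classes of reflections, on which [kappa] is constant. *)
Lemma sum_parity (k : nat) (F : nat -> R) :
  \sum_(j < 2 * k) F j = \sum_(i < k) (F (2 * i)%N + F (2 * i).+1).
Proof.
elim: k => [|k IH]; first by rewrite !big_ord0.
by rewrite [RHS]big_ord_recr /= -IH mulnS addrA !big_ord_recr.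
Qed.

Lemma poly_eq0_itv (p : {poly R}) :
  (forall x, -1 < x < 1 -> p.[x] = 0) -> p = 0.
Proof.
(* The points 1/2, 1/3, ... provide [size p] distinct roots. *)
move=> hp; apply: (@roots_geq_poly_eq0 _ p
  [seq (i.+2%:R)^-1 | i <- iota 0 (size p)]).
- apply/allP => _ /mapP[i _ ->]; apply/eqP/hp; apply/andP; split.
    by rewrite (@lt_trans _ _ 0) // ?oppr_lt0 ?ltr01 // invr_gt0 ltr0n.
  by rewrite invf_lt1 ?ltr1n ?ltr0n.
- rewrite map_inj_uniq ?iota_uniq // => i j /invr_inj /eqP.
  by rewrite eqr_nat => /eqP[].
- by rewrite size_map size_iota.
Qed.

End TrigSums.

(** * Fourier modes of the gradient of the Dirichlet average *)

Section Modes.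
Variables (R : realType) (k : nat) (lam : R).

(* [amode n m] is the polynomial in xi = cos theta such that the m-th Fourier
   mode of the Taylor coefficients [dirF] is amode n m + e^(i theta) amode n (k-m). *)
Fixpoint amode (n m : nat) : {poly R} :=
  if n is n'.+1 then
    if m == 0%N then
      n'.+1%:R^-1 *: (amode n' 1 + 'X * amode n' k.-1 + amode n' 0)
    else if (m < k)%N then
      (n'.+1%:R + k%:R * lam)^-1 *:
        (2^-1 *: (amode n' m.-1 + amode n' m.+1) + amode n' m)
    else 0
  else (m == 0%N)%:R%:P.

Hypothesis k2 : (2 <= k)%N.
Hypothesis lam0 : 0 < lam.

Let k0 : 0 < k%:R :> R. Proof. by rewrite ltr0n (ltn_trans _ k2). Qed.

Lemma amodeS0 n :
  n.+1%:R *: amode n.+1 0 = amode n 1 + 'X * amode n k.-1 + amode n 0.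
Proof. by rewrite /= scalerA divff ?scale1r // pnatr_eq0. Qed.

Lemma amodeSm n m : (0 < m < k)%N ->
  (n.+1%:R + k%:R * lam) *: amode n.+1 m
  = 2^-1 *: (amode n m.-1 + amode n m.+1) + amode n m.
Proof.
case: m => // m /= mk; rewrite mk scalerA divff ?scale1r //.
by rewrite lt0r_neq0 // ltr_pwDl // ?ltr0Sn // mulr_ge0 // ltW.
Qed.

Lemma amode_k n : amode n k = 0.
Proof.
by case: n => [|n] /=; rewrite ?ltnn gtn_eqF // (ltn_trans _ k2).
Qed.

Variable s : 'S_k.
(** The k solutions x of k x = th modulo 2 pi; the permutation s keeps the order of the roots
    arbitrary. *)
Definition rphi (th : R) (j : 'I_k) : R := (th + 2 * pi * (s j)%:R) / k%:R.
Definition rc (j : 'I_k) (th : R) : R := 1 + cos (rphi th j).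
Let js := index_enum 'I_k.

Let size_js : size js = k.
Proof. by rewrite /js -[index_enum _]enumT -cardE card_ord. Qed.

Lemma k_rphi th j : k%:R * rphi th j = th + 2 * pi * (s j)%:R.
Proof. by rewrite /rphi; field; exact: lt0r_neq0. Qed.

Lemma sum_sin_rphi th m : (0 < m < k)%N ->
  \sum_(j < k) sin (m%:R * rphi th j) = 0.
Proof.
move=> mk; rewrite -[RHS](sum_sin_roots (m%:R * (th / k%:R)) mk).
rewrite [RHS](reindex_inj (@perm_inj _ s)) /=; apply: eq_bigr => j _.
by congr (sin _); rewrite /rphi; ring.
Qed.

(** The right side is the imaginary part of the mode of index k - m, that is of a_(k-m) + e^(i th)
    a_m with real amplitudes, which isolates a_m. In the induction the factor [rc] = 1 + cos becomes
    the averaging of neighbouring modes. *)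
Lemma amode_eval th n m : sin th != 0 -> (m <= k)%N ->
  sin th * (amode n m).[cos th] =
  \sum_(j <- js) dirF lam (rc^~ th) js j n * sin ((k - m)%:R * rphi th j).
Proof.
move=> sth; have js0 : (0 < size js)%N by rewrite size_js (ltn_trans _ k2).
elim: n m => [|n IH] m mk.
  under eq_bigr do rewrite dirF0 // size_js.
  rewrite -mulr_sumr /= hornerC.
  case: (posnP m) => [->|m0].
    rewrite subn0; under eq_bigr do rewrite k_rphi sinD2pin.
    rewrite big_const_seq count_predT iter_addr_0 size_js mulr1 -[sin th *+ k]mulr_natr.
    by field; exact: lt0r_neq0.
  rewrite mulr0; move: mk; rewrite leq_eqVlt => /predU1P[->|mk].
    rewrite subnn; under eq_bigr do rewrite mul0r sin0.
    by rewrite big1_eq mulr0.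
  by rewrite sum_sin_rphi ?mulr0 // subn_gt0 mk ltn_subrL m0 (ltn_trans m0).
case: (posnP m) => [->|m0].
  have h1 : n.+1%:R != 0 :> R by rewrite pnatr_eq0.
  apply: (mulfI h1); rewrite mulrCA -hornerZ amodeS0 subn0.
  under eq_bigr do rewrite k_rphi sinD2pin.
  rewrite -mulr_suml dirF_sum // mulrA dirG_rec // mulr_suml.
  rewrite !hornerD hornerM hornerX !mulrDr mulrCA !IH //; last 2 first.
  - exact: leq_pred.
  - by rewrite (ltn_trans _ k2).
  rewrite mulr_sumr -!big_split /=; apply: eq_bigr => j _.
  (* Modes 1 and k - 1 combine through sin (th - x) + cos th sin x = sin th cos x, with x =
     [rphi th j]. *)
  have -> : (k - k.-1)%N = 1%N by rewrite -subn1 subKn // (ltn_trans _ k2).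
  rewrite subn0 natrB; last by rewrite (ltn_trans _ k2).
  rewrite mulrBl mul1r sinB k_rphi sinD2pin cosD2pin /rc; ring.
move: mk; rewrite leq_eqVlt => /predU1P[->|mk].
  rewrite amode_k horner0 mulr0 subnn.
  by under eq_bigr do rewrite mul0r sin0 mulr0; rewrite big1_eq.
have h1 : n.+1%:R + k%:R * lam != 0.
  by rewrite lt0r_neq0 // ltr_pwDl // ?ltr0Sn // mulr_ge0 // ltW.
apply: (mulfI h1); rewrite mulrCA -hornerZ amodeSm ?m0 // mulr_sumr.
rewrite (eq_bigr (fun j => rc j th * dirF lam (rc^~ th) js j n * sin ((k - m)%:R * rphi th j) +
   lam * dirG lam (rc^~ th) js n.+1 * sin ((k - m)%:R * rphi th j))); last first.
  move=> j _; rewrite mulrA -{1}size_js dirF_rec //; ring.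
(* The term lam [dirG] is independent of j and drops out, as 0 < k - m < k. *)
rewrite big_split /= -[X in _ = _ + X]mulr_sumr sum_sin_rphi; last first.
  by rewrite subn_gt0 mk ltn_subrL m0 (ltn_trans m0).
rewrite mulr0 addr0 hornerD hornerZ hornerD.
have expand (a x y z : R) :
  a * (2^-1 * (x + y) + z) = 2^-1 * (a * x) + 2^-1 * (a * y) + a * z by ring.
rewrite expand !IH ?(ltnW mk) //; last by rewrite (leq_trans (leq_pred _)) // ltnW.
rewrite !mulr_sumr -!big_split /=; apply: eq_bigr => j _.
have [q qE] : exists q, (k - m)%N = q.+1.
  by exists (k - m).-1; rewrite prednK // subn_gt0.
have -> : (k - m.-1)%N = q.+2 by rewrite -qE -subSn ?(ltnW mk) //; case: m m0 {mk qE}.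
have -> : (k - m.+1)%N = q by rewrite subnS qE.
rewrite qE; set x := rphi th j.
have -> : q.+2%:R * x = q.+1%:R * x + x by rewrite -[q.+2%:R]natr1; ring.
have -> : q%:R * x = q.+1%:R * x - x by rewrite -[q.+1%:R]natr1; ring.
by rewrite sinD sinB /rc -/x; field.
Qed.

Lemma is_derive_rc (th : R) j : is_derive th 1 (rc j) (- sin (rphi th j) / k%:R).
Proof.
have h : is_derive th 1 (rphi^~ j) k%:R^-1.
  rewrite [X in is_derive _ _ X _](_ : _ =
      k%:R^-1 *: (id + cst (2 * pi * (s j)%:R))); last first.
    by apply/funext => y; exact: mulrC.
  apply: is_derive_eq; rewrite addr0; exact: mulr1.
rewrite [X in is_derive _ _ X _](_ : _ = cst 1 + (cos \o rphi^~ j)) //.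
by apply: is_derive_eq; rewrite add0r mulNr.
Qed.

Lemma is_derive_dirP_rc (th : R) n :
  is_derive th 1 (fun y => dirP lam (rc^~ y) js n)
   (lam * \sum_(j <- js) (- sin (rphi th j) / k%:R) * sshift (dirH lam (rc^~ th) js j) n).
Proof.
rewrite -dirDE; apply: is_derive_dirP => j; exact: is_derive_rc.
Qed.

Lemma amode0_eval_neq0 th n : sin th != 0 ->
  (amode n 0).[cos th] = dirG lam (rc^~ th) js n.
Proof.
move=> sth; apply: (mulfI sth); rewrite amode_eval // subn0.
under eq_bigr do rewrite k_rphi sinD2pin.
by rewrite -mulr_suml dirF_sum ?size_js ?(ltn_trans _ k2) // mulrC.
Qed.

(** Where sin th = 0, [amode_eval] cannot be divided by sin th; both sides are continuous in th and
    agree at angles just to the right. *)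
Lemma amode0_eval th n : (amode n 0).[cos th] = dirG lam (rc^~ th) js n.
Proof.
have [sth|/amode0_eval_neq0//] := eqVneq (sin th) 0.
pose D y := (amode n 0).[cos y] - dirG lam (rc^~ y) js n.
suff : D th = 0 by move/eqP; rewrite subr_eq0 => /eqP.
have cD : {for th, continuous D}.
  apply: cvgB.
    apply: continuous_comp; first exact: continuous_cos.
    exact: continuous_horner.
  apply: cvgM; last exact: cvg_cst.
  have [+ _] := is_derive_dirP_rc th n.
  by move=> /derivable1_diffP /differentiable_continuous.
have cD' : D y @[y --> th^'+] --> D th by exact: cvg_at_right_filter.
have c0 : D y @[y --> th^'+] --> (0 : R).
  apply: cvg_near_cst; near=> y; rewrite /D amode0_eval_neq0 ?subrr //.
  have -> : y = (y - th) + th by rewrite subrK.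
  rewrite sinD sth mulr0 addr0 mulf_neq0 //.
    rewrite lt0r_neq0 //; apply: sin_gt0_pi; apply/andP; split.
      by rewrite subr_gt0; near: y; exact: nbhs_right_gt.
    rewrite ltrBlDl; near: y; apply: nbhs_right_lt; rewrite ltrDl; exact: pi_gt0.
  by rewrite -normr_eq0 sin0cos1 // oner_eq0.
exact: cvg_unique cD' c0.
Unshelve. all: by end_near. Qed.

(** Differentiate [amode0_eval] in th. The polynomial side gives - sin th times its derivative at
    cos th; the Dirichlet side gives - sum_j [dirF] sin phi_j / k, which [amode_eval] at m = k - 1
    turns into - sin th [amode n k.-1] / k. *)
Lemma amode_deriv n : k%:R *: (amode n.+1 0)^`() = amode n k.-1.
Proof.
apply/eqP; rewrite -subr_eq0; apply/eqP; apply: poly_eq0_itv => x x11.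
have xI : x \in `[(-1), 1].
  by rewrite in_itv /= !ltW //; case/andP: x11.
set th := acos x; have <- : cos th = x by exact: acosK.
have sth : sin th != 0.
  rewrite lt0r_neq0 // sin_gt0_pi // acos_gt0 ?acos_ltpi //.
    by case/andP: x11 => -> /ltW ->.
  by case/andP: x11 => /ltW -> ->.
have h1 := is_derive_dirP_rc th n.+1.
have h2 : is_derive th 1 (fun y => (amode n.+1 0).[cos y])
    ((amode n.+1 0)^`().[cos th] * (- sin th)).
  exact: (is_derive1_comp (f := horner (amode n.+1 0))).
have h3 : is_derive th 1 (fun y => (amode n.+1 0).[cos y])
  ((poch ((size js)%:R * lam) n.+1)^-1 *:
   (lam * \sum_(j <- js) (- sin (rphi th j) / k%:R) * sshift (dirH lam (rc^~ th) js j) n.+1)).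
  rewrite [X in is_derive _ _ X _](_ : _ =
    (poch ((size js)%:R * lam) n.+1)^-1 *: (fun y => dirP lam (rc^~ y) js n.+1)); last first.
    by apply/funext => y; rewrite amode0_eval /dirG mulrC.
  exact: is_deriveZ.
have := @derive_val _ _ _ _ _ _ _ h2; rewrite (@derive_val _ _ _ _ _ _ _ h3) => /esym h4.
apply: (mulfI sth); rewrite mulr0 hornerD hornerN mulrDr mulrN amode_eval ?leq_pred //.
have -> : (k - k.-1)%N = 1%N by rewrite -subn1 subKn // (ltn_trans _ k2).
apply/eqP; rewrite subr_eq0 hornerZ; apply/eqP.
have -> : sin th * (k%:R * (amode n.+1 0)^`().[cos th]) =
   - k%:R * ((amode n.+1 0)^`().[cos th] * - sin th) by ring.
rewrite h4 /= /GRing.scale /= !mulr_sumr; apply: eq_bigr => j _.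
rewrite mul1r /dirF; field.
by rewrite !lt0r_neq0 // poch_gt0 // size_js mulr_gt0.
Qed.

End Modes.

(** * Formal integration of polynomials against nu^al and nu^be *)

Section Moments.
Variable R : realType.
Implicit Types (a al be A B : R) (p q l : nat) (g h : {poly R}).

(* Moments of the probability measure nu^a. *)
Fixpoint mom a n : R :=
  match n with
  | 0%N => 1
  | 1%N => 0
  | n'.+2 => n'.+1%:R / (2 * a + n'.+1%:R) * mom a n'
  end.

Arguments mom : simpl never.

Lemma momSS a n : mom a n.+2 = n.+1%:R / (2 * a + n.+1%:R) * mom a n.
Proof. by []. Qed.

Lemma mom_ind (P : nat -> Prop) :
  P 0%N -> P 1%N -> (forall n, P n -> P n.+2) -> forall n, P n.
Proof.
move=> P0 P1 PS n; suff [] : P n /\ P n.+1 by [].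
by elim: n => // n [? ?]; split=> //; exact: PS.
Qed.

(** Moment form of the fact that the derivative of u^n (1 - u^2)^a integrates to 0 over [-1, 1]. *)
Lemma mom_parts a n : 0 < a ->
  2 * a * mom a n.+1 = n%:R * (mom a n.-1 - mom a n.+1).
Proof.
move=> a0; case: n => [|n]; first by rewrite /= mulr0 mul0r.
rewrite [n.+1.-1]/= momSS; have : 2 * a + n.+1%:R != 0.
  by rewrite lt0r_neq0 // ltr_wpDr // mulr_gt0.
by move: (n.+1%:R) (mom a n) => N M h; field.
Qed.

Lemma mom_sign a n : (-1) ^+ n * mom a n = mom a n.
Proof.
elim/mom_ind: n => [||n IH]; rewrite ?expr0 ?mul1r ?mulr0 //.
by rewrite -signr_odd /= negbK signr_odd mulrCA IH.
Qed.

(* [Tmom al be A B p q g] is the value of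
   int int u^p v^q g(v A + u B) dnu^al(u) dnu^be(v). *)
Definition Tmon al be A B p q l : R :=
  \sum_(i < l.+1) 'C(l, i)%:R * A ^+ i * B ^+ (l - i) *
    mom be (i + q) * mom al (l - i + p).

Definition Tmom al be A B p q g : R := \sum_(l < size g) g`_l * Tmon al be A B p q l.

Lemma TmomE al be A B p q g N : (size g <= N)%N ->
  Tmom al be A B p q g = \sum_(l < N) g`_l * Tmon al be A B p q l.
Proof.
move=> gN; rewrite /Tmom (big_ord_widen _ (fun l => g`_l * Tmon al be A B p q l) gN).
rewrite big_mkcond; apply: eq_bigr => i _; case: ifPn => //.
by rewrite -leqNgt => h; rewrite nth_default // mul0r.
Qed.

Lemma TmomD al be A B p q g h :
  Tmom al be A B p q (g + h) = Tmom al be A B p q g + Tmom al be A B p q h.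
Proof.
pose N := maxn (size g) (size h).
rewrite !(@TmomE _ _ _ _ _ _ _ N) ?leq_maxl ?leq_maxr ?size_polyD //.
by rewrite -big_split; apply: eq_bigr => i _; rewrite coefD mulrDl.
Qed.

Lemma TmomZ al be A B p q c g : Tmom al be A B p q (c *: g) = c * Tmom al be A B p q g.
Proof.
rewrite (@TmomE _ _ _ _ _ _ _ (size g)) ?size_scale_leq // mulr_sumr.
by apply: eq_bigr => i _; rewrite coefZ mulrA.
Qed.

Lemma Tmon_swap al be A B p q l : Tmon al be A B p q l = Tmon be al B A q p l.
Proof.
rewrite /Tmon (reindex_inj rev_ord_inj); apply: eq_bigr => i _ /=.
have il : (i <= l)%N by rewrite -ltnS.
rewrite subSS subKn // bin_sub //; ring.
Qed.

Lemma Tmom_swap al be A B p q g : Tmom al be A B p q g = Tmom be al B A q p g.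
Proof. by apply: eq_bigr => i _; rewrite Tmon_swap. Qed.

(** Pascal's rule: one factor v A + u B is split off the power. *)
Lemma TmonS al be A B p q l :
  Tmon al be A B p q l.+1 = A * Tmon al be A B p q.+1 l + B * Tmon al be A B p.+1 q l.
Proof.
rewrite /Tmon !mulr_sumr big_ord_recl /= bin0.
rewrite (eq_bigr (fun i : 'I_l.+1 =>
   A * ('C(l, i)%:R * A ^+ i * B ^+ (l - i) * mom be (i + q.+1) * mom al (l - i + p)) +
   'C(l, i.+1)%:R * A ^+ i.+1 * B ^+ (l - i) * mom be (i.+1 + q) * mom al (l - i + p)));
  last first.
  move=> i _; rewrite /bump /= add1n binS natrD subSS addSnnS exprS; ring.
rewrite big_split /= addrCA; congr (_ + _).
rewrite big_ord_recr /= bin_small // !mul0r addr0 [RHS]big_ord_recl /= bin0 !subn0.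
rewrite addSnnS [in LHS]exprS; congr (_ + _); first by ring.
apply: eq_bigr => i _; rewrite /bump /= add1n.
have -> : (l - i = (l - i.+1).+1)%N by rewrite subnSK.
by rewrite [((l - i.+1).+1 + p)%N]addSnnS [B ^+ _.+1]exprS; ring.
Qed.

Lemma Tmom_mulX al be A B p q g :
  Tmom al be A B p q ('X * g) = A * Tmom al be A B p q.+1 g + B * Tmom al be A B p.+1 q g.
Proof.
rewrite (@TmomE _ _ _ _ _ _ _ (size g).+1); last first.
  have [->|g0] := eqVneq g 0; first by rewrite mulr0 size_poly0.
  by rewrite mulrC size_mulX.
rewrite big_ord_recl coefXM mul0r add0r /Tmom !mulr_sumr -big_split /=.
apply: eq_bigr => i _; rewrite coefXM /= TmonS; ring.
Qed.

Lemma Tmon_parts al be A B p l : 0 < be ->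
  2 * be * Tmon al be A B p 1 l.+1 =
  l.+1%:R * A * (Tmon al be A B p 0 l - Tmon al be A B p 2 l).
Proof.
move=> be0; rewrite /Tmon -sumrB !mulr_sumr big_ord_recl.
rewrite [mom be (_ + 1)](_ : _ = 0) // !(mulr0, mul0r) add0r.
apply: eq_bigr => i _; rewrite /= /bump /= add1n subSS.
have := mom_parts i.+1 be0; rewrite addn1 addn0 addn2 [i.+1.-1]/= => h.
have hC : i.+1%:R * 'C(l.+1, i.+1)%:R = l.+1%:R * 'C(l, i)%:R :> R.
  by rewrite -!natrM mul_bin_diag.
rewrite exprS.
transitivity ('C(l.+1, i.+1)%:R * (A * A ^+ i) * B ^+ (l - i) * mom al (l - i + p) *
  (2 * be * mom be i.+2)); first by ring.
rewrite h.
transitivity ((i.+1%:R * 'C(l.+1, i.+1)%:R) * (A * A ^+ i) * B ^+ (l - i) *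
  mom al (l - i + p) * (mom be i - mom be i.+2)); first by ring.
rewrite hC; ring.
Qed.

(** The derivative of (1 - v^2)^be is - 2 be v (1 - v^2)^(be - 1), so a factor 2 be v on g(v A + u
    B) is traded for (1 - v^2) A g'(v A + u B). *)
Lemma Tmom_parts_v al be A B p g : 0 < be ->
  2 * be * Tmom al be A B p 1 g = A * (Tmom al be A B p 0 g^`() - Tmom al be A B p 2 g^`()).
Proof.
move=> be0; case E : (size g) => [|n].
  move/eqP: E; rewrite size_poly_eq0 => /eqP ->.
  by rewrite deriv0 /Tmom size_poly0 !big_ord0 subrr !mulr0.
rewrite (@TmomE _ _ _ _ _ _ g n.+1) ?E //.
have sg' : (size g^`()%R <= n)%N by rewrite (leq_trans (size_poly _ _)) // E.
rewrite !(@TmomE _ _ _ _ _ _ g^`()%R n) //.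
rewrite big_ord_recl {1}/Tmon big_ord1 [mom be (_ + 1)](_ : _ = 0) // !(mulr0, mul0r) add0r.
rewrite -sumrB !mulr_sumr; apply: eq_bigr => i _; rewrite lift0.
rewrite mulrCA Tmon_parts // coef_deriv -mulr_natr; ring.
Qed.

Lemma Tmom_parts_u al be A B q g : 0 < al ->
  2 * al * Tmom al be A B 1 q g = B * (Tmom al be A B 0 q g^`() - Tmom al be A B 2 q g^`()).
Proof. by move=> al0; rewrite !(Tmom_swap al be) Tmom_parts_v. Qed.

(** The substitution u -> -u, which preserves nu^al; in moments it is [mom_sign]. *)
Lemma Tmom_signB al be A B p q g (e : nat) :
  Tmom al be A ((-1) ^+ e * B) p q g = (-1) ^+ (e * p) * Tmom al be A B p q g.
Proof.
rewrite /Tmom mulr_sumr; apply: eq_bigr => l _; rewrite mulrCA; congr (_ * _).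
rewrite /Tmon mulr_sumr; apply: eq_bigr => i _.
rewrite exprMn -exprM.
have h : (-1) ^+ (e * (l - i)) * mom al (l - i + p)
   = (-1) ^+ (e * p) * mom al (l - i + p) :> R.
  rewrite -[in RHS](mom_sign al (l - i + p)); case: (boolP (odd e)) => oe.
    rewrite -![(-1) ^+ (e * _)]signr_odd !oddM oe /= !signr_odd exprD.
    have hp : (-1) ^+ p * (-1) ^+ p = 1 :> R by rewrite -expr2 sqrr_sign.
    move: hp; move: ((-1) ^+ p) ((-1) ^+ (l - i)) (mom al _) => x y M hp.
    by transitivity (x * x * (y * M)); [rewrite hp mul1r | ring].
  rewrite -![(-1) ^+ (e * _)]signr_odd !oddM (negbTE oe) /= !expr0 !mul1r.
  by rewrite mom_sign.
transitivity ('C(l, i)%:R * A ^+ i * B ^+ (l - i) * mom be (i + q) *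
  ((-1) ^+ (e * (l - i)) * mom al (l - i + p))); first by ring.
rewrite h; ring.
Qed.

Lemma Tmom_signA al be A B p q g (e : nat) :
  Tmom al be ((-1) ^+ e * A) B p q g = (-1) ^+ (e * q) * Tmom al be A B p q g.
Proof. by rewrite !(Tmom_swap al be) Tmom_signB. Qed.

(* Integration against the weight (1 + e u)(1 + d v). *)
Definition Wmom al be A B (e d : R) g : R :=
  Tmom al be A B 0 0 g + e * Tmom al be A B 1 0 g + d * Tmom al be A B 0 1 g +
  e * d * Tmom al be A B 1 1 g.

Lemma WmomD al be A B e d g h :
  Wmom al be A B e d (g + h) = Wmom al be A B e d g + Wmom al be A B e d h.
Proof. rewrite /Wmom !TmomD; ring. Qed.

Lemma WmomZ al be A B e d c g : Wmom al be A B e d (c *: g) = c * Wmom al be A B e d g.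
Proof. rewrite /Wmom !TmomZ; ring. Qed.

(** The group acts on A and B by signs; these move onto the weight. A is paired with v and B with u,
    so the two signs appear there in exchanged order. *)
Lemma Wmom_sign al be A B (i j : nat) g :
  Wmom al be ((-1) ^+ i * A) ((-1) ^+ j * B) 1 1 g =
  Wmom al be A B ((-1) ^+ j) ((-1) ^+ i) g.
Proof.
rewrite /Wmom !Tmom_signA !Tmom_signB !muln0 !muln1 !expr0; ring.
Qed.

Lemma Wmom1 al be A B : Wmom al be A B 1 1 1 = 1.
Proof.
rewrite /Wmom /Tmom size_poly1 !big_ord1 /Tmon !big_ord1 /= !coefC /=.
have m0 a : mom a 0 = 1 by []. have m1 a : mom a 1 = 0 by [].
by rewrite subnn !add0n !m0 !m1 !expr0 bin0; ring.
Qed.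

End Moments.

(** * The explicit coefficients K_n and their recursion *)

Section ExplicitKernel.
Variables (R : realType) (k : nat) (al be : R).
Hypotheses (k2 : (2 <= k)%N) (al0 : 0 < al) (be0 : 0 < be).
Let lam := al + be.
Let lam0 : 0 < lam. Proof. exact: addr_gt0. Qed.
Let k0 : 0 < k%:R :> R. Proof. by rewrite ltr0n (ltn_trans _ k2). Qed.
Local Notation amode := (amode k lam).

(** At xi = cos (k eta) this is k times the [dirF] of the root with angle eta; here the polynomial
    variable xi and the angle eta are independent. *)
Definition Amode n (eta : R) : {poly R} :=
  amode n 0 + \sum_(m < k.-1) (2 * cos (m.+1%:R * eta)) *: amode n m.+1.

(** Summation by parts: with c_m = cos (m eta), averaging neighbouring amplitudes becomes
    multiplication of the cosines by cos eta. In use K + 1 = k, so the boundary term with a_(K+1)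
    vanishes by [amode_k]. *)
Lemma shift_cos_sum (S : comPzRingType) (c a : nat -> S) (K : nat) : c 0%N = 1 ->
  c 1%N * a 0%N + \sum_(m < K) (c m.+2 + c m) * a m.+1 + c K * a K.+1 =
  a 1%N + c K.+1 * a K + \sum_(m < K) c m.+1 * (a m + a m.+2).
Proof.
move=> c0; elim: K => [|K IH]; first by rewrite !big_ord0 c0; ring.
rewrite !big_ord_recr /=.
transitivity ((c 1%N * a 0%N + \sum_(m < K) (c m.+2 + c m) * a m.+1 + c K * a K.+1)
   + (c K.+2 * a K.+1 + c K.+1 * a K.+2)); first by ring.
rewrite IH; ring.
Qed.

(** At xi = cos (k eta) the last bracket vanishes and the identity is k times [dirF_rec]; the
    bracket is the cost of decoupling xi from eta. *)
Lemma AmodeS n eta :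
  (n.+1%:R + k%:R * lam) *: Amode n.+1 eta =
  (1 + cos eta) *: Amode n eta + (k%:R * lam) *: amode n.+1 0
  + ('X * amode n k.-1 - cos (k%:R * eta) *: amode n k.-1).
Proof.
have kK : k = k.-1.+1 by rewrite prednK // (ltn_trans _ k2).
rewrite /Amode scalerDr scaler_sumr.
rewrite (eq_bigr (fun m : 'I_k.-1 => (cos (m.+1%:R * eta))%:P *
   (amode n m + amode n m.+2) + (2 * cos (m.+1%:R * eta)) *: amode n m.+1)); last first.
  move=> m _; rewrite scalerA [_ * (2 * _)]mulrC -[LHS]scalerA amodeSm //=; last first.
    by have := ltn_ord m; rewrite -ltnS -kK.
  rewrite scalerDr scalerA mulrAC divff ?mul1r ?pnatr_eq0 // mul_polyC //.
rewrite big_split /=.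
have := @shift_cos_sum _ (fun m => (cos (m%:R * eta))%:P) (amode n) k.-1.
rewrite mul0r cos0 -kK amode_k // mulr0 addr0 => /(_ erefl) h.
have -> : (n.+1%:R + k%:R * lam) *: amode n.+1 0 = amode n 1 + 'X * amode n k.-1
   + amode n 0 + (k%:R * lam) *: amode n.+1 0.
  by rewrite scalerDl amodeS0.
have {}h : \sum_(m < k.-1) (cos (m.+1%:R * eta))%:P * (amode n m + amode n m.+2) =
  cos eta *: (amode n 0 + \sum_(m < k.-1) (2 * cos (m.+1%:R * eta)) *: amode n m.+1)
  - amode n 1 - cos (k%:R * eta) *: amode n k.-1.
  have -> : cos eta *: (amode n 0 +
      \sum_(m < k.-1) (2 * cos (m.+1%:R * eta)) *: amode n m.+1) =
    (cos (1%:R * eta))%:P * amode n 0 + \sum_(m < k.-1)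
      ((cos (m.+2%:R * eta))%:P + (cos (m%:R * eta))%:P) * amode n m.+1.
    rewrite mul1r -mul_polyC mulrDr mulr_sumr; congr (_ + _).
    apply: eq_bigr => m _.
    rewrite -mul_polyC mulrA; congr (_ * _); rewrite -polyCM -polyCD; congr (_%:P).
    have -> : m.+2%:R * eta = m.+1%:R * eta + eta by rewrite -[m.+2%:R]natr1; ring.
    have -> : m%:R * eta = m.+1%:R * eta - eta by rewrite -[m.+1%:R]natr1; ring.
    rewrite cosD cosB; ring.
  by rewrite h -mul_polyC; ring.
rewrite h; rewrite -!mul_polyC polyCD; ring.
Qed.

Lemma sum_Amode n x :
  \sum_(i < k) Amode n (x + 2 * pi * i%:R / k%:R) = k%:R *: amode n 0.
Proof.
rewrite /Amode big_split /= sumr_const card_ord scaler_nat exchange_big big1 ?addr0 //.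
move=> m _; rewrite -scaler_suml -mulr_sumr.
under eq_bigr do rewrite mulrDr.
rewrite sum_cos_roots ?mulr0 ?scale0r //=.
by have := ltn_ord m; rewrite -ltnS prednK // (ltn_trans _ k2).
Qed.

Lemma AmodeN n x : Amode n (- x) = Amode n x.
Proof.
congr (_ + _); apply: eq_bigr => m _.
by rewrite mulrN cosN.
Qed.

(* The n-th coefficient, in powers of |z||w|, of e^(|z||w|) E(z, w). *)
Definition Kn (n : nat) (th ph : R) : R :=
  Wmom al be (cos (k%:R * th) * cos (k%:R * ph)) (sin (k%:R * th) * sin (k%:R * ph))
    1 1 (Amode n (th - ph)).

Lemma Kn0 th ph : Kn 0 th ph = 1.
Proof.
rewrite /Kn [Amode _ _](_ : _ = 1) ?Wmom1 // /Amode /=.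
by rewrite big1 ?addr0 // => m _; rewrite scaler0.
Qed.

Lemma Kn_refl n th ph (j : nat) :
  Kn n (- th + j%:R * pi / k%:R) ph =
  Wmom al be (cos (k%:R * th) * cos (k%:R * ph)) (sin (k%:R * th) * sin (k%:R * ph))
    ((-1) ^+ j.+1) ((-1) ^+ j) (Amode n (- th - ph + j%:R * pi / k%:R)).
Proof.
rewrite /Kn -Wmom_sign.
have -> : k%:R * (- th + j%:R * pi / k%:R) = - (k%:R * th) + j%:R * pi.
  by field; exact: lt0r_neq0.
rewrite cosDpin sinDpin cosN sinN exprS.
rewrite (_ : - th + j%:R * pi / k%:R - ph = - th - ph + j%:R * pi / k%:R); last by ring.
congr (Wmom _ _ _ _ _ _ _); ring.
Qed.

(** Within one parity class the angles differ by multiples of 2 pi / k, so the sum over the class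
    kills every mode but the zeroth. The first argument of F is the parity bit. *)
Lemma sum_parity_Amode n x (F : nat -> {poly R} -> R) :
  (forall b g h, F b (g + h) = F b g + F b h) -> (forall b, F b 0 = 0) ->
  (forall b c g, F b (c *: g) = c * F b g) ->
  \sum_(j < 2 * k) F (odd j) (Amode n (x + j%:R * pi / k%:R)) =
  k%:R * (F 0%N (amode n 0) + F 1%N (amode n 0)).
Proof.
move=> FD F0 FZ.
rewrite (sum_parity k (fun j => F (odd j) (Amode n (x + j%:R * pi / k%:R)))).
rewrite big_split /= mulrDr; congr (_ + _).
  rewrite -FZ -(sum_Amode n x) (big_morph (F 0%N) (FD 0%N) (F0 0%N)).
  apply: eq_bigr => i _; rewrite mul2n odd_double; congr (F _ (Amode n (_ + _))).
  by rewrite -mul2n natrM; ring.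
rewrite -FZ -(sum_Amode n (x + pi / k%:R)) (big_morph (F 1%N) (FD 1%N) (F0 1%N)).
apply: eq_bigr => i _; rewrite mul2n odd_double; congr (F _ (Amode n _)).
by rewrite -mul2n -natr1 natrM; ring.
Qed.

(** Summed over a class, the reflected terms keep only the zeroth mode, with 1 + u turned into 1 - u
    for even index and 1 + v into 1 - v for odd index. Against the k lam times zeroth mode of
    [AmodeS] this leaves the weight 2 k (al u (1 + v) + be v (1 + u)), which cancels the defect
    after integration by parts. *)
Lemma Kn_rec n th ph :
  n.+1%:R * Kn n.+1 th ph +
  \sum_(j < 2 * k) kappa al be j * (Kn n.+1 th ph - Kn n.+1 (- th + j%:R * pi / k%:R) ph)
  = (1 + cos (th - ph)) * Kn n th ph.
Proof.
set A := cos (k%:R * th) * cos (k%:R * ph); set B := sin (k%:R * th) * sin (k%:R * ph).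
pose F (b : nat) (g : {poly R}) :=
  kappa al be b * Wmom al be A B ((-1) ^+ b.+1) ((-1) ^+ b) g.
have hF : \sum_(j < 2 * k) kappa al be j * Kn n.+1 (- th + j%:R * pi / k%:R) ph
   = k%:R * (F 0%N (amode n.+1 0) + F 1%N (amode n.+1 0)).
  rewrite -(sum_parity_Amode n.+1 (- th - ph)); last 3 first.
  - by move=> b g h; rewrite /F WmomD mulrDr.
  - by move=> b; rewrite /F -(scale0r 0) WmomZ mul0r mulr0.
  - by move=> b c g; rewrite /F WmomZ mulrCA.
  apply: eq_bigr => j _; rewrite Kn_refl /F /kappa oddb; congr (_ * Wmom _ _ _ _ _ _ _).
    by rewrite !exprS signr_odd.
  by rewrite signr_odd.
have hk : \sum_(j < 2 * k) kappa al be j = k%:R * lam.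
  rewrite (sum_parity k (fun j => kappa al be j)) /kappa.
  under eq_bigr do rewrite /= mul2n odd_double /=.
  by rewrite sumr_const card_ord mulr_natl.
under eq_bigr do rewrite mulrBr.
rewrite sumrB -mulr_suml hk hF addrA -mulrDl {1}/Kn -WmomZ AmodeS.
rewrite -/A -/B -(amode_deriv k2 lam0 1%g) {hF hk}.
move: (amode n.+1 0) => f.
rewrite -scaleNr !WmomD -scalerAr !WmomZ -/(Kn n th ph).
(* Now xi - cos (k (th - ph)) reads (v - 1) A + (u - 1) B, and the weight (1 + u)(1 + v) completes
   its factors to - (1 - v^2) and - (1 - u^2), as needed for [e1] to [e4]. *)
have -> : cos (k%:R * (th - ph)) = A + B by rewrite mulrBr cosB.
rewrite /F /kappa /= !expr0 expr1 expr2 /Wmom !Tmom_mulX.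
have e1 := Tmom_parts_v al A B 0 f be0.
have e2 := Tmom_parts_v al A B 1 f be0.
have e3 := Tmom_parts_u be A B 0 f al0.
have e4 := Tmom_parts_u be A B 1 f al0.
rewrite /lam.
move: e1 e2 e3 e4.
set t00 := Tmom _ _ _ _ 0 0 f^`(); set t01 := Tmom _ _ _ _ 0 1 f^`().
set t10 := Tmom _ _ _ _ 1 0 f^`(); set t11 := Tmom _ _ _ _ 1 1 f^`().
set t02 := Tmom _ _ _ _ 0 2 f^`(); set t20 := Tmom _ _ _ _ 2 0 f^`().
set t12 := Tmom _ _ _ _ 1 2 f^`(); set t21 := Tmom _ _ _ _ 2 1 f^`().
set s00 := Tmom _ _ _ _ 0 0 f; set s01 := Tmom _ _ _ _ 0 1 f.
set s10 := Tmom _ _ _ _ 1 0 f; set s11 := Tmom _ _ _ _ 1 1 f.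
move=> e1 e2 e3 e4.
transitivity ((1 + cos (th - ph)) * Kn n th ph + k%:R * (2 * be * s01 + 2 * be * s11 + 2 * al * s10 + 2 * al * s11
  - A * (t00 - t02) - A * (t10 - t12) - B * (t00 - t20) - B * (t01 - t21))).
  ring.
rewrite e1 e2 e3 e4; ring.
Qed.

(* Averaging kills the modes m > 0 (roots of unity) and the odd weights u, v, uv. *)
Lemma sum_Kn_orbit n th ph :
  \sum_(j < 2 * k) (Kn n th (ph + j%:R * pi / k%:R) + Kn n th (- ph + j%:R * pi / k%:R))
  = 4 * k%:R * Tmom al be (cos (k%:R * th) * cos (k%:R * ph))
      (sin (k%:R * th) * sin (k%:R * ph)) 0 0 (amode n 0).
Proof.
set A := cos (k%:R * th) * cos (k%:R * ph); set B := sin (k%:R * th) * sin (k%:R * ph).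
(* A rotation by j pi / k multiplies both A and B by (-1)^j, a reflection multiplies them by
   opposite signs; the four resulting weights (1 +- u)(1 +- v) add up to 4. *)
pose F (b : nat) (g : {poly R}) := Wmom al be A B ((-1) ^+ b) ((-1) ^+ b) g.
pose G (b : nat) (g : {poly R}) := Wmom al be A B ((-1) ^+ b.+1) ((-1) ^+ b) g.
have hF : \sum_(j < 2 * k) Kn n th (ph + j%:R * pi / k%:R)
   = k%:R * (F 0%N (amode n 0) + F 1%N (amode n 0)).
  rewrite -(sum_parity_Amode n (ph - th)); last 3 first.
  - by move=> b g h; rewrite /F WmomD.
  - by move=> b; rewrite /F -(scale0r 0) WmomZ mul0r.
  - by move=> b c g; rewrite /F WmomZ.
  apply: eq_bigr => j _; rewrite /F signr_odd -Wmom_sign /Kn -AmodeN.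
  have -> : k%:R * (ph + j%:R * pi / k%:R) = (k%:R * ph) + j%:R * pi.
    by field; exact: lt0r_neq0.
  rewrite cosDpin sinDpin; congr (Wmom _ _ _ _ _ _ (Amode _ _)); rewrite /A /B; ring.
have hG : \sum_(j < 2 * k) Kn n th (- ph + j%:R * pi / k%:R)
   = k%:R * (G 0%N (amode n 0) + G 1%N (amode n 0)).
  rewrite -(sum_parity_Amode n (- ph - th)); last 3 first.
  - by move=> b g h; rewrite /G WmomD.
  - by move=> b; rewrite /G -(scale0r 0) WmomZ mul0r.
  - by move=> b c g; rewrite /G WmomZ.
  apply: eq_bigr => j _; rewrite /G exprS !signr_odd -exprS -Wmom_sign /Kn -AmodeN.
  have -> : k%:R * (- ph + j%:R * pi / k%:R) = - (k%:R * ph) + j%:R * pi.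
    by field; exact: lt0r_neq0.
  rewrite cosDpin sinDpin cosN sinN exprS.
  congr (Wmom _ _ _ _ _ _ (Amode _ _)); rewrite /A /B; ring.
rewrite big_split /= hF hG /F /G /Wmom !expr0 !expr1 expr2; ring.
Qed.

End ExplicitKernel.

(** * Derivatives along rays and a Gronwall bound *)

Section Gronwall.
Variable R : realType.

Lemma is_derive_ray (V : normedModType R) (f : V -> R) (x : V) (t : R) :
  differentiable f (t *: x) ->
  is_derive t 1 (fun s : R => f (s *: x)) ('D_x f (t *: x)).
Proof.
move=> df; have dv : derivable f (t *: x) x by exact: diff_derivable.
have h : (fun h : R => h^-1 *: (((fun s : R => f (s *: x)) \o shift t) (h *: 1)
             - f (t *: x))) =
         (fun h : R => h^-1 *: ((f \o shift (t *: x)) (h *: x) - f (t *: x))).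
  apply/funext => h /=; congr (_ *: (f _ - _)).
  by rewrite -[h *: 1]/(h * 1) mulr1 scalerDl.
apply: DeriveDef; first by rewrite /derivable h.
by rewrite /derive h.
Qed.

Lemma is_derive_sum_seq (I : Type) (s : seq I) (h : I -> R -> R) (dh : I -> R) (x : R) :
  (forall i, is_derive x 1 (h i) (dh i)) ->
  is_derive x 1 (fun y => \sum_(i <- s) h i y) (\sum_(i <- s) dh i).
Proof.
move=> hd; elim: s => [|i s IH].
  rewrite big_nil [X in is_derive _ _ X _](_ : _ = cst 0); first exact: is_derive_cst.
  by apply/funext => y; rewrite big_nil.
rewrite big_cons [X in is_derive _ _ X _](_ : _ = h i + (fun y => \sum_(j <- s) h j y)).
  exact: is_deriveD.
by apply/funext => y; rewrite big_cons.
Qed.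

(** The function e^(-C t) sum_i X_i^2 - K t vanishes at 0 and has nonpositive derivative on ]0, 1[,
    because e^(-C t) <= 1. The inequality is asked for 0 < t < 1 only, since it will come from an
    equation multiplied by t. *)
Lemma gronwall (I : finType) (X Y : I -> R -> R) (C K : R) :
  0 <= C -> 0 <= K -> (forall i (t : R), is_derive t 1 (X i) (Y i t)) ->
  (forall i, X i 0 = 0) ->
  (forall t, 0 < t < 1 ->
     \sum_i 2 * X i t * Y i t <= C * (\sum_i X i t ^+ 2) + K) ->
  \sum_i X i 1 ^+ 2 <= K * expR C.
Proof.
move=> C0 K0 dX X0 ineq.
pose V t := \sum_i X i t ^+ 2.
pose V' t := \sum_i 2 * X i t * Y i t.
have dV (t : R) : is_derive t 1 V (V' t).
  apply: is_derive_sum_seq => i; rewrite [X in is_derive _ _ X _](_ : _ = X i ^+ 2) //.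
  by apply: is_derive_eq; rewrite /= expr1.
pose W t := expR (- C * t) * V t - K * t.
pose W' t := expR (- C * t) * (V' t - C * V t) - K.
have dW (t : R) : is_derive t 1 W (W' t).
  have d1 : is_derive t 1 (fun s => expR (- C * s)) (expR (- C * t) * (- C)).
    apply: (is_derive1_comp (f := expR) (g := fun s => - C * s)).
    by apply: (is_derive_eq (is_deriveZ (- C) (is_derive_id t 1))); rewrite /GRing.scale /= mulr1.
  have d2 : is_derive t 1 (fun s => K * s) K.
    by apply: (is_derive_eq (is_deriveZ K (is_derive_id t 1))); rewrite /GRing.scale /= mulr1.
  apply: (is_derive_eq (is_deriveB (is_deriveM d1 (dV t)) d2)).
  by rewrite /W' /GRing.scale /=; ring.
have cW : {within `[0, 1], continuous W}.
  apply: derivable_within_continuous => t _; by case: (dW t).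
have [c] := MVT (@ltr01 R) (fun x _ => dW x) cW.
rewrite in_itv /= => c01.
have W0 : W 0 = 0.
  rewrite /W !mulr0 subr0 /V big1 ?mulr0 // => i _; by rewrite X0 expr0n.
rewrite W0 !subr0 mulr1 => W1.
have W'c : W' c <= 0.
  have h1 : V' c - C * V c <= K by rewrite lerBlDl; exact: ineq.
  rewrite /W' subr_le0; apply: (le_trans (ler_wpM2l (expR_ge0 _) h1)).
  rewrite ler_piMl // -expR0 ler_expR mulNr oppr_le0 mulr_ge0 //.
  by case/andP: c01 => /ltW.
move: W'c; rewrite -W1 /W mulr1 subr_le0 mulr1 expRN mulrC ler_pdivrMr ?expR_gt0 //.
Qed.

End Gronwall.

(** * Polar coordinates and the mirrors *)

Section Polar.
Variable R : realType.

Definition polar (r th : R) : cplx R := (r * cos th, r * sin th).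

Lemma polarP (z : cplx R) : exists r th, [/\ 0 <= r, cnorm z = r & z = polar r th].
Proof.
case: z => x y; pose r := cnorm (x, y).
have r0 : 0 <= r by exact: sqrtr_ge0.
have r2 : r ^+ 2 = x ^+ 2 + y ^+ 2 by rewrite sqr_sqrtr // addr_ge0 // sqr_ge0.
have [rz|rn0] := eqVneq r 0.
  exists r, 0; split=> //; move: r2; rewrite rz expr0n /= => /esym/eqP.
  rewrite paddr_eq0 ?sqr_ge0 // !sqrf_eq0 => /andP[/eqP -> /eqP ->].
  by rewrite /polar !mul0r.
have rp : 0 < r by rewrite lt_def rn0.
have xr : -1 <= x / r <= 1.
  rewrite -ler_norml normrM normfV (ger0_norm r0) ler_pdivrMr // mul1r.
  by rewrite -(ler_sqr (normr_ge0 _) r0) // real_normK ?num_real // r2 lerDl sqr_ge0.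
have xrI : x / r \in `[(-1), 1] by rewrite in_itv.
have hs : r * Num.sqrt (1 - (x / r) ^+ 2) = `|y|.
  rewrite -{1}(ger0_norm r0) -sqrtr_sqr -sqrtrM ?sqr_ge0 //.
  rewrite -sqrtr_sqr; congr Num.sqrt.
  have -> : y ^+ 2 = r ^+ 2 - x ^+ 2 by rewrite r2 addrC addKr.
  by field.
have hc : r * (x / r) = x by rewrite mulrC divfK.
have [y0|y0] := leP 0 y.
  exists r, (acos (x / r)); split=> //.
  by rewrite /polar acosK // sin_acos // hs hc ger0_norm.
exists r, (- acos (x / r)); split=> //.
by rewrite /polar cosN sinN acosK // sin_acos // mulrN hs hc ltr0_norm // opprK.
Qed.

Lemma refl_polar k j r th : refl k j (polar r th) = polar r (- th + j%:R * pi / k%:R).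
Proof.
rewrite /refl /polar /cmul /cconj /cexpi /= cosD sinD cosN sinN.
by congr (_, _); ring.
Qed.

Lemma rot_polar k j r th : Defs.rot k j (polar r th) = polar r (th + j%:R * pi / k%:R).
Proof.
rewrite /Defs.rot /polar /cmul /cexpi /= cosD sinD.
by congr (_, _); ring.
Qed.

Lemma scale_polar (t r th : R) : t *: polar r th = polar (t * r) th.
Proof. by rewrite /polar -!mulrA. Qed.

Lemma cdot_polar r th s ph : cdot (polar r th) (polar s ph) = r * s * cos (th - ph).
Proof. rewrite /cdot /cre /cmul /cconj /polar /= cosB; ring. Qed.

Lemma cdot_root_polar k j r th :
  cdot (root_vec R k j) (polar r th) = r * sin (th - j%:R * pi / (2 * k%:R)).
Proof. rewrite /cdot /cre /cmul /cconj /polar /root_vec /cmul /cexpi /= sinB; ring. Qed.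

Lemma sin_mulrn_eq0 (x : R) n : sin x = 0 -> sin (n%:R * x) = 0.
Proof.
move=> sx; elim: n => [|n IH]; first by rewrite mul0r sin0.
by rewrite -natr1 mulrDl mul1r sinD IH sx mul0r mulr0 addr0.
Qed.

(** The mirrors lie at the angles j pi / (2 k), which are zeros of sin (2 k th); one scalar
    condition thus covers all roots. *)
Lemma regular_polar k r th : (0 < k)%N -> r != 0 -> sin ((2 * k)%:R * th) != 0 ->
  regular k (polar r th).
Proof.
move=> k0 r0 s0 j _; rewrite cdot_root_polar mulf_neq0 //; apply: contra_neq s0.
move=> /(sin_mulrn_eq0 (2 * k)) h.
have -> : (2 * k)%:R * th =
   (2 * k)%:R * (th - j%:R * pi / (2 * k%:R)) + j%:R * pi.
  by rewrite natrM; field; rewrite pnatr_eq0 -lt0n.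
by rewrite sinDpin h mulr0.
Qed.

End Polar.

(** * Energy estimate on orbits for an arbitrary Dunkl kernel *)

Section DunklEstimate.
Variables (R : realType) (k : nat) (al be : R).
Hypotheses (k2 : (2 <= k)%N) (al0 : 0 < al) (be0 : 0 < be).
Let k0 : 0 < k%:R :> R. Proof. by rewrite ltr0n (ltn_trans _ k2). Qed.
Local Notation Kn := (Kn k al be).
Local Notation per g := (forall y : R, g (y + 2 * pi) = g y).

Lemma orbit_sum_shift (g : R -> R) x (j : nat) : per g ->
  \sum_(i < 2 * k) g (x + j%:R * pi / k%:R + i%:R * pi / k%:R) =
  \sum_(i < 2 * k) g (x + i%:R * pi / k%:R).
Proof.
move=> pg; elim: j => [|j IH].
  by apply: eq_bigr => i _; rewrite !mul0r addr0.
rewrite -IH; case E : (2 * k)%N => [|n]; first by rewrite !big_ord0.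
rewrite big_ord_recr [RHS]big_ord_recl [LHS]addrC; congr (_ + _).
  have hn : n%:R = 2 * k%:R - 1 :> R.
    by apply: (addIr 1); rewrite subrK natr1 -E natrM.
  rewrite -[RHS]pg; congr (g _); rewrite /= hn -[j.+1%:R]natr1.
  by field; exact: lt0r_neq0.
by apply: eq_bigr => i _; congr (g _); rewrite lift0 /= -[i.+1%:R]natr1 -[j.+1%:R]natr1; ring.
Qed.

Lemma orbit_sum_rev (g : R -> R) x : per g ->
  \sum_(i < 2 * k) g (x - i%:R * pi / k%:R) =
  \sum_(i < 2 * k) g (x + i%:R * pi / k%:R).
Proof.
move=> pg; rewrite -(orbit_sum_shift x 1 pg) (reindex_inj rev_ord_inj).
apply: eq_bigr => i _; rewrite -[LHS]pg; congr (g _) => /=.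
rewrite natrB; last by rewrite ltn_ord.
by rewrite natrM -[i.+1%:R]natr1; field; exact: lt0r_neq0.
Qed.

(* The angles of the I_2k-orbit of a point at angle [th]. *)
Definition ang (th : R) (p : bool * 'I_(2 * k)) : R :=
  (if p.1 then - th else th) + p.2%:R * pi / k%:R.

(** A reflection exchanges the two halves of the index set, up to reversal and a cyclic shift inside
    each half. *)
Lemma orbit_sum_refl (g : R -> R) th (j : nat) : per g ->
  \sum_p g (- ang th p + j%:R * pi / k%:R) = \sum_p g (ang th p).
Proof.
move=> pg; rewrite -(pair_bigA _ (fun b i => g (- ang th (b, i) + j%:R * pi / k%:R))).
rewrite -(pair_bigA _ (fun b i => g (ang th (b, i)))) /= !big_bool /ang /= addrC.
have h x : \sum_(i < 2 * k) g (- (x + i%:R * pi / k%:R) + j%:R * pi / k%:R) =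
  \sum_(i < 2 * k) g (- x + i%:R * pi / k%:R).
  rewrite -(orbit_sum_shift (- x) j pg) -orbit_sum_rev //.
  by apply: eq_bigr => i _; congr (g _); ring.
by rewrite !h opprK.
Qed.

(* The reflection part of the Dunkl operator in the radial direction xi = x, where
   <alpha, xi> / <alpha, x> = 1. *)
Definition Mop (h : R -> R) (x : R) : R :=
  \sum_(j < 2 * k) kappa al be j * (h x - h (- x + j%:R * pi / k%:R)).

Lemma kappa_gt0 j : 0 < kappa al be j.
Proof. by rewrite /kappa; case: ifP. Qed.

(* The reflections permute each orbit, so h^2 and its reflections have equal sums. *)
Lemma Mop_psd (h : R -> R) th : per h ->
  0 <= \sum_p h (ang th p) * Mop h (ang th p).
Proof.
move=> ph; rewrite /Mop; under eq_bigr do rewrite mulr_sumr.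
rewrite exchange_big; apply: sumr_ge0 => j _ /=.
have ph2 : per (fun x => h x ^+ 2) by move=> y; rewrite ph.
have e := orbit_sum_refl th j ph2.
rewrite (eq_bigr (fun p => kappa al be j *
  (h (ang th p) * (h (ang th p) - h (- ang th p + j%:R * pi / k%:R))))); last first.
  by move=> p _; rewrite mulrCA.
rewrite -mulr_sumr; apply: mulr_ge0; first exact: ltW (kappa_gt0 _).
apply: (@le_trans _ _ (\sum_p (2^-1 * h (ang th p) ^+ 2
   - 2^-1 * h (- ang th p + j%:R * pi / k%:R) ^+ 2))).
  by rewrite sumrB -!mulr_sumr e subrr.
apply: ler_sum => p _; move: (h _) (h (- _ + _)) => x y.
rewrite -subr_ge0; have -> : x * (x - y) - (2^-1 * x ^+ 2 - 2^-1 * y ^+ 2) =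
  2^-1 * (x - y) ^+ 2 by field.
by rewrite mulr_ge0 ?sqr_ge0 // invr_ge0.
Qed.

Lemma cos_per (m : nat) (x y : R) : cos (m%:R * (x + 2 * pi - y)) = cos (m%:R * (x - y)).
Proof.
have -> : m%:R * (x + 2 * pi - y) = m%:R * (x - y) + 2 * pi * m%:R by ring.
by rewrite cosD2pin.
Qed.

Lemma Kn_per n ph : per (fun th => Kn n th ph).
Proof.
move=> th; rewrite /Kn.
have -> : k%:R * (th + 2 * pi) = k%:R * th + 2 * pi * k%:R by ring.
rewrite cosD2pin sinD2pin /Amode; congr (Wmom _ _ _ _ _ _ (_ + _)).
by apply: eq_bigr => m _; rewrite cos_per.
Qed.

Lemma Kn_recM n th ph :
  n.+1%:R * Kn n.+1 th ph + Mop (fun x => Kn n.+1 x ph) th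
  = (1 + cos (th - ph)) * Kn n th ph.
Proof. exact: Kn_rec. Qed.

Lemma Mop_Kn0 th ph : Mop (fun x => Kn 0 x ph) th = 0.
Proof. by rewrite /Mop big1 // => j _; rewrite !Kn0 subrr mulr0. Qed.

Lemma MopB f g x : Mop (fun y => f y - g y) x = Mop f x - Mop g x.
Proof. by rewrite /Mop -sumrB; apply: eq_bigr => j _; ring. Qed.

Lemma MopZ c f x : Mop (fun y => c * f y) x = c * Mop f x.
Proof. by rewrite /Mop mulr_sumr; apply: eq_bigr => j _; ring. Qed.

Lemma Mop_sum n (F : nat -> R -> R) x :
  Mop (fun y => \sum_(i < n) F i y) x = \sum_(i < n) Mop (F i) x.
Proof.
rewrite /Mop exchange_big; apply: eq_bigr => j _ /=.
by rewrite -mulr_sumr sumrB.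
Qed.

Lemma onecos_ge0 (x : R) : 0 <= 1 + cos x.
Proof. by have := cos_geN1 x; rewrite -subr_ge0 opprK addrC. Qed.

Lemma onecos_le2 (x : R) : 1 + cos x <= 2.
Proof. by have := cos_le1 x; rewrite -(lerD2l 1). Qed.

Lemma onecos_sqr_le (x : R) : (1 + cos x) ^+ 2 <= 4.
Proof.
have -> : 4 = 2 ^+ 2 :> R by rewrite -natrX.
by rewrite ler_sqr ?nnegrE ?onecos_ge0 ?onecos_le2.
Qed.

Definition Knorm n th ph : R := \sum_p Kn n (ang th p) ph ^+ 2.

(** Pair [Kn_recM] with K_(n+1) over the orbit: the M-term is nonnegative by [Mop_psd], and
    expanding the square of N K_(n+1) - (1 + cos) K_n, with 0 <= 1 + cos <= 2, bounds the right
    side. *)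
Lemma KnormS n th ph : n.+1%:R ^+ 2 * Knorm n.+1 th ph <= 4 * Knorm n th ph.
Proof.
have N0 : 0 < n.+1%:R :> R by [].
set N : R := n.+1%:R in N0 *.
have h1 : N * Knorm n.+1 th ph <=
   \sum_p Kn n.+1 (ang th p) ph * ((1 + cos (ang th p - ph)) * Kn n (ang th p) ph).
  rewrite (eq_bigr (fun p => N * Kn n.+1 (ang th p) ph ^+ 2 +
    Kn n.+1 (ang th p) ph * Mop (fun x => Kn n.+1 x ph) (ang th p))); last first.
    by move=> p _; rewrite -Kn_recM -/N; ring.
  rewrite big_split /= -mulr_sumr lerDl.
  exact: (Mop_psd th (Kn_per n.+1 ph)).
have h2 : 2 * N * \sum_p Kn n.+1 (ang th p) ph *
       ((1 + cos (ang th p - ph)) * Kn n (ang th p) ph) <=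
   N ^+ 2 * Knorm n.+1 th ph + 4 * Knorm n th ph.
  rewrite /Knorm !mulr_sumr -big_split /=; apply: ler_sum => p _.
  have := onecos_sqr_le (ang th p - ph).
  move: (1 + cos _) (Kn _ _ _) (Kn n _ _) => c x y c4.
  apply: (@le_trans _ _ (N ^+ 2 * x ^+ 2 + c ^+ 2 * y ^+ 2)).
    rewrite -subr_ge0.
    have -> : N ^+ 2 * x ^+ 2 + c ^+ 2 * y ^+ 2 - 2 * N * (x * (c * y)) =
      (N * x - c * y) ^+ 2 by ring.
    exact: sqr_ge0.
  by rewrite lerD2l ler_wpM2r ?sqr_ge0.
have h3 : 2 * N * (N * Knorm n.+1 th ph) <= N ^+ 2 * Knorm n.+1 th ph + 4 * Knorm n th ph.
  by apply: le_trans h2; rewrite ler_wpM2l // mulr_ge0 ?ltW.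
rewrite -(lerD2l (N ^+ 2 * Knorm n.+1 th ph)); apply: le_trans h3.
by rewrite le_eqVlt; apply/orP; left; apply/eqP; ring.
Qed.

(** Iterate [KnormS] from K_0 = 1, whose orbit sum is the group order 4 k. *)
Lemma Knorm_le n th ph : Knorm n th ph <= 4 * k%:R * (2 ^+ n / n`!%:R) ^+ 2.
Proof.
elim: n => [|n IH].
  rewrite /Knorm expr0 fact0 divr1 expr1n mulr1.
  under eq_bigr do rewrite Kn0 expr1n.
  by rewrite sumr_const card_prod card_bool card_ord mulnA natrM.
have h1 : 0 < n.+1%:R ^+ 2 :> R by rewrite exprn_gt0.
rewrite -(ler_pM2l h1); apply: (le_trans (KnormS n th ph)).
apply: (@le_trans _ _ (4 * (4 * k%:R * (2 ^+ n / n`!%:R) ^+ 2))).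
  by rewrite ler_wpM2l.
rewrite le_eqVlt; apply/orP; left; apply/eqP.
have h2 : n`!%:R != 0 :> R by rewrite pnatr_eq0 -lt0n fact_gt0.
have h3 : n.+1%:R != 0 :> R by rewrite pnatr_eq0.
rewrite factS natrM [2 ^+ n.+1]exprS; move: h2 h3; move: (n.+1%:R) (n`!%:R) => x y hy hx.
by field; rewrite hx hy.
Qed.

(** At the point t x in the direction x every quotient of root products equals 1 / t, so multiplying
    the Dunkl equation by t leaves the root-free operator [Mop]. *)
Lemma dunkl_ray (E : cplx R -> cplx R -> R) rx ry th ph t :
  is_dunkl_kernel k al be E -> 0 < rx -> 0 < t -> sin ((2 * k)%:R * th) != 0 ->
  t * 'D_(polar rx th) (E^~ (polar ry ph)) (t *: polar rx th) =
  t * (rx * ry * cos (th - ph)) * E (polar (t * rx) th) (polar ry ph)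
  - Mop (fun x => E (polar (t * rx) x) (polar ry ph)) th.
Proof.
move=> dE rx0 t0 s0; have [_ [_ [+ _]]] := dE (polar ry ph).
have trx : t * rx != 0 by rewrite mulf_neq0 ?lt0r_neq0.
have reg : regular k (polar (t * rx) th).
  by apply: regular_polar => //; rewrite (ltn_trans _ k2).
move=> /(_ (polar rx th) _ reg); rewrite /dunkl cdot_polar scale_polar.
move/(congr1 (fun x => t * x)); rewrite mulrDr => hh.
have -> : Mop (fun x => E (polar (t * rx) x) (polar ry ph)) th =
  t * \sum_(j < 2 * k) kappa al be j * cdot (root_vec R k j) (polar rx th) *
       (E (polar (t * rx) th) (polar ry ph) -
        E (refl k j (polar (t * rx) th)) (polar ry ph)) /
       cdot (root_vec R k j) (polar (t * rx) th).
  rewrite /Mop mulr_sumr; apply: eq_bigr => j _; rewrite refl_polar.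
  have := reg j (ltn_ord j); rewrite !cdot_root_polar.
  move: (sin _) (E _ _) (E _ _) => S e1 e2; rewrite mulf_eq0 negb_or => /andP[_ S0].
  by field; rewrite S0 !lt0r_neq0.
by rewrite -mulrA -hh addrK.
Qed.

(** Being off the mirrors is invariant under the group, so the ray equation holds at all orbit
    points together. *)
Lemma sin_ang th p : sin ((2 * k)%:R * th) != 0 -> sin ((2 * k)%:R * ang th p) != 0.
Proof.
move=> s0; rewrite /ang.
have -> : (2 * k)%:R * ((if p.1 then - th else th) + p.2%:R * pi / k%:R) =
  (2 * k)%:R * (if p.1 then - th else th) + 2 * pi * p.2%:R.
  by rewrite natrM; field; exact: lt0r_neq0.
by rewrite sinD2pin; case: p.1; rewrite // mulrN sinN oppr_eq0.
Qed.

(** The partial sum solves the radial equation up to its last term: the Euler operator multiplies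
    the n-th term by n, and [Kn_recM] shifts the index by one. *)
Lemma Taylor_Mop N (rt : R) (th ph : R) :
  \sum_(n < N.+1) n%:R * (rt ^+ n * Kn n th ph) +
  Mop (fun x => \sum_(n < N.+1) rt ^+ n * Kn n x ph) th =
  rt * (1 + cos (th - ph)) *
   (\sum_(n < N.+1) rt ^+ n * Kn n th ph - rt ^+ N * Kn N th ph).
Proof.
rewrite (Mop_sum N.+1 (fun n x => rt ^+ n * Kn n x ph)) -big_split /=.
rewrite big_ord_recl mul0r add0r MopZ Mop_Kn0 mulr0 add0r.
rewrite [in RHS]big_ord_recr /= addrK mulr_sumr; apply: eq_bigr => n _.
rewrite /bump /= add1n MopZ exprS; transitivity (rt * rt ^+ n * (n.+1%:R * Kn n.+1 th ph +
   Mop (fun x => Kn n.+1 x ph) th)); first by ring.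
by rewrite Kn_recM; ring.
Qed.

(** The error is followed along the rays through all orbit points at once, because only the sum of
    squares over the orbit gives the difference part a sign. It starts from 0 and is driven by the
    single source term left by [Taylor_Mop]. *)
Lemma dunkl_kernel_energy (E : cplx R -> cplx R -> R) rx ry th ph N :
  is_dunkl_kernel k al be E -> 0 < rx -> 0 <= ry -> sin ((2 * k)%:R * th) != 0 ->
  (expR (rx * ry) * E (polar rx th) (polar ry ph)
   - \sum_(n < N.+1) (rx * ry) ^+ n * Kn n th ph) ^+ 2
  <= 4 * (rx * ry) ^+ 2 * ((rx * ry) ^+ N) ^+ 2 * Knorm N th ph
     * expR (4 * (rx * ry) + 1).
Proof.
move=> dE rx0 ry0 s0; set r := rx * ry; set y := polar ry ph.
have r0 : 0 <= r by rewrite mulr_ge0 // ltW.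
pose x0 p := polar rx (ang th p).
pose x t ps := expR (r * t) * E (polar (t * rx) ps) y
    - \sum_(n < N.+1) (r * t) ^+ n * Kn n ps ph.
pose X p t := x t (ang th p).
pose Y p t := expR (r * t) * (r * E (t *: x0 p) y + 'D_(x0 p) (E^~ y) (t *: x0 p))
    - \sum_(n < N.+1) n%:R * (r * t) ^+ n.-1 * r * Kn n (ang th p) ph.
have pe t : per (x t).
  move=> ps; rewrite /x /polar;
  have -> : cos (ps + 2 * pi) = cos ps by rewrite -[RHS](cosD2pin ps 1) mulr1.
  have -> : sin (ps + 2 * pi) = sin ps by rewrite -[RHS](sinD2pin ps 1) mulr1.
  by congr (_ - _); apply: eq_bigr => n _; rewrite Kn_per.
have dX p (t : R) : is_derive t 1 (X p) (Y p t).
  have d0 : is_derive t 1 (fun s : R => r * s) r.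
    by apply: (is_derive_eq (is_deriveZ r (is_derive_id t 1))); rewrite /GRing.scale /= mulr1.
  have d1 : is_derive t 1 (fun s => expR (r * s)) (expR (r * t) * r).
    exact: (is_derive1_comp (f := expR) (g := fun s => r * s)).
  have d2 : is_derive t 1 (fun s : R => E (s *: x0 p) y) ('D_(x0 p) (E^~ y) (t *: x0 p)).
    by apply: (@is_derive_ray _ _ (E^~ y)); case: (dE y).
  have d3 : is_derive t 1 (fun s => \sum_(n < N.+1) (r * s) ^+ n * Kn n (ang th p) ph)
      (\sum_(n < N.+1) n%:R * (r * t) ^+ n.-1 * r * Kn n (ang th p) ph).
    apply: is_derive_sum_seq => n.
    rewrite [X in is_derive _ _ X _](_ : _ = Kn n (ang th p) ph *: ((fun s : R => r * s) ^+ n)).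
      2: by apply/funext => s; rewrite !fctE mulrC.
    by apply: is_derive_eq; rewrite /GRing.scale /=; ring.
  rewrite [X in is_derive _ _ X _](_ : _ = (fun s => expR (r * s)) * (fun s : R => E (s *: x0 p) y)
    - (fun s => \sum_(n < N.+1) (r * s) ^+ n * Kn n (ang th p) ph)); last first.
    by apply/funext => s; rewrite /X /x !fctE /x0 scale_polar.
  apply: (is_derive_eq (is_deriveB (is_deriveM d1 d2) d3)).
  by rewrite /Y /GRing.scale /=; ring.
have X0 p : X p 0 = 0.
  rewrite /X /x mulr0 mul0r expR0 mul1r big_ord_recl expr0 mul1r Kn0 big1 ?addr0.
    by rewrite /polar !mul0r; have [_ [_ [_ ->]]] := dE y; rewrite subrr.
  by move=> n _; rewrite lift0 exprS !mul0r.
have tY p t : 0 < t -> t * Y p t = (r * t) * (1 + cos (ang th p - ph)) * X p t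
   - Mop (x t) (ang th p)
   + t * (r * (r * t) ^+ N * (1 + cos (ang th p - ph)) * Kn N (ang th p) ph).
  move=> t0.
  have hray : t * 'D_(x0 p) (E^~ y) (t *: x0 p) =
    t * (r * cos (ang th p - ph)) * E (polar (t * rx) (ang th p)) y
    - Mop (fun ps => E (polar (t * rx) ps) y) (ang th p).
    exact: (dunkl_ray ry ph dE rx0 t0 (sin_ang p s0)).
  have hT := Taylor_Mop N (r * t) (ang th p) ph.
  have hS : t * \sum_(n < N.+1) n%:R * (r * t) ^+ n.-1 * r * Kn n (ang th p) ph =
    \sum_(n < N.+1) n%:R * ((r * t) ^+ n * Kn n (ang th p) ph).
    rewrite mulr_sumr; apply: eq_bigr => -[[|n] hn] _ /=; first by rewrite !mul0r mulr0.
    by rewrite [in RHS]exprS; ring.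
  have hM : Mop (x t) (ang th p) =
    expR (r * t) * Mop (fun ps => E (polar (t * rx) ps) y) (ang th p)
    - Mop (fun ps => \sum_(n < N.+1) (r * t) ^+ n * Kn n ps ph) (ang th p).
    by rewrite /x MopB MopZ.
  have {}hT := canRL (addrK _) hT.
  rewrite /Y mulrBr hS mulrCA mulrDr hray {}hT hM /X /x scale_polar.
  ring.
have K0 : 0 <= Knorm N th ph by apply: sumr_ge0 => p _; exact: sqr_ge0.
have C0 : 0 <= 4 * r + 1 by rewrite addr_ge0 // mulr_ge0.
have Kp : 0 <= 4 * r ^+ 2 * (r ^+ N) ^+ 2 * Knorm N th ph.
  by apply: mulr_ge0 => //; apply: mulr_ge0; rewrite ?sqr_ge0 // mulr_ge0 ?sqr_ge0.
have ineq t : 0 < t < 1 -> \sum_p 2 * X p t * Y p t <=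
    (4 * r + 1) * (\sum_p X p t ^+ 2) + 4 * r ^+ 2 * (r ^+ N) ^+ 2 * Knorm N th ph.
  move=> /andP[t0 t1]; rewrite -(ler_pM2l t0) mulr_sumr.
  rewrite (eq_bigr (fun p => (2 * X p t * ((r * t) * (1 + cos (ang th p - ph)) * X p t +
      t * (r * (r * t) ^+ N * (1 + cos (ang th p - ph)) * Kn N (ang th p) ph)))
      - 2 * (x t (ang th p) * Mop (x t) (ang th p)))); last first.
    by move=> p _; rewrite mulrCA tY // -/(X p t); ring.
  rewrite sumrB -[X in _ - X]mulr_sumr.
  (* The difference part is discarded by its sign. *)
  apply: (@le_trans _ _ (\sum_p (2 * X p t * ((r * t) * (1 + cos (ang th p - ph)) * X p t +
      t * (r * (r * t) ^+ N * (1 + cos (ang th p - ph)) * Kn N (ang th p) ph))))).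
    by rewrite gerBl mulr_ge0 // Mop_psd.
  rewrite /Knorm !mulr_sumr -big_split mulr_sumr /=; apply: ler_sum => p _.
  have c0 := onecos_ge0 (ang th p - ph); have c2 := onecos_le2 (ang th p - ph).
  have cc := onecos_sqr_le (ang th p - ph).
  have rtN : ((r * t) ^+ N) ^+ 2 <= (r ^+ N) ^+ 2.
    have rt0 : 0 <= r * t by rewrite mulr_ge0 // ltW.
    have rtr : r * t <= r by rewrite ler_piMr // ltW.
    by rewrite ler_sqr ?nnegrE ?exprn_ge0 // lerXn2r ?nnegrE.
  move: (1 + cos _) c0 c2 cc (Kn _ _ _) (X p t) ((r * t) ^+ N) (r ^+ N) rtN.
  move=> c c0 c2 cc K z a b ab.
  (* Use 2 z w <= z^2 + w^2 with the source w = r a c K; then 0 <= c <= 2 yields the constants 4 r +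
     1 and 4 r^2. *)
  apply: (@le_trans _ _ (t * (2 * r * c * z ^+ 2 + (z ^+ 2 + (r * a * c * K) ^+ 2)))).
    rewrite -subr_ge0.
    have -> : t * (2 * r * c * z ^+ 2 + (z ^+ 2 + (r * a * c * K) ^+ 2)) -
     2 * z * (r * t * c * z + t * (r * a * c * K)) = t * (z - r * a * c * K) ^+ 2 by ring.
    by rewrite mulr_ge0 ?sqr_ge0 // ltW.
  rewrite ler_pM2l // addrA; apply: lerD.
    have -> : 2 * r * c * z ^+ 2 + z ^+ 2 = (2 * c * r + 1) * z ^+ 2 by ring.
    rewrite ler_wpM2r ?sqr_ge0 // lerD2r ler_wpM2r //.
    have -> : 4 = 2 * 2 :> R by rewrite -natrM.
    by rewrite ler_pM2l.
  have -> : (r * a * c * K) ^+ 2 = (c ^+ 2 * a ^+ 2) * (r ^+ 2 * K ^+ 2) by ring.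
  have -> : 4 * r ^+ 2 * b ^+ 2 * K ^+ 2 = (4 * b ^+ 2) * (r ^+ 2 * K ^+ 2) by ring.
  apply: ler_wpM2r; first by apply: mulr_ge0; exact: sqr_ge0.
  by apply: ler_pM; rewrite ?sqr_ge0.
have := gronwall C0 Kp dX X0 ineq; apply: le_trans.
have k20 : (0 < 2 * k)%N by rewrite muln_gt0 (ltn_trans _ k2).
(* Of the nonnegative squares only that of the given point itself, of index (false, 0), is kept. *)
rewrite (bigD1 (false, Ordinal k20)) //= /X /x /ang /= mul0r mul0r addr0 mulr1 mul1r.
by rewrite lerDl sumr_ge0 // => p _; exact: sqr_ge0.
Qed.

End DunklEstimate.

(** * Power series of the generalized Bessel function *)

Section BesselSeries.
Variables (R : realType) (k : nat) (al be : R).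
Hypotheses (k2 : (2 <= k)%N) (al0 : 0 < al) (be0 : 0 < be).
Let k0 : 0 < k%:R :> R. Proof. by rewrite ltr0n (ltn_trans _ k2). Qed.
Local Notation Kn := (Kn k al be).

Definition bessel_coef (n : nat) (th ph : R) : R :=
  Tmom al be (cos (k%:R * th) * cos (k%:R * ph)) (sin (k%:R * th) * sin (k%:R * ph))
    0 0 (amode k (al + be) n 0).

(** Its square dominates [dunkl_kernel_energy] combined with [Knorm_le], and its last factor is a
    term of an exponential series, hence tends to 0. *)
Let err (r : R) (N : nat) : R :=
  4 * k%:R * r * expR (2 * r + 1) * ((2 * r) ^+ N / N`!%:R).

Let err_cvg r : err r N @[N --> \oo] --> (0 : R).
Proof.
rewrite -[X in _ --> X](mulr0 (4 * k%:R * r * expR (2 * r + 1))).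
apply: cvgM; first exact: cvg_cst.
exact: (cvg_series_cvg_0 (is_cvg_series_exp_coeff (2 * r))).
Qed.

Let err_ge0 r N : 0 <= r -> 0 <= err r N.
Proof.
move=> r0; apply: mulr_ge0; last by rewrite divr_ge0 ?exprn_ge0 ?mulr_ge0.
by apply: mulr_ge0; rewrite ?expR_ge0 // mulr_ge0 // mulr_ge0 // ltW.
Qed.

Variable E : cplx R -> cplx R -> R.
Hypothesis dE : is_dunkl_kernel k al be E.

Lemma dunkl_kernel_approx rx ry th ph N :
  0 < rx -> 0 <= ry -> sin ((2 * k)%:R * th) != 0 ->
  `| expR (rx * ry) * E (polar rx th) (polar ry ph)
   - \sum_(n < N.+1) (rx * ry) ^+ n * Kn n th ph | <= err (rx * ry) N.
Proof.
move=> rx0 ry0 s0; have r0 : 0 <= rx * ry by rewrite mulr_ge0 // ltW.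
have := dunkl_kernel_energy k2 al0 be0 ph N dE rx0 ry0 s0.
move: (_ - _) => D hD; rewrite -(ler_sqr (normr_ge0 _) (err_ge0 _ r0)) //.
rewrite real_normK ?num_real //; apply: (le_trans hD).
set r := rx * ry in r0 *.
have k1 : 1 <= k%:R :> R by rewrite ler1n (ltn_trans _ k2).
apply: (@le_trans _ _ (4 * r ^+ 2 * (r ^+ N) ^+ 2 * (4 * k%:R * (2 ^+ N / N`!%:R) ^+ 2) *
   expR (4 * r + 1))).
  rewrite ler_wpM2r ?expR_ge0 // ler_wpM2l ?Knorm_le //.
  by apply: mulr_ge0; rewrite ?sqr_ge0 // mulr_ge0 ?sqr_ge0.
have -> : err r N ^+ 2 = (4 * r ^+ 2 * (r ^+ N) ^+ 2 * (4 * k%:R * (2 ^+ N / N`!%:R) ^+ 2)) *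
  (k%:R * expR (4 * r + 2)).
  rewrite /err exprMn -[4 * r + 2](_ : (2 * r + 1) + (2 * r + 1) = _) ?expRD; last by ring.
  by rewrite [(2 * r) ^+ N]exprMn; ring.
apply: ler_wpM2l.
  apply: mulr_ge0; last by rewrite mulr_ge0 ?sqr_ge0 // mulr_ge0 // ltW.
  by apply: mulr_ge0; rewrite ?sqr_ge0 // mulr_ge0 ?sqr_ge0.
apply: (@le_trans _ _ (expR (4 * r + 2))); last by rewrite ler_peMl ?expR_ge0.
by rewrite ler_expR lerD2l ler1n.
Qed.

(** The bound for the kernel does not depend on ph, so it survives averaging over the orbit of the
    second argument. *)
Lemma bessel_polar_approx_reg rx ry th ph N :
  0 < rx -> 0 <= ry -> sin ((2 * k)%:R * th) != 0 ->
  `| expR (rx * ry) * bessel k E (polar rx th) (polar ry ph)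
   - \sum_(n < N.+1) (rx * ry) ^+ n * bessel_coef n th ph | <= err (rx * ry) N.
Proof.
move=> rx0 ry0 s0; set r := rx * ry.
pose D ph' := expR r * E (polar rx th) (polar ry ph')
   - \sum_(n < N.+1) r ^+ n * Kn n th ph'.
have kk : 0 < 4 * k%:R :> R by rewrite mulr_gt0.
have -> : expR r * bessel k E (polar rx th) (polar ry ph)
   - \sum_(n < N.+1) r ^+ n * bessel_coef n th ph =
  (4 * k%:R)^-1 * \sum_(j < 2 * k) (D (ph + j%:R * pi / k%:R) + D (- ph + j%:R * pi / k%:R)).
  have -> : \sum_(n < N.+1) r ^+ n * bessel_coef n th ph =
    (4 * k%:R)^-1 * \sum_(j < 2 * k) \sum_(n < N.+1)
      r ^+ n * (Kn n th (ph + j%:R * pi / k%:R) + Kn n th (- ph + j%:R * pi / k%:R)).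
    rewrite exchange_big mulr_sumr /=; apply: eq_bigr => n _.
    rewrite -mulr_sumr sum_Kn_orbit // -/(bessel_coef n th ph).
    by field; exact: lt0r_neq0.
  rewrite /bessel mulrCA -mulrBr mulr_sumr -sumrB; congr (_ * _); apply: eq_bigr => j _.
  rewrite rot_polar refl_polar /D.
  under [X in _ - X = _]eq_bigr do rewrite mulrDr.
  by rewrite big_split /=; ring.
rewrite normrM normfV (ger0_norm (ltW kk)) mulrC ler_pdivrMr //.
apply: (le_trans (ler_norm_sum _ _ _)).
apply: (@le_trans _ _ (\sum_(j < 2 * k) (err r N + err r N))).
  apply: ler_sum => j _; apply: (le_trans (ler_normD _ _)).
  by apply: lerD; exact: dunkl_kernel_approx.
rewrite sumr_const card_ord -[_ *+ (2 * k)]mulr_natr natrM le_eqVlt; apply/orP; left; apply/eqP.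
by ring.
Qed.

Lemma continuous_polar (r th : R) : {for th, continuous (polar r)}.
Proof.
have h1 : r * cos x @[x --> th] --> r * cos th.
  by apply: cvgM; [exact: cvg_cst|exact: continuous_cos].
have h2 : r * sin x @[x --> th] --> r * sin th.
  by apply: cvgM; [exact: cvg_cst|exact: continuous_sin].
exact: cvg_pair h1 h2.
Qed.

Lemma continuous_sumR (I : Type) (s : seq I) (F : I -> R -> R) (x : R) :
  (forall i, F i y @[y --> x] --> F i x) ->
  \sum_(i <- s) F i y @[y --> x] --> \sum_(i <- s) F i x.
Proof.
move=> cF; elim: s => [|i s IH].
  rewrite big_nil; under eq_fun do rewrite big_nil.
  exact: cvg_cst.
rewrite big_cons; under eq_fun do rewrite big_cons.
exact: cvgD (cF i) IH.
Qed.

Lemma continuous_bessel_coef n ph th : {for th, continuous (fun x => bessel_coef n x ph)}.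
Proof.
have hk : k%:R * x @[x --> th] --> k%:R * th.
  by apply: cvgM; [exact: cvg_cst|exact: cvg_id].
have hc : cos (k%:R * x) * cos (k%:R * ph) @[x --> th] --> cos (k%:R * th) * cos (k%:R * ph).
  apply: cvgM; last exact: cvg_cst.
  exact: (@continuous_cvg _ _ _ _ _ _ cos _ (@continuous_cos R _) hk).
have hs : sin (k%:R * x) * sin (k%:R * ph) @[x --> th] --> sin (k%:R * th) * sin (k%:R * ph).
  apply: cvgM; last exact: cvg_cst.
  exact: (@continuous_cvg _ _ _ _ _ _ sin _ (@continuous_sin R _) hk).
apply: continuous_sumR => l; apply: cvgM; first exact: cvg_cst.
apply: continuous_sumR => i.
apply: cvgM; last exact: cvg_cst; apply: cvgM; last exact: cvg_cst.
apply: cvgM; [apply: cvgM; first exact: cvg_cst|].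
  exact: (@continuous_cvg _ _ _ _ _ _ (fun y : R => y ^+ i) _ (@exprn_continuous R i _) hc).
exact: (@continuous_cvg _ _ _ _ _ _ (fun y : R => y ^+ (l - i)) _ (@exprn_continuous R _ _) hs).
Qed.

Lemma bessel_polar_approx rx ry th ph N : 0 < rx -> 0 <= ry ->
  `| expR (rx * ry) * bessel k E (polar rx th) (polar ry ph)
   - \sum_(n < N.+1) (rx * ry) ^+ n * bessel_coef n th ph | <= err (rx * ry) N.
Proof.
move=> rx0 ry0.
have [sth|] := eqVneq (sin ((2 * k)%:R * th)) 0; last exact: bessel_polar_approx_reg.
set r := rx * ry.
pose D x := expR r * bessel k E (polar rx x) (polar ry ph)
   - \sum_(n < N.+1) r ^+ n * bessel_coef n x ph.
have cE y : {for th, continuous (fun x => E (polar rx x) y)}.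
  apply: (@continuous_comp _ _ _ (polar rx) (E^~ y)); first exact: continuous_polar.
  by apply: differentiable_continuous; case: (dE y).
have cD : {for th, continuous D}.
  apply: cvgB.
    apply: cvgM; first exact: cvg_cst.
    apply: cvgM; first exact: cvg_cst.
    by apply: continuous_sumR => j; apply: cvgD; exact: cE.
  apply: continuous_sumR => n; apply: cvgM; first exact: cvg_cst.
  exact: continuous_bessel_coef.
have cD' : `|D y| @[y --> th^'+] --> `|D th|.
  by apply: cvg_norm; exact: cvg_at_right_filter.
have K0 : 0 < (2 * k)%:R :> R by rewrite natrM mulr_gt0.
suff : `|D th| <= err r N by [].
apply: (closed_cvg (fun y => y <= err r N) (@closed_le _ (err r N)) _ _ cD').
near=> y; apply: bessel_polar_approx_reg => //.
have -> : y = (y - th) + th by rewrite subrK.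
rewrite mulrDr sinD sth mulr0 addr0 mulf_neq0 //.
  rewrite lt0r_neq0 //; apply: sin_gt0_pi; apply/andP; split.
    by rewrite mulr_gt0 // subr_gt0; near: y; exact: nbhs_right_gt.
  rewrite mulrC -ltr_pdivlMr // ltrBlDl; near: y; apply: nbhs_right_lt.
  by rewrite ltrDl; exact: divr_gt0 (pi_gt0 R) K0.
by rewrite -normr_eq0 sin0cos1 // oner_eq0.
Unshelve. all: by end_near. Qed.

Lemma bessel_series rx ry th ph : 0 <= rx -> 0 <= ry ->
  \sum_(n < N) (rx * ry) ^+ n * bessel_coef n th ph @[N --> \oo] -->
  expR (rx * ry) * bessel k E (polar rx th) (polar ry ph).
Proof.
move=> rx0 ry0; rewrite -cvg_shiftS.
(* At rx = 0 there is no ray to follow; only the zeroth coefficient counts there, and [sum_Kn_orbit]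
   shows that it is 1. *)
move: rx0; rewrite le_eqVlt => /predU1P[<-|rx0].
  have b0 : bessel k E (polar 0 th) (polar ry ph) = 1.
    rewrite /bessel /polar !mul0r.
    under eq_bigr => j _.
      have [_ [_ [_ ->]]] := dE (Defs.rot k j (ry * cos ph, ry * sin ph)).
      have [_ [_ [_ ->]]] := dE (refl k j (ry * cos ph, ry * sin ph)).
      over.
    rewrite sumr_const card_ord -[_ *+ (2 * k)]mulr_natr natrM.
    by field; exact: lt0r_neq0.
  rewrite mul0r expR0 mul1r b0; apply: cvg_near_cst; near=> N.
  rewrite /= big_ord_recl expr0 mul1r big1 ?addr0; last first.
    by move=> n _; rewrite lift0 exprS !mul0r.
  have := sum_Kn_orbit al be k2 0 th ph; rewrite -/(bessel_coef 0 th ph).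
  under eq_bigr do rewrite !Kn0.
  rewrite sumr_const card_ord -[_ *+ (2 * k)]mulr_natr natrM => h.
  apply: (@mulfI _ (4 * k%:R)); first by rewrite lt0r_neq0 // mulr_gt0.
  by rewrite -h; ring.
apply/cvgrPdist_le => e e0; near=> N.
apply: le_trans (bessel_polar_approx th ph N rx0 ry0) _.
have r0 : 0 <= rx * ry by rewrite mulr_ge0 // ltW.
rewrite -[X in X <= _](ger0_norm (err_ge0 N r0)) -[err _ _]subr0 -normrN opprB.
near: N; move/cvgrPdist_le: (err_cvg (rx * ry)) => /(_ _ e0); exact.
Unshelve. all: by end_near. Qed.

End BesselSeries.

(** * Substitution in improper integrals *)

Section Exhaustion.
Variable R : realType.
Local Notation mu := (@lebesgue_measure R).

Lemma bigcup_itv_oo (c d : R) (a_ b_ : nat -> R) :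
  (forall n, c < a_ n) -> (forall n, b_ n < d) ->
  a_ n @[n --> \oo] --> c -> b_ n @[n --> \oo] --> d ->
  \bigcup_n `[a_ n, b_ n]%classic = `]c, d[%classic.
Proof.
move=> ca bd ac bdc; apply/seteqP; split => x /=.
  move=> [n _] /=; rewrite !in_itv /= => /andP[ax xb].
  by rewrite (lt_le_trans (ca n) ax) (le_lt_trans xb (bd n)).
rewrite in_itv /= => /andP[cx xd].
have h1 : \forall n \near \oo, a_ n <= x by exact: (cvgr_le _ ac).
have h2 : \forall n \near \oo, x <= b_ n by exact: (cvgr_ge _ bdc).
have [N _ hN] : \forall n \near \oo, a_ n <= x /\ x <= b_ n by near=> n; split; near: n.
by exists N => //=; rewrite in_itv /=; have [-> ->] := hN N (leqnn N).
Unshelve. all: by end_near. Qed.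

Lemma bigcup_itv_oy (c : R) (a_ b_ : nat -> R) :
  (forall n, c < a_ n) ->
  a_ n @[n --> \oo] --> c -> b_ n @[n --> \oo] --> +oo ->
  \bigcup_n `[a_ n, b_ n]%classic = `]c, +oo[%classic.
Proof.
move=> ca ac bdc; apply/seteqP; split => x /=.
  move=> [n _] /=; rewrite !in_itv /= => /andP[ax xb].
  by rewrite (lt_le_trans (ca n) ax).
rewrite in_itv /= andbT => cx.
have h1 : \forall n \near \oo, a_ n <= x by exact: (cvgr_le _ ac).
have h2 : \forall n \near \oo, x <= b_ n by move/cvgryPge: bdc; apply.
have [N _ hN] : \forall n \near \oo, a_ n <= x /\ x <= b_ n by near=> n; split; near: n.
by exists N => //=; rewrite in_itv /=; have [-> ->] := hN N (leqnn N).
Unshelve. all: by end_near. Qed.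

(** Substitution on each compact interval, then monotone convergence to the union. Nonnegativity
    replaces integrability, so G may blow up at the ends, as the densities do for exponents below
    1. *)
Lemma ge0_substitution_exhaust (F F' G : R -> R) (a_ b_ : nat -> R) :
  (forall x : R, is_derive x 1 F (F' x)) -> continuous F' ->
  (forall n, a_ n <= b_ n) -> nonincreasing_seq a_ -> nondecreasing_seq b_ ->
  (forall n, {in `[a_ n, b_ n] &, {homo F : x y / x < y}}) ->
  (forall n x, x \in `[a_ n, b_ n] -> 0 <= F' x) ->
  (forall n x, x \in `[F (a_ n), F (b_ n)] -> {for x, continuous G}) ->
  (forall n x, x \in `[F (a_ n), F (b_ n)] -> 0 <= G x) ->
  (\int[mu]_(x in \bigcup_n `[F (a_ n), F (b_ n)]%classic) (G x)%:E =
   \int[mu]_(x in \bigcup_n `[a_ n, b_ n]%classic) (G (F x) * F' x)%:E)%E.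
Proof.
move=> dF cF' ab nia ndb incF F'0 cG G0.
have F'E : F^`()%classic = F'.
  by apply/funext => x; rewrite derive1E; exact: derive_val.
have cF x : {for x, continuous F}.
  by apply: differentiable_continuous; apply/derivable1_diffP; case: (dF x).
have incle n : {in `[a_ n, b_ n] &, {homo F : x y / x <= y}}.
  move=> x y xi yi; rewrite le_eqVlt => /predU1P[->//|xy].
  by apply: ltW; exact: (incF n _ _ xi yi xy).
have ain n : a_ n \in `[a_ n, b_ n] by rewrite in_itv /= lexx ab.
have bin n : b_ n \in `[a_ n, b_ n] by rewrite in_itv /= lexx ab.
have Fin n x : x \in `[a_ n, b_ n] -> F x \in `[F (a_ n), F (b_ n)].
  move=> xi; rewrite in_itv /=; have := xi; rewrite in_itv /= => /andP[h1 h2].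
  by rewrite !(incle n).
have sub m n : (m <= n)%N -> {subset `[a_ m, b_ m] <= `[a_ n, b_ n]}.
  move=> mn x; rewrite !in_itv /= => /andP[h1 h2].
  by rewrite (le_trans (nia _ _ mn) h1) (le_trans h2 (ndb _ _ mn)).
have eqn n : (\int[mu]_(x in `[F (a_ n), F (b_ n)]) (G x)%:E =
   \int[mu]_(x in `[a_ n, b_ n]) (G (F x) * F' x)%:E)%E.
  rewrite integration_by_substitution_increasing //; first by rewrite F'E.
  - by rewrite F'E => x _; exact: cF'.
  - by rewrite F'E; apply/cvg_ex; exists (F' (a_ n)); apply: cvg_at_right_filter; exact: cF'.
  - by rewrite F'E; apply/cvg_ex; exists (F' (b_ n)); apply: cvg_at_left_filter; exact: cF'.
  - split; first by move=> x _; case: (dF x).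
      by apply: cvg_at_right_filter; exact: cF.
    by apply: cvg_at_left_filter; exact: cF.
  - by apply: continuous_in_subspaceT => x; rewrite inE => xi; exact: (cG n).
have mG n : measurable_fun `[F (a_ n), F (b_ n)]%classic (EFin \o G).
  apply/measurable_EFinP; apply: subspace_continuous_measurable_fun => //.
  by apply: continuous_in_subspaceT => x; rewrite inE => xi; exact: (cG n).
have mGF n : measurable_fun `[a_ n, b_ n]%classic (EFin \o (fun x => G (F x) * F' x)).
  apply/measurable_EFinP; apply: subspace_continuous_measurable_fun => //.
  apply: continuous_in_subspaceT => x; rewrite inE => xi.
  apply: cvgM; last exact: cF'.
  by apply: (@continuous_comp _ _ _ F G); [exact: cF|apply: (cG n); exact: Fin].
have l1 : (\int[mu]_(x in `[F (a_ n), F (b_ n)]) (G x)%:E @[n --> \oo] -->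
    \int[mu]_(x in \bigcup_n `[F (a_ n), F (b_ n)]%classic) (G x)%:E)%E.
  apply: ge0_nondecreasing_set_cvg_integral => //.
  move=> m n mn; rewrite subsetEset => x /=; rewrite !in_itv /= => /andP[h1 h2].
    rewrite (le_trans _ h1) /=; last first.
      by apply: (incle n) => //; [exact: (sub _ _ mn)|exact: nia].
    by rewrite (le_trans h2) //; apply: (incle n) => //; [exact: (sub _ _ mn)|exact: ndb].
have l2 : (\int[mu]_(x in `[a_ n, b_ n]) (G (F x) * F' x)%:E @[n --> \oo] -->
    \int[mu]_(x in \bigcup_n `[a_ n, b_ n]%classic) (G (F x) * F' x)%:E)%E.
  apply: ge0_nondecreasing_set_cvg_integral => //.
  - by move=> m n mn; rewrite subsetEset => x /=; exact: sub.
  - move=> n x /= xi; rewrite lee_fin mulr_ge0 //; last exact: (F'0 n).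
    by apply: (G0 n); exact: Fin.
move: l1; under eq_fun do rewrite eqn.
by move=> l1; exact: cvg_unique l1 l2.
Qed.

End Exhaustion.

(** * Translation, scaling and squaring on open intervals *)

Section Substitutions.
Variable R : realType.
Local Notation mu := (@lebesgue_measure R).

Let h1 (n : nat) : R := n.+1%:R^-1.
(** Starting at 1/2 keeps [h2 n, 1 - h2 n] nonempty and inside ]0, 1[ for every n. *)
Let h2 (n : nat) : R := n.+2%:R^-1.

Let h1_gt0 n : 0 < h1 n. Proof. by rewrite invr_gt0. Qed.
Let h2_gt0 n : 0 < h2 n. Proof. by rewrite invr_gt0. Qed.
Let h1_le1 n : h1 n <= 1. Proof. by rewrite invf_le1 // ler1n. Qed.
Let h2_lt1 n : h2 n < 1. Proof. by rewrite invf_lt1 // ltr1n. Qed.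
Let h2_half n : h2 n <= 1 - h2 n.
Proof.
rewrite lerBrDr -mulr2n -mulr_natl ler_pdivrMr // mul1r ler_nat.
by rewrite -[2%N]addn0 -addn2 addnC leq_add2l.
Qed.
Let h1_cvg : h1 n @[n --> \oo] --> (0 : R). Proof. exact: cvg_harmonic. Qed.
Let h2_cvg : h2 n @[n --> \oo] --> (0 : R).
Proof. by have := h1_cvg; rewrite -(cvg_shiftS h1). Qed.
Let h1_noninc : nonincreasing_seq h1.
Proof. by move=> m n mn; rewrite lef_pV2 ?posrE // ler_nat. Qed.
Let h2_noninc : nonincreasing_seq h2.
Proof. by move=> m n mn; rewrite lef_pV2 ?posrE // ler_nat. Qed.
Let natS_cvg : (n.+1%:R : R) @[n --> \oo] --> +oo.
Proof. by have := @cvgr_idn R; rewrite -(cvg_shiftS (fun n => n%:R : R)). Qed.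

Lemma ge0_translation_y (G : R -> R) (c : R) :
  (forall x, 0 < x -> {for x, continuous G}) -> (forall x, 0 <= G x) ->
  (\int[mu]_(x in `]0%R, +oo[) (G x)%:E = \int[mu]_(x in `]c, +oo[) (G (x - c))%:E)%E.
Proof.
move=> cG G0; pose a_ n := c + h1 n; pose b_ n : R := c + n.+1%:R.
pose F (x : R) := x - c.
have Fa n : F (a_ n) = h1 n by rewrite /F /a_ addrC addKr.
have Fb n : F (b_ n) = n.+1%:R by rewrite /F /b_ addrC addKr.
have -> : `]0%R, +oo[%classic = \bigcup_n `[F (a_ n), F (b_ n)]%classic.
  apply/esym/bigcup_itv_oy; first by move=> n; rewrite Fa.
    by under eq_fun do rewrite Fa; exact: h1_cvg.
  by under eq_fun do rewrite Fb; exact: natS_cvg.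
have -> : `]c, +oo[%classic = \bigcup_n `[a_ n, b_ n]%classic.
  apply/esym/bigcup_itv_oy; first by move=> n; rewrite ltrDl.
    by rewrite -[X in _ --> X]addr0; apply: cvgD; [exact: cvg_cst|exact: h1_cvg].
  apply/cvgryPge => A; near=> n; rewrite -lerBlDl; near: n.
  by move/cvgryPge: natS_cvg; apply.
have dF (x : R) : is_derive x 1 F 1.
  rewrite [X in is_derive _ _ X _](_ : _ = id - cst c) //.
  by apply: is_derive_eq; rewrite subr0.
rewrite (@ge0_substitution_exhaust _ F (fun=> 1) G a_ b_ dF).
- by apply: eq_integral => x _; rewrite mulr1.
- by move=> x; exact: cvg_cst.
- by move=> n; rewrite lerD2l (le_trans (h1_le1 n)) // ler1n.
- by move=> m n mn; rewrite lerD2l; exact: h1_noninc.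
- by move=> m n mn; rewrite lerD2l ler_nat.
- by move=> n x y _ _ xy; rewrite /F ltrD2r.
- by move=> n x _.
- move=> n x; rewrite Fa Fb in_itv /= => /andP[hx _]; apply: cG.
  exact: lt_le_trans hx.
- by move=> n x _.
Unshelve. all: by end_near. Qed.

Lemma ge0_scaling_oo (G : R -> R) (s : R) : 0 < s ->
  (forall x, 0 < x < s -> {for x, continuous G}) -> (forall x, 0 <= G x) ->
  (\int[mu]_(x in `]0%R, s[) (G x)%:E = \int[mu]_(x in `]0%R, 1%R[) (G (s * x) * s)%:E)%E.
Proof.
move=> s0 cG G0; pose a_ n := h2 n; pose b_ n : R := 1 - h2 n.
pose F (x : R) := s * x.
have a01 n : 0 < s * a_ n by rewrite mulr_gt0.
have b01 n : s * b_ n < s by rewrite gtr_pMr // gtrBl.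
have acvg : a_ n @[n --> \oo] --> (0 : R) by exact: h2_cvg.
have bcvg : b_ n @[n --> \oo] --> (1 : R).
  by rewrite -[X in _ --> X]subr0; apply: cvgB; [exact: cvg_cst|exact: h2_cvg].
have -> : `]0%R, s[%classic = \bigcup_n `[F (a_ n), F (b_ n)]%classic.
  apply/esym/bigcup_itv_oo => //.
    by rewrite -[X in _ --> X](mulr0 s); apply: cvgM; first exact: cvg_cst.
  by rewrite -[X in _ --> X](mulr1 s); apply: cvgM; first exact: cvg_cst.
have -> : `]0%R, 1%R[%classic = \bigcup_n `[a_ n, b_ n]%classic.
  by apply/esym/bigcup_itv_oo => // n; rewrite gtrBl.
have dF (x : R) : is_derive x 1 F s.
  rewrite [X in is_derive _ _ X _](_ : _ = s *: id) //.
  by apply: is_derive_eq; rewrite /GRing.scale /= mulr1.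
rewrite (@ge0_substitution_exhaust _ F (fun=> s) G a_ b_ dF) //.
- by move=> x; exact: cvg_cst.
- by move=> m n mn; rewrite lerD2l lerN2; exact: h2_noninc.
- by move=> n x y _ _ xy; rewrite /F ltr_pM2l.
- by move=> n x _; exact: ltW.
- move=> n x; rewrite in_itv /= => /andP[hx hx']; apply: cG.
  by rewrite (lt_le_trans (a01 n) hx) (le_lt_trans hx' (b01 n)).
Qed.

Lemma is_derive_sqr (x : R) : is_derive x 1 (fun u : R => u ^+ 2) (2 * x).
Proof.
rewrite [X in is_derive _ _ X _](_ : _ = id ^+ 2) //.
by apply: is_derive_eq; rewrite /GRing.scale /= expr1 mulr1.
Qed.

Lemma ge0_square_oy (G : R -> R) :
  (forall x, 0 < x -> {for x, continuous G}) -> (forall x, 0 <= G x) ->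
  (\int[mu]_(x in `]0%R, +oo[) (G x)%:E =
   \int[mu]_(x in `]0%R, +oo[) (G (x ^+ 2) * (2 * x))%:E)%E.
Proof.
move=> cG G0; pose a_ n := h1 n; pose b_ n : R := n.+1%:R.
pose F (x : R) := x ^+ 2.
have Fa0 n : 0 < F (a_ n) by rewrite exprn_gt0.
have e1 : `]0%R, +oo[%classic = \bigcup_n `[F (a_ n), F (b_ n)]%classic.
  apply/esym/bigcup_itv_oy => //.
    have -> : 0 = 0 ^+ 2 :> R by rewrite expr0n.
    exact: (@continuous_cvg _ _ _ _ _ _ F _ (@exprn_continuous R 2 _) h1_cvg).
  apply/cvgryPge => A; near=> n; apply: (@le_trans _ _ (b_ n)).
    by near: n; move/cvgryPge: natS_cvg; apply.
  by rewrite /F expr2 ler_peMl // ler1n.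
have e2 : `]0%R, +oo[%classic = \bigcup_n `[a_ n, b_ n]%classic.
  exact/esym/bigcup_itv_oy.
rewrite [in RHS]e2 e1 (@ge0_substitution_exhaust _ F (fun x => 2 * x) G a_ b_ is_derive_sqr) //.
- by move=> x; apply: cvgM; [exact: cvg_cst|exact: cvg_id].
- by move=> n; rewrite (le_trans (h1_le1 n)) // ler1n.
- by move=> m n mn; rewrite ler_nat.
- move=> n x y; rewrite !in_itv /= => /andP[x0 _] /andP[y0 _] xy.
  by rewrite /F ltr_sqr // nnegrE (le_trans _ x0, le_trans _ y0) // ltW.
- move=> n x; rewrite in_itv /= => /andP[hx _]; rewrite mulr_ge0 //.
  by rewrite (le_trans _ hx) // ltW.
- move=> n x; rewrite in_itv /= => /andP[hx _]; apply: cG.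
  exact: lt_le_trans (Fa0 n) hx.
Unshelve. all: by end_near. Qed.

Lemma ge0_square_oo (G : R -> R) :
  (forall x, 0 < x < 1 -> {for x, continuous G}) -> (forall x, 0 <= G x) ->
  (\int[mu]_(x in `]0%R, 1%R[) (G x)%:E =
   \int[mu]_(x in `]0%R, 1%R[) (G (x ^+ 2) * (2 * x))%:E)%E.
Proof.
move=> cG G0; pose a_ n := h2 n; pose b_ n : R := 1 - h2 n.
pose F (x : R) := x ^+ 2.
have Fa0 n : 0 < F (a_ n) by rewrite exprn_gt0.
have b0 n : 0 <= b_ n by rewrite subr_ge0 ltW.
have b1 n : b_ n < 1 by rewrite gtrBl.
have Fb1 n : F (b_ n) < 1 by rewrite expr_lt1.
have bcvg : b_ n @[n --> \oo] --> (1 : R).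
  by rewrite -[X in _ --> X]subr0; apply: cvgB; [exact: cvg_cst|exact: h2_cvg].
have e1 : `]0%R, 1%R[%classic = \bigcup_n `[F (a_ n), F (b_ n)]%classic.
  apply/esym/bigcup_itv_oo => //.
    have -> : 0 = 0 ^+ 2 :> R by rewrite expr0n.
    exact: (@continuous_cvg _ _ _ _ _ _ F _ (@exprn_continuous R 2 _) h2_cvg).
  have -> : 1 = 1 ^+ 2 :> R by rewrite expr1n.
  exact: (@continuous_cvg _ _ _ _ _ _ F _ (@exprn_continuous R 2 _) bcvg).
have e2 : `]0%R, 1%R[%classic = \bigcup_n `[a_ n, b_ n]%classic.
  exact/esym/bigcup_itv_oo.
rewrite [in RHS]e2 e1 (@ge0_substitution_exhaust _ F (fun x => 2 * x) G a_ b_ is_derive_sqr) //.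
- by move=> x; apply: cvgM; [exact: cvg_cst|exact: cvg_id].
- by move=> m n mn; rewrite lerD2l lerN2; exact: h2_noninc.
- move=> n x y; rewrite !in_itv /= => /andP[x0 _] /andP[y0 _] xy.
  by rewrite /F ltr_sqr // nnegrE (le_trans _ x0, le_trans _ y0) // ltW.
- move=> n x; rewrite in_itv /= => /andP[hx _]; rewrite mulr_ge0 //.
  by rewrite (le_trans _ hx) // ltW.
- move=> n x; rewrite in_itv /= => /andP[hx hx']; apply: cG.
  by rewrite (lt_le_trans (Fa0 n) hx) (le_lt_trans hx' (Fb1 n)).
Qed.

(* Improper at 0 when a < 1. *)
Lemma integral_powR01 (a : R) : 0 < a ->
  (\int[mu]_(x in `]0%R, 1%R[) (x `^ (a - 1))%:E = (a^-1)%:E)%E.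
Proof.
move=> a0; pose a_ n := h2 n; pose b_ n : R := 1 - h2 n.
have b0 n : 0 < b_ n by rewrite subr_gt0.
have b1 n : b_ n < 1 by rewrite gtrBl.
have bcvg : b_ n @[n --> \oo] --> (1 : R).
  by rewrite -[X in _ --> X]subr0; apply: cvgB; [exact: cvg_cst|exact: h2_cvg].
have e : `]0%R, 1%R[%classic = \bigcup_n `[a_ n, b_ n]%classic.
  exact/esym/bigcup_itv_oo.
have cp (p x : R) : 0 < x -> {for x, continuous (fun y => y `^ p)}.
  move=> x0; apply: differentiable_continuous; apply/derivable1_diffP.
  by apply: derivable_powR; rewrite in_itv /= x0.
have eqn n : (\int[mu]_(x in `[a_ n, b_ n]) (x `^ (a - 1))%:E =
    (a^-1 * (b_ n `^ a) - a^-1 * (a_ n `^ a))%:E)%E.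
  (* For n = 0 the interval is the single point 1/2. *)
  have [ab|] := eqVneq (a_ n) (b_ n).
    by rewrite -ab set_itv1 integral_set1 subrr.
  move=> nab; have ab : a_ n < b_ n by rewrite lt_neqAle nab h2_half.
  have dF (x : R) : 0 < x -> is_derive x 1 (fun y => a^-1 * y `^ a) (x `^ (a - 1)).
    move=> x0; rewrite [X in is_derive _ _ X _](_ : _ = a^-1 *: (@powR R ^~ a)) //.
    by apply: (is_derive_eq (is_deriveZ _ (is_derive1_powR a x0))); rewrite scalerA mulVf ?lt0r_neq0 // scale1r.
  rewrite (@continuous_FTC2 _ _ (fun y => a^-1 * y `^ a)) // ?EFinB //.
  - apply: continuous_in_subspaceT => x; rewrite inE /= in_itv /= => /andP[hx _].
    by apply: cp; apply: lt_le_trans hx; exact: h2_gt0.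
  - split.
    + move=> x; rewrite in_itv /= => /andP[hx _].
      by case: (dF x (lt_trans (h2_gt0 n) hx)).
    + apply: cvg_at_right_filter; apply: cvgM; first exact: cvg_cst.
      by apply: cp; exact: h2_gt0.
    + apply: cvg_at_left_filter; apply: cvgM; first exact: cvg_cst.
      by apply: cp.
  - move=> x; rewrite in_itv /= => /andP[hx _]; rewrite derive1E.
    exact: (@derive_val _ _ _ _ _ _ _ (dF x (lt_trans (h2_gt0 n) hx))).
have l1 : (\int[mu]_(x in `[a_ n, b_ n]) (x `^ (a - 1))%:E @[n --> \oo] -->
    \int[mu]_(x in \bigcup_n `[a_ n, b_ n]%classic) (x `^ (a - 1))%:E)%E.
  apply: ge0_nondecreasing_set_cvg_integral => //.
  - move=> m n mn; rewrite subsetEset => x /=; rewrite !in_itv /= => /andP[hx hx'].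
    apply/andP; split; first exact: le_trans (h2_noninc mn) hx.
    by apply: (le_trans hx'); rewrite lerD2l lerN2; exact: h2_noninc.
  - move=> n; apply/measurable_EFinP; apply: measurable_funTS; exact: measurable_powR.
  - by move=> n x _; rewrite lee_fin powR_ge0.
have l2 : ((a^-1 * (b_ n `^ a) - a^-1 * (a_ n `^ a))%:E @[n --> \oo] --> (a^-1)%:E)%E.
  apply: cvg_EFin; first by near=> n.
  rewrite (_ : _ \o _ = fun n => a^-1 * (b_ n `^ a) - a^-1 * (a_ n `^ a)) //.
  rewrite -[X in _ --> X]subr0 -[X in _ --> X - _]mulr1 -[X in _ --> _ - X](mulr0 a^-1).
  apply: cvgB; apply: cvgM; try exact: cvg_cst.
    have <- : (1 : R) `^ a = 1 by rewrite powR1.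
    exact: (@continuous_cvg _ _ _ _ _ _ (fun y : R => y `^ a) _ (cp a 1 ltr01) bcvg).
  move/cvg_at_rightP: (powR_cvg0 a0); apply; split; [exact: h2_gt0|exact: h2_cvg].
rewrite e; move: l1; under eq_fun do rewrite eqn.
by move=> l1; exact: cvg_unique l1 l2.
Unshelve. all: by end_near. Qed.

End Substitutions.

(** * Gamma and beta integrals *)

Section GammaBeta.
Variable R : realType.
Local Notation mu := (@lebesgue_measure R).
Local Open Scope ereal_scope.

Definition gfun (a t : R) : R := (t `^ (a - 1) * expR (- t))%R.
(** Kept in the extended reals, because [gint_mul] comes before finiteness and is used to prove
    it. *)
Definition gint (a : R) : \bar R := \int[mu]_(t in `]0%R, +oo[) (gfun a t)%:E.
Definition bint (a b : R) : \bar R :=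
  \int[mu]_(x in `]0%R, 1%R[) (x `^ (a - 1) * (1 - x) `^ (b - 1))%:E.

Lemma gfun_ge0 a t : (0 <= gfun a t)%R.
Proof. by rewrite mulr_ge0 ?powR_ge0 ?expR_ge0. Qed.

Lemma measurable_gfun a : measurable_fun [set: R] (gfun a).
Proof.
apply: measurable_funM; first exact: measurable_powR.
by apply: measurableT_comp => //; exact: measurable_expR.
Qed.

Lemma continuous_powRp (p x : R) : (0 < x)%R -> {for x, continuous (fun y : R => (y `^ p)%R)}.
Proof.
move=> x0; apply: differentiable_continuous; apply/derivable1_diffP.
by apply: derivable_powR; rewrite in_itv /= x0.
Qed.

Lemma continuous_gfun (a : R) (x : R) : (0 < x)%R -> {for x, continuous (gfun a)}.
Proof.
move=> x0; apply: cvgM; first exact: continuous_powRp.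
apply: (@continuous_comp _ _ _ (fun y : R => - y)%R expR); first exact: continuousN.
exact: continuous_expR.
Qed.

Lemma gint_ge0 a : 0 <= gint a.
Proof. by apply: integral_ge0 => t _; rewrite lee_fin gfun_ge0. Qed.

Lemma bint_ge0 a b : 0 <= bint a b.
Proof. by apply: integral_ge0 => t _; rewrite lee_fin mulr_ge0 ?powR_ge0. Qed.

Lemma measurable_bfun (a b s : R) :
  measurable_fun [set: R] (fun x : R => x `^ (a - 1) * (s - x) `^ (b - 1))%R.
Proof.
apply: measurable_funM; first exact: measurable_powR.
apply: (measurableT_comp (measurable_powR (b - 1))).
by apply: measurable_funB => //; exact: measurable_cst.
Qed.

Lemma beta_scaling (a b s : R) : (0 < s)%R ->
  \int[mu]_(x in `]0%R, s[) (x `^ (a - 1) * (s - x) `^ (b - 1))%:E =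
  (s `^ (a + b - 1))%:E * bint a b.
Proof.
move=> s0; rewrite (@ge0_scaling_oo _ (fun x => x `^ (a - 1) * (s - x) `^ (b - 1))%R) //; last 2 first.
- move=> x /andP[x0 xs]; apply: cvgM; first exact: continuous_powRp.
  apply: (@continuous_comp _ _ _ (fun y => s - y)%R (fun y => y `^ (b - 1))%R).
    by apply: cvgB; [exact: cvg_cst|exact: cvg_id].
  by apply: continuous_powRp; rewrite subr_gt0.
- by move=> x; rewrite mulr_ge0 ?powR_ge0.
rewrite /bint -ge0_integralZl_EFin ?powR_ge0 //; last 2 first.
- by move=> x _; rewrite lee_fin mulr_ge0 ?powR_ge0.
- by apply/measurable_EFinP; apply: measurable_funTS; exact: measurable_bfun.
apply: eq_integral => x; rewrite inE /= in_itv /= => /andP[x0 x1].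
have -> : (s - s * x = s * (1 - x))%R by ring.
rewrite !powRM ?ltW // ?subr_gt0 // -EFinM; congr EFin.
have -> : (s `^ (a + b - 1) = s `^ (a - 1) * s `^ (b - 1) * s)%R.
  rewrite -[in X in (_ * X)%R](powRr1 (ltW s0)) -!powRD ?lt0r_neq0 ?implybT //.
  by congr powR; ring.
by ring.
Qed.

Lemma gintZ (a : R) (c : \bar R) : 0 <= c ->
  c * gint a = \int[mu]_(t in `]0%R, +oo[) (c * (gfun a t)%:E).
Proof.
move=> c0; rewrite ge0_integralZl //.
- by apply/measurable_EFinP; apply: measurable_funTS; exact: measurable_gfun.
- by move=> t _; rewrite lee_fin gfun_ge0.
Qed.

Lemma integral_oy_mkcond (f g : R -> \bar R) :
  (forall x, (0 < x)%R -> g x = f x) -> (forall x, ~~ (0 < x)%R -> g x = 0) ->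
  \int[mu]_(x in `]0%R, +oo[) f x = \int[mu]_x g x.
Proof.
move=> gf g0; rewrite integral_mkcond; congr (integral _ _ _); apply/funext => x.
rewrite patchE; case: ifPn; rewrite ?inE ?notin_setE /= in_itv /= andbT.
  by move=> x0; rewrite gf.
by move=> /negP x0; rewrite g0.
Qed.

Let conv_fun (a b : R) (z : R * R) : R :=
  (if (0 < z.1) && (z.1 < z.2) then z.1 `^ (a - 1) * (z.2 - z.1) `^ (b - 1) * expR (- z.2)
  else 0)%R.

Let conv_fun_ge0 a b z : (0 <= conv_fun a b z)%R.
Proof.
by rewrite /conv_fun; case: ifP => // _; rewrite !mulr_ge0 ?powR_ge0 ?expR_ge0.
Qed.

Let measurable_conv_fun a b : measurable_fun [set: R * R] (conv_fun a b).
Proof.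
have m1 : measurable_fun [set: R * R] (fst : R * R -> R) by exact: measurable_fst.
have m2 : measurable_fun [set: R * R] (snd : R * R -> R) by exact: measurable_snd.
apply: measurable_fun_if => //.
- apply: measurable_and; apply: measurable_fun_ltr => //; exact: measurable_cst.
- apply: measurable_funTS; apply: measurable_funM; first apply: measurable_funM.
  + exact: (measurableT_comp (measurable_powR (a - 1))).
  + by apply: (measurableT_comp (measurable_powR (b - 1))); exact: measurable_funB.
  + apply: (measurableT_comp (@measurable_expR R)).
    by apply: measurableT_comp.
Qed.

Let conv_fun_le0 (a b x : R) : ~~ (0 < x)%R -> \int[mu]_y (conv_fun a b (x, y))%:E = 0.
Proof.
by move=> x0; apply: integral0_eq => y _; rewrite /conv_fun /= (negbTE x0).
Qed.

Let conv_fun_inner (a b x : R) : (0 < x)%R ->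
  \int[mu]_y (conv_fun a b (x, y))%:E = gint b * (gfun a x)%:E.
Proof.
move=> x0; rewrite muleC /gint (ge0_translation_y x (@continuous_gfun b) (gfun_ge0 b)).
rewrite -ge0_integralZl_EFin; last 4 first.
- exact: measurable_itv.
- by move=> t _; rewrite lee_fin gfun_ge0.
- apply/measurable_EFinP; apply: measurable_funTS.
  apply: (measurableT_comp (measurable_gfun b)).
  by apply: measurable_funB => //; exact: measurable_cst.
- exact: gfun_ge0.
rewrite [RHS]integral_mkcond; apply: eq_integral => y _; rewrite patchE.
rewrite /conv_fun /= x0 /=; case: ifPn => [xy|/negbTE xy].
  rewrite mem_set /= ?in_itv /= ?xy // -EFinM; congr EFin; rewrite /gfun.
  have -> : (expR (- y) = expR (- x) * expR (- (y - x)))%R.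
    by rewrite -expRD; congr expR; ring.
  by ring.
by rewrite memNset //= in_itv /= xy.
Qed.

Let conv_fun_outer (a b y : R) : (0 < y)%R ->
  \int[mu]_x (conv_fun a b (x, y))%:E = bint a b * (gfun (a + b) y)%:E.
Proof.
move=> y0.
have -> : bint a b * (gfun (a + b) y)%:E = (expR (- y))%:E * ((y `^ (a + b - 1))%:E * bint a b).
  by rewrite muleA -EFinM muleC /gfun mulrC.
rewrite -beta_scaling // -ge0_integralZl_EFin; last 4 first.
- exact: measurable_itv.
- by move=> x _; rewrite lee_fin mulr_ge0 ?powR_ge0.
- by apply/measurable_EFinP; apply: measurable_funTS; exact: measurable_bfun.
- exact: expR_ge0.
rewrite [RHS]integral_mkcond; apply: eq_integral => x _; rewrite patchE /conv_fun /=.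
case: ifPn => [xy|/negbTE xy].
  rewrite mem_set /=; last by rewrite in_itv.
  by rewrite -EFinM mulrC.
by rewrite memNset //= in_itv /= xy.
Qed.

Let conv_fun_outer0 (a b y : R) : ~~ (0 < y)%R -> \int[mu]_x (conv_fun a b (x, y))%:E = 0.
Proof.
move=> y0; apply: integral0_eq => x _; rewrite /conv_fun /=.
case: ifP => // /andP[x0 xy].
by case/negP: y0; exact: lt_trans x0 xy.
Qed.

(* Tonelli for x^(a-1) (y-x)^(b-1) e^(-y) on 0 < x < y. *)
Lemma gint_mul (a b : R) : gint a * gint b = bint a b * gint (a + b).
Proof.
have mc : measurable_fun [set: R * R] (EFin \o conv_fun a b).
  by apply/measurable_EFinP; exact: measurable_conv_fun.
have h : \int[mu]_x \int[mu]_y (conv_fun a b (x, y))%:E =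
         \int[mu]_y \int[mu]_x (conv_fun a b (x, y))%:E.
  apply: (@fubini_tonelli _ _ _ _ R mu mu (EFin \o conv_fun a b)) => // z.
  by rewrite lee_fin.
rewrite muleC gintZ; last exact: gint_ge0.
rewrite gintZ; last exact: bint_ge0.
rewrite (@integral_oy_mkcond _ (fun x => \int[mu]_y (conv_fun a b (x, y))%:E)).
- rewrite (@integral_oy_mkcond _ (fun y => \int[mu]_x (conv_fun a b (x, y))%:E)).
  + exact: h.
  + exact: conv_fun_outer.
  + exact: conv_fun_outer0.
- exact: conv_fun_inner.
- exact: conv_fun_le0.
Qed.

Lemma gint1 : gint 1 = 1.
Proof.
have dN (x : R) : is_derive x 1%R (fun y : R => - expR (- y))%R (expR (- x)).
  have d1 : is_derive x 1%R (fun y : R => expR (- y)) (expR (- x) * -1)%R.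
    exact: (is_derive1_comp (f := expR) (g := fun y : R => - y)%R).
  by apply: (is_derive_eq (is_deriveN d1)); rewrite mulrN1 opprK.
rewrite /gint integral_itv_obnd_cbnd; last first.
  by apply/measurable_EFinP; apply: measurable_funTS; exact: measurable_gfun.
under eq_integral do rewrite /gfun subrr powRr0 mul1r.
rewrite (@ge0_continuous_FTC2y _ _ (fun x => - expR (- x))%R _ 0%R).
- by rewrite oppr0 expR0 EFinN oppeK add0e.
- by move=> x _; exact: expR_ge0.
- apply: continuous_subspaceT => x.
  apply: (@continuous_comp _ _ _ (fun y : R => - y)%R expR); first exact: continuousN.
  exact: continuous_expR.
- by rewrite -oppr0; apply: cvgN; exact: cvgr_expR.
- by move=> x _; case: (dN x).
- have cN : {for 0%R, continuous (fun y : R => - expR (- y))%R}.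
    by apply: differentiable_continuous; apply/derivable1_diffP; case: (dN 0%R).
  by apply: cvg_at_right_filter; exact: cN.
- by move=> x _; rewrite derive1E; exact: (@derive_val _ _ _ _ _ _ _ (dN x)).
Qed.

Lemma bint1 (a : R) : (0 < a)%R -> bint a 1 = (a^-1)%:E.
Proof.
move=> a0; rewrite /bint -integral_powR01 //; apply: eq_integral => x _.
by rewrite subrr powRr0 mulr1.
Qed.

Lemma gintS (a : R) : (0 < a)%R -> gint (a + 1) = a%:E * gint a.
Proof.
move=> a0; have := gint_mul a 1; rewrite gint1 bint1 // mule1 => ->.
by rewrite muleA -EFinM divff ?lt0r_neq0 // mul1e.
Qed.

Lemma gint_nat_fin (n : nat) : gint n.+1%:R \is a fin_num.
Proof.
elim: n => [|n IH]; first by rewrite gint1.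
by rewrite -natr1 gintS ?ltr0n // fin_numM.
Qed.

Lemma measurable_gfunE (a : R) (D : set R) : measurable_fun D (EFin \o gfun a).
Proof. by apply/measurable_EFinP; apply: measurable_funTS; exact: measurable_gfun. Qed.

Lemma gint_split (a : R) : gint a =
  \int[mu]_(t in `]0%R, 1%R[) (gfun a t)%:E + \int[mu]_(t in `[1%R, +oo[) (gfun a t)%:E.
Proof.
rewrite /gint -ge0_integral_setU //.
- by congr (integral _ _ _); rewrite -itv_bndbnd_setU // bnd_simp.
- exact: measurable_gfunE.
- by move=> t _; rewrite lee_fin gfun_ge0.
- apply/disj_set2P; rewrite -subset0 => t /=; rewrite !in_itv /= andbT.
  by move=> [/andP[_ t1]]; rewrite leNgt t1.
Qed.

(** On ]0, 1[ the integrand is at most t^(a-1); on [1, +oo[ it is at most the one with an integer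
    exponent, settled by [gint_nat_fin]. *)
Lemma gint_fin (a : R) : (0 < a)%R -> gint a \is a fin_num.
Proof.
move=> a0; have [n an] : exists n : nat, (a <= n.+1%:R)%R.
  exists (Num.truncn a); by rewrite ltW // truncnS_gt.
have h1 : \int[mu]_(t in `]0%R, 1%R[) (gfun a t)%:E <= (a^-1)%:E.
  rewrite -integral_powR01 //; apply: ge0_le_integral => //.
  - by move=> t _; rewrite lee_fin gfun_ge0.
  - exact: measurable_gfunE.
  - by apply/measurable_EFinP; apply: measurable_funTS; exact: measurable_powR.
  - move=> t /=; rewrite in_itv /= => /andP[t0 _]; rewrite lee_fin /gfun.
    by rewrite ler_piMr ?powR_ge0 // -expR0 ler_expR oppr_le0 ltW.
have h2 : \int[mu]_(t in `[1%R, +oo[) (gfun a t)%:E <= gint n.+1%:R.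
  apply: (@le_trans _ _ (\int[mu]_(t in `[1%R, +oo[) (gfun n.+1%:R t)%:E)).
    apply: ge0_le_integral => //.
    - by move=> t _; rewrite lee_fin gfun_ge0.
    - exact: measurable_gfunE.
    - exact: measurable_gfunE.
    - move=> t /=; rewrite in_itv /= andbT => t1; rewrite lee_fin /gfun.
      by rewrite ler_wpM2r ?expR_ge0 // ler_powR // lerD2r.
  apply: ge0_subset_integral => //.
  - exact: measurable_gfunE.
  - by move=> t _; rewrite lee_fin gfun_ge0.
  - by move=> t /=; rewrite !in_itv /= !andbT; exact: lt_le_trans.
rewrite ge0_fin_numE ?gint_ge0 // gint_split; apply: (@le_lt_trans _ _ ((a^-1)%:E + gint n.+1%:R)).
  exact: leeD.
by rewrite lte_add_pinfty ?ltry // -ge0_fin_numE ?gint_ge0 ?gint_nat_fin.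
Qed.

Lemma gintE (a : R) : (0 < a)%R -> gint a = (Gamma a)%:E.
Proof. by move=> a0; rewrite -(fineK (gint_fin a0)). Qed.

(** The part over ]0, 1[ alone is at least e^(-1) / a. *)
Lemma Gamma_gt0 (a : R) : (0 < a)%R -> (0 < Gamma a)%R.
Proof.
move=> a0; rewrite -lte_fin -gintE // gint_split.
apply: (@lt_le_trans _ _ (\int[mu]_(t in `]0%R, 1%R[) (gfun a t)%:E)); last first.
  by apply: leeDl; apply: integral_ge0 => t _; rewrite lee_fin gfun_ge0.
apply: (@lt_le_trans _ _ ((expR (-1))%:E * (a^-1)%:E)).
  by rewrite -EFinM lte_fin mulr_gt0 ?expR_gt0 ?invr_gt0.
rewrite -integral_powR01 // -ge0_integralZl_EFin; last 4 first.
- exact: measurable_itv.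
- by move=> t _; rewrite lee_fin powR_ge0.
- by apply/measurable_EFinP; apply: measurable_funTS; exact: measurable_powR.
- exact: expR_ge0.
apply: ge0_le_integral.
- exact: measurable_itv.
- by move=> t _; rewrite -EFinM lee_fin mulr_ge0 ?expR_ge0 ?powR_ge0.
- apply: measurable_funeM.
  by apply/measurable_EFinP; apply: measurable_funTS; exact: measurable_powR.
- exact: measurable_gfunE.
- move=> t /=; rewrite in_itv /= => /andP[t0 t1]; rewrite -EFinM lee_fin /gfun mulrC.
  by rewrite ler_wpM2l ?powR_ge0 // ler_expR lerN2 ltW.
Qed.

Lemma bintE (a b : R) : (0 < a)%R -> (0 < b)%R ->
  bint a b = (Gamma a * Gamma b / Gamma (a + b))%:E.
Proof.
move=> a0 b0; have ab0 : (0 < a + b)%R by exact: addr_gt0.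
have := gint_mul a b; rewrite !gintE // -EFinM => h.
have gn : (Gamma (a + b) != 0)%R by rewrite lt0r_neq0 ?Gamma_gt0.
by rewrite EFinM h -muleA -EFinM divff // mule1.
Qed.

Lemma GammaS (a : R) : (0 < a)%R -> Gamma (a + 1) = (a * Gamma a)%R.
Proof.
move=> a0; have := gintS a0; rewrite !gintE ?addr_gt0 // -EFinM.
by case.
Qed.

Lemma Gamma_poch (a : R) n : (0 < a)%R -> Gamma (a + n%:R) = (Gamma a * poch a n)%R.
Proof.
move=> a0; elim: n => [|n IH]; first by rewrite addr0 poch0 mulr1.
rewrite -natr1 addrA GammaS; last by rewrite ltr_pwDl.
by rewrite IH pochS; ring.
Qed.

(** The substitution t = x^2 gives twice the half-line Gaussian integral. *)
Lemma Gamma_half : Gamma (2^-1) = Num.sqrt pi :> R.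
Proof.
have h0 : (0 < 2^-1 :> R)%R by rewrite invr_gt0.
suff : gint (2^-1) = (Num.sqrt pi)%:E by rewrite gintE // => -[].
rewrite /gint (ge0_square_oy (@continuous_gfun _) (gfun_ge0 _)).
have -> : (Num.sqrt pi)%:E = 2%:E * (Num.sqrt pi / 2)%:E :> \bar R.
  by rewrite -EFinM mulrC divfK.
rewrite -integral0y_gauss -integral_itv_obnd_cbnd; last first.
  by apply/measurable_EFinP; apply: measurable_funTS; exact: measurable_gauss_fun.
rewrite -ge0_integralZl_EFin; last 4 first.
- exact: measurable_itv.
- by move=> t _; rewrite lee_fin gauss_fun_ge0.
- by apply/measurable_EFinP; apply: measurable_funTS; exact: measurable_gauss_fun.
- by [].
apply: eq_integral => t; rewrite inE /= in_itv /= andbT => t0.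
rewrite -EFinM /gfun /gauss_fun; congr EFin.
have -> : ((t ^+ 2) `^ (2^-1 - 1) = t^-1)%R.
  rewrite -[(t ^+ 2)%R]powR_mulrn ?ltW // -powRrM.
  have -> : (2%:R * (2^-1 - 1) = -1 :> R)%R by field.
  by rewrite powR_inv1 // ltW.
by field; exact: lt0r_neq0.
Qed.

End GammaBeta.

(** * The formal moments as Lebesgue integrals *)

Section NuMoments.
Variable R : realType.
Local Notation mu := (@lebesgue_measure R).
Local Open Scope ereal_scope.

Lemma ge0_integral_opp (f : R -> \bar R) (D : set R) : measurable D ->
  measurable_fun [set: R] f -> (forall x, 0 <= f x) ->
  \int[mu]_(x in D) f x = \int[mu]_(x in (fun y : R => (- y)%R) @^-1` D) f (- x)%R.
Proof.
move=> mD mf f0.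
transitivity (\int[pushforward mu (-%R : _ -> measurableTypeR R)]_(y in D) f y).
  by apply: eq_measure_integral => //= A mA AS; exact/esym/lebesgue_measureN.
by rewrite ge0_integral_pushforward//=; exact: measurable_funS mf.
Qed.

Lemma integral_opp (f : R -> \bar R) (D : set R) : measurable D ->
  measurable_fun [set: R] f ->
  mu.-integrable ((fun y : R => (- y)%R) @^-1` D) (f \o (fun y : R => - y)%R) ->
  \int[mu]_(x in D) f x = \int[mu]_(x in (fun y : R => (- y)%R) @^-1` D) f (- x)%R.
Proof.
move=> mD mf fi.
transitivity (\int[pushforward mu (-%R : _ -> measurableTypeR R)]_(y in D) f y).
  by apply: eq_measure_integral => //= A mA AS; exact/esym/lebesgue_measureN.
by rewrite integral_pushforward.
Qed.

Definition dens (a u : R) : R := ((1 - u ^+ 2) `^ (a - 1))%R.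

Lemma dens_ge0 a u : (0 <= dens a u)%R. Proof. exact: powR_ge0. Qed.

Lemma measurable_dens a : measurable_fun [set: R] (dens a).
Proof.
apply: (measurableT_comp (measurable_powR (a - 1))).
by apply: measurable_funB; [exact: measurable_cst|exact: exprn_measurable].
Qed.

Lemma measurable_densX a i : measurable_fun [set: R] (fun u => dens a u * u ^+ i)%R.
Proof.
by apply: measurable_funM; [exact: measurable_dens|exact: exprn_measurable].
Qed.

Lemma dens_even_half a j : (0 < a)%R ->
  \int[mu]_(u in `]0%R, 1%R[) (dens a u * u ^+ (2 * j))%:E * 2%:E = bint (j%:R + 2^-1) a.
Proof.
move=> a0; rewrite /bint.
rewrite (@ge0_square_oo _ (fun x => x `^ (j%:R + 2^-1 - 1) * (1 - x) `^ (a - 1))%R).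
- rewrite muleC -ge0_integralZl_EFin; last 4 first.
  + exact: measurable_itv.
  + move=> t /=; rewrite in_itv /= => /andP[t0 _].
    by rewrite lee_fin mulr_ge0 ?dens_ge0 // exprn_ge0 // ltW.
  + by apply/measurable_EFinP; apply: measurable_funTS; exact: measurable_densX.
  + by [].
  apply: eq_integral => u; rewrite inE /= in_itv /= => /andP[u0 u1].
  rewrite -EFinM; congr EFin; rewrite /dens.
  have -> : (u ^+ (2 * j) = (u ^+ 2) `^ (j%:R + 2^-1 - 1) * u)%R.
    rewrite -[(u ^+ 2)%R]powR_mulrn ?ltW // -powRrM -{3}(powRr1 (ltW u0)) -powRD.
      by rewrite -powR_mulrn ?ltW // natrM; congr powR; field.
    by rewrite lt0r_neq0 ?implybT.
  by ring.
- move=> x /andP[x0 x1]; apply: cvgM; first exact: continuous_powRp.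
  apply: (@continuous_comp _ _ _ (fun y : R => 1 - y)%R (fun y : R => y `^ (a - 1))%R).
    by apply: cvgB; [exact: cvg_cst|exact: cvg_id].
  by apply: continuous_powRp; rewrite subr_gt0.
- by move=> x; rewrite mulr_ge0 ?powR_ge0.
Qed.

Lemma dens_even a j : (0 < a)%R ->
  \int[mu]_(u in `[(-1)%R, 1%R]) (dens a u * u ^+ (2 * j))%:E = bint (j%:R + 2^-1) a.
Proof.
move=> a0; pose f u : \bar R := (dens a u * u ^+ (2 * j))%:E.
have mf : measurable_fun [set: R] f by apply/measurable_EFinP; exact: measurable_densX.
have f0 u : 0 <= f u by rewrite lee_fin mulr_ge0 ?dens_ge0 // exprM exprn_ge0 // sqr_ge0.
have fN u : f (- u)%R = f u by rewrite /f /dens sqrrN exprM sqrrN -exprM.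
have -> : bint (j%:R + 2^-1) a = \int[mu]_(u in `]0%R, 1%R[) f u * 2%:E.
  by rewrite -dens_even_half.
change (\int[mu]_(u in `[(-1)%R, 1%R]) f u = \int[mu]_(u in `]0%R, 1%R[) f u * 2%:E).
rewrite (_ : `[(-1)%R, 1%R]%classic = `[(-1)%R, 0%R] `|` `]0%R, 1%R]); last first.
  by rewrite -itv_bndbnd_setU // bnd_simp // lerN10.
rewrite ge0_integral_setU //; last 2 first.
- exact: measurable_funTS.
- apply/disj_set2P; rewrite -subset0 => t /=; rewrite !in_itv /=.
  by move=> [/andP[_ t1] /andP[t0 _]]; move: t0; rewrite ltNge t1.
have -> : \int[mu]_(x in `[(-1)%R, 0%R]) f x = \int[mu]_(x in `]0%R, 1%R[) f x.
  rewrite ge0_integral_opp // opp_preimage_itvbndbnd /= oppr0 opprK.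
  rewrite integral_itv_bndoo; first by apply: eq_integral => x _; rewrite fN.
  by apply: measurable_funTS; apply: measurableT_comp.
have -> : \int[mu]_(x in `]0%R, 1%R]) f x = \int[mu]_(x in `]0%R, 1%R[) f x.
  by rewrite integral_itv_bndoo //; exact: measurable_funTS.
by rewrite muleC mule_natl mule2n.
Qed.

(** Integrability is kept next to the value so that the relation passes to linear combinations of
    arbitrary sign. *)
Definition has_nu (a : R) (F : R -> R) (m : R) : Prop :=
  mu.-integrable `[(-1)%R, 1%R] (EFin \o (fun u => nu_dens a u * F u)%R) /\
  \int[mu]_(u in `[(-1)%R, 1%R]) (nu_dens a u * F u)%:E = m%:E.

Definition nu_cst (a : R) : R := Gamma (a + 2^-1) / (Num.sqrt pi * Gamma a).

Lemma nu_densE a u : nu_dens a u = (nu_cst a * dens a u)%R. Proof. by []. Qed.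

Lemma half_gt0 : (0 < 2^-1 :> R)%R. Proof. by rewrite invr_gt0. Qed.

(** The case i = 0 is the beta integral B(1/2, a); since |u| <= 1 it dominates every other power. *)
Lemma integrable_densX a i : (0 < a)%R ->
  mu.-integrable `[(-1)%R, 1%R] (EFin \o (fun u => dens a u * u ^+ i)%R).
Proof.
move=> a0.
have h0 : mu.-integrable `[(-1)%R, 1%R] (EFin \o (fun u => dens a u * u ^+ (2 * 0))%R).
  apply/integrableP; split.
    by apply/measurable_EFinP; apply: measurable_funTS; exact: measurable_densX.
  under eq_integral => u _.
    rewrite /= ger0_norm; last by rewrite mulr_ge0 ?dens_ge0.
    over.
  rewrite (dens_even 0 a0) bintE ?ltry // ?add0r ?half_gt0 //.
apply: le_integrable h0 => //.
  by apply/measurable_EFinP; apply: measurable_funTS; exact: measurable_densX.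
move=> u /=; rewrite in_itv /= => /andP[u1 u2].
rewrite lee_fin !normrM ler_wpM2l // normrX muln0 expr0 normr1.
by rewrite exprn_ile1 // ler_norml u1.
Qed.

(** The Gamma factors cancel into Pochhammer symbols, with Gamma (1/2) = sqrt pi making the total
    mass 1 at j = 0. *)
Lemma nu_cst_even a j : (0 < a)%R -> (nu_cst a)%:E * bint (j%:R + 2^-1) a =
  (poch 2^-1 j / poch (a + 2^-1) j)%:E.
Proof.
move=> a0; have h0 := half_gt0; have ah : (0 < a + 2^-1)%R by exact: addr_gt0.
rewrite bintE ?ltr_wpDl // -EFinM; congr EFin.
rewrite [(j%:R + 2^-1)%R]addrC Gamma_poch // addrAC [(2^-1 + a)%R]addrC Gamma_poch //.
rewrite Gamma_half /nu_cst.
have n1 := lt0r_neq0 (Gamma_gt0 a0); have n2 := lt0r_neq0 (Gamma_gt0 ah).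
have n3 := lt0r_neq0 (poch_gt0 j ah).
have n4 : (Num.sqrt pi != 0 :> R)%R by rewrite lt0r_neq0 // sqrtr_gt0 pi_gt0.
move: n1 n2 n3 n4; move: (Gamma a) (Gamma (a + 2^-1)) (poch (a + 2^-1) j) (Num.sqrt pi).
by move=> x y z t x0 y0 z0 t0; move: (poch _ _) => w; field; rewrite x0 y0 z0 t0.
Qed.

Lemma mom_even (a : R) j : (0 < a)%R -> mom a (2 * j) = (poch 2^-1 j / poch (a + 2^-1) j)%R.
Proof.
move=> a0; elim: j => [|j IH]; first by rewrite !poch0 divr1.
have ah : (0 < a + 2^-1)%R by rewrite addr_gt0 ?half_gt0.
rewrite mulnS momSS IH !pochS -[((2 * j).+1%:R)%R]natr1 natrM.
have n3 := lt0r_neq0 (poch_gt0 j ah).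
have n4 : (a + 2^-1 + j%:R != 0)%R by rewrite lt0r_neq0 // ltr_pwDl.
have n5 : (2 * a + (2 * j%:R + 1) != 0)%R.
  by rewrite lt0r_neq0 // ltr_pwDl // ?mulr_gt0 // addr_ge0 ?mulr_ge0.
have n6 : (2 * (a + 2^-1 + j%:R) = 2 * a + (2 * j%:R + 1))%R by field.
have n7 : (2 * (2^-1 + j%:R) = 2 * j%:R + 1 :> R)%R by field.
rewrite -n6 -n7; move: n3 n4; move: (a + 2^-1 + j%:R)%R (2^-1 + j%:R)%R (poch _ j) (poch _ j).
by move=> x y z t z0 x0; field; rewrite ?z0 ?x0.
Qed.

Lemma mom_odd (a : R) j : mom a (2 * j).+1 = 0%R.
Proof. by elim: j => [|j IH] //; rewrite mulnS momSS IH mulr0. Qed.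

Lemma has_nuX a i : (0 < a)%R -> has_nu a (fun u => u ^+ i)%R (mom a i).
Proof.
move=> a0; have hi := integrable_densX i a0.
have e u : (nu_dens a u * u ^+ i)%:E = (nu_cst a)%:E * (dens a u * u ^+ i)%:E.
  by rewrite nu_densE -mulrA EFinM.
split.
  rewrite (_ : EFin \o _ = fun u => (nu_cst a)%:E * (dens a u * u ^+ i)%:E).
    exact: integrableZl.
  by apply/funext => u; rewrite /= e.
under eq_integral do rewrite e.
rewrite integralZl //.
have [j [iE|iE]] : exists j, i = (2 * j).+1 \/ i = (2 * j)%N.
  exists i./2; rewrite mul2n; case: (boolP (odd i)) => oi; [left|right].
    by rewrite -[LHS]odd_double_half oi.
  by rewrite -[LHS]odd_double_half (negbTE oi).
  subst i; rewrite mom_odd.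
  pose g u := (dens a u * u ^+ (2 * j).+1)%R.
  have gN u : g (- u)%R = (- g u)%R.
    by rewrite /g /dens sqrrN exprNn -signr_odd /= mul2n odd_double expr1 mulN1r mulrN.
  suff g0 : \int[mu]_(u in `[(-1)%R, 1%R]) (g u)%:E = 0 by rewrite g0 mule0.
  (* An odd integrand gives I = - I, which forces I = 0 only once I is known to be finite. *)
  have fin : \int[mu]_(u in `[(-1)%R, 1%R]) (g u)%:E \is a fin_num by exact: integrable_fin_num.
  have : \int[mu]_(u in `[(-1)%R, 1%R]) (g u)%:E = - \int[mu]_(u in `[(-1)%R, 1%R]) (g u)%:E.
    rewrite {1}(@integral_opp (EFin \o g) `[(-1)%R, 1%R]%classic) //.
    - rewrite opp_preimage_itvbndbnd /= opprK -integralN.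
        by apply: eq_integral => u _; rewrite /= gN EFinN.
      exact: integrable_add_def.
    - by apply/measurable_EFinP; exact: measurable_densX.
    - rewrite opp_preimage_itvbndbnd /= opprK.
      rewrite (_ : _ \o _ = fun u => - (g u)%:E); first exact: integrableN.
      by apply/funext => u; rewrite /= gN EFinN.
  move: fin; case: (\int[mu]_(u in _) _) => // r _ [] /eqP.
  by rewrite -subr_eq0 opprK -mulr2n mulrn_eq0 /= => /eqP ->.
by rewrite iE dens_even // nu_cst_even // mom_even.
Qed.

Lemma has_nuZ a c F m : has_nu a F m -> has_nu a (fun u => c * F u)%R (c * m).
Proof.
move=> [Fi Fm].
have e u : (nu_dens a u * (c * F u))%:E = c%:E * (nu_dens a u * F u)%:E.
  by rewrite mulrCA EFinM.
split.
  rewrite (_ : EFin \o _ = fun u => c%:E * (nu_dens a u * F u)%:E).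
    exact: integrableZl.
  by apply/funext => u; rewrite /= e.
under eq_integral do rewrite e.
by rewrite integralZl // Fm EFinM.
Qed.

Lemma has_nu_sum a (I : Type) (s : seq I) (F : I -> R -> R) (m : I -> R) :
  (forall i, has_nu a (F i) (m i)) ->
  has_nu a (fun u => \sum_(i <- s) F i u)%R (\sum_(i <- s) m i)%R.
Proof.
move=> h.
have e u : (nu_dens a u * \sum_(i <- s) F i u)%:E = \sum_(i <- s) (nu_dens a u * F i u)%:E.
  by rewrite mulr_sumr sumEFin.
split.
  rewrite (_ : EFin \o _ = fun u => \sum_(i <- s) (nu_dens a u * F i u)%:E).
    by apply: integrable_sum => // i _; have [] := h i.
  by apply/funext => u; rewrite /= e.
under eq_integral do rewrite e.
rewrite integral_sum //; last by move=> i; have [] := h i.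
by rewrite -sumEFin; apply: eq_bigr => i _; have [] := h i.
Qed.

Lemma has_nu_eq a F F' m m' : (forall u, F u = F' u) -> m = m' ->
  has_nu a F m -> has_nu a F' m'.
Proof. by move=> /funext <- <-. Qed.

Lemma horner_lin2 (g : {poly R}) (A B u v : R) : g.[v * A + u * B]%R =
  (\sum_(l < size g) g`_l * \sum_(i < l.+1)
     ('C(l, i)%:R * A ^+ i * B ^+ (l - i) * u ^+ (l - i)) * v ^+ i)%R.
Proof.
rewrite horner_coef; apply: eq_bigr => l _; congr (_ * _)%R.
rewrite addrC exprDn; apply: eq_bigr => i _.
by rewrite !exprMn -mulr_natl; ring.
Qed.

(** This ties [Tmom] to a true iterated integral: G is the inner integral over v, written out as a
    polynomial in u. *)
Lemma nu_double al be (A B : R) (g : {poly R}) : (0 < al)%R -> (0 < be)%R ->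
  exists G : R -> R, (forall u, has_nu be (fun v => g.[v * A + u * B]%R) (G u)) /\
    has_nu al G (Tmom al be A B 0 0 g).
Proof.
move=> al0 be0; exists (fun u => \sum_(l < size g) g`_l * \sum_(i < l.+1)
     ('C(l, i)%:R * A ^+ i * B ^+ (l - i) * mom be i) * u ^+ (l - i))%R; split.
  move=> u; apply: has_nu_eq (fun v => esym (horner_lin2 g A B u v)) _ _ => [|].
    2: apply: has_nu_sum => l; apply: has_nuZ; apply: has_nu_sum => i; apply: has_nuZ;
       exact: has_nuX.
  by apply: eq_bigr => l _; congr (_ * _)%R; apply: eq_bigr => i _; ring.
apply: has_nu_eq (fun u => erefl) _ _; last first.
  apply: has_nu_sum => l; apply: has_nuZ; apply: has_nu_sum => i; apply: has_nuZ.
  exact: has_nuX.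
apply: eq_bigr => l _; congr (_ * _)%R; apply: eq_bigr => i _.
by rewrite !addn0; ring.
Qed.

End NuMoments.

(** * Dirichlet integrals of exponentials over the simplex *)

Section Simplex.
Variables (R : realType) (lam : R).
Hypothesis lam0 : (0 < lam)%R.
Local Notation mu := (@lebesgue_measure R).
Local Open Scope ereal_scope.

Lemma expR_nneseries (x : R) : (expR x)%:E = \sum_(i <oo) (x ^+ i / i`!%:R)%:E.
Proof.
apply/esym/cvg_lim => //.
have h := is_cvg_series_exp_coeff x.
under eq_fun do rewrite sumEFin.
by apply: cvg_EFin; [near=> n|exact: h].
Unshelve. all: by end_near. Qed.

Lemma powR_addn (x a : R) (i : nat) : (0 < x)%R ->
  (x `^ (a + i%:R - 1) = x `^ (a - 1) * x ^+ i)%R.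
Proof.
move=> x0; rewrite -powR_mulrn ?ltW // -powRD ?lt0r_neq0 ?implybT //.
by congr powR; ring.
Qed.

(** Extension by 0 outside the triangle i <= N turns the resummation along antidiagonals into an
    interchange of two full series. *)
Lemma nneseries_cauchy (g : nat -> nat -> \bar R) : (forall i m, 0 <= g i m) ->
  \sum_(i <oo) \sum_(m <oo) g i m = \sum_(N <oo) \sum_(i < N.+1) g i (N - i)%N.
Proof.
move=> g0; pose h (i N : nat) : \bar R := if (i <= N)%N then g i (N - i)%N else 0.
have h0 i N : 0 <= h i N by rewrite /h; case: ifP.
transitivity (\sum_(i <oo) \sum_(N <oo) h i N).
  apply: eq_eseriesr => i _; rewrite (@nneseries_split _ (h i) 0 i); last by move=> N _; exact: h0.
  rewrite add0n [X in X + _]big_nat big1 ?add0e; last first.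
    by move=> N /andP[_ Ni]; rewrite /h leqNgt Ni.
  rewrite -[RHS]nneseries_addn //; apply: eq_eseriesr => m _.
  by rewrite /h leq_addl addnK.
rewrite nneseries_interchange //; apply: eq_eseriesr => N _.
rewrite (@nneseries_split _ (h^~ N) 0 N.+1); last by move=> i _; exact: h0.
rewrite add0n [X in _ + X]eseries0 ?adde0; last first.
  by move=> i Ni _; rewrite /h leqNgt Ni.
rewrite big_mkord; apply: eq_bigr => i _.
by rewrite /h -ltnS ltn_ord.
Qed.

(** Expand e^(c x) and integrate termwise: each term is a beta integral, and Gamma (lam + i)
    supplies the Pochhammer symbol of [bcoef]. *)
Lemma exp_beta (c b s : R) : (0 <= c)%R -> (0 < b)%R -> (0 < s)%R ->
  \int[mu]_(x in `]0%R, s[) (x `^ (lam - 1) * expR (c * x) * (s - x) `^ (b - 1))%:E =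
  \sum_(i <oo) (bcoef lam c i * (Gamma lam * Gamma b / Gamma (lam + b + i%:R))
     * s `^ (lam + b + i%:R - 1))%:E.
Proof.
move=> c0 b0 s0.
have bi (i : nat) : (0 < lam + i%:R)%R by rewrite ltr_pwDl.
transitivity (\int[mu]_(x in `]0%R, s[) \sum_(i <oo)
  ((c ^+ i / i`!%:R)%:E * (x `^ (lam + i%:R - 1) * (s - x) `^ (b - 1))%:E)).
  apply: eq_integral => x; rewrite inE /= in_itv /= => /andP[x0 xs].
  rewrite mulrAC mulrC EFinM muleC expR_nneseries -nneseriesZl; last first.
    by move=> i _; rewrite lee_fin divr_ge0 // exprn_ge0 // mulr_ge0 // ltW.
  apply: eq_eseriesr => i _; rewrite -!EFinM; congr EFin.
  by rewrite exprMn powR_addn //; ring.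
have ci (i : nat) : (0 <= c ^+ i / i`!%:R)%R by rewrite divr_ge0 // exprn_ge0.
have mi (i : nat) : measurable_fun `]0%R, s[%classic
    (fun x : R => (x `^ (lam + i%:R - 1) * (s - x) `^ (b - 1))%:E).
  by apply/measurable_EFinP; apply: measurable_funTS; exact: measurable_bfun.
rewrite integral_nneseries //; last 2 first.
- by move=> i; apply: measurable_funeM; exact: mi.
- by move=> i x _; rewrite -EFinM lee_fin mulr_ge0 // mulr_ge0 ?powR_ge0.
apply: eq_eseriesr => i _.
rewrite ge0_integralZl_EFin; last 4 first.
- exact: measurable_itv.
- by move=> x _; rewrite lee_fin mulr_ge0 ?powR_ge0.
- exact: mi.
- exact: ci.
rewrite beta_scaling // bintE // -!EFinM; congr EFin.
have -> : (lam + i%:R + b = lam + b + i%:R)%R by ring.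
rewrite /bcoef Gamma_poch //; move: (Gamma _) (Gamma b) (Gamma _) (_ `^ _)%R (poch _ _) => g1 g2 g3 p w.
by ring.
Qed.

Lemma bcoef_ge0 (c : R) i : (0 <= c)%R -> (0 <= bcoef lam c i)%R.
Proof.
by move=> c0; rewrite mulr_ge0 ?exprn_ge0 // divr_ge0 // ltW // poch_gt0.
Qed.

(* [sexp c0 cs s l] is sum_j cs_j l_j + c0 (s - sum_j l_j), and [swt s l] the Dirichlet
   weight, both in the recursive form that matches [simplex_int]. *)
Fixpoint sexp (c0 : R) (cs : seq R) (s : R) (l : seq R) : R :=
  match cs, l with
  | c :: cs', x :: l' => (c * x + sexp c0 cs' (s - x) l')%R
  | _, _ => (c0 * s)%R
  end.

Fixpoint swt (s : R) (l : seq R) : R :=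
  if l is x :: l' then (x `^ (lam - 1) * swt (s - x) l')%R else (s `^ (lam - 1))%R.

(** Dirichlet's integral in degree N for n + 1 variables of sum s, without the factor [dirP] that
    depends on the exponents. *)
Definition sterm (n N : nat) (s : R) : R :=
  (Gamma lam ^+ n.+1 / Gamma (n.+1%:R * lam + N%:R) * s `^ (n.+1%:R * lam + N%:R - 1))%R.

Let bn_gt0 (n N : nat) : (0 < n.+1%:R * lam + N%:R)%R.
Proof. by rewrite ltr_pwDl // mulr_gt0. Qed.

Lemma sterm_ge0 n N s : (0 <= sterm n N s)%R.
Proof.
rewrite mulr_ge0 ?powR_ge0 // divr_ge0 // ?exprn_ge0 //; apply: ltW; exact: Gamma_gt0.
Qed.

Local Notation P := (dirP lam (@idfun R)).

Lemma dirP_seq_ge0 (cs : seq R) n : all (fun c => 0 <= c)%R cs -> (0 <= P cs n)%R.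
Proof.
elim: cs n => [|c cs IH] n /=; first by rewrite ler0n.
by move=> /andP[c0 h]; apply: sumr_ge0 => i _; rewrite mulr_ge0 ?IH ?bcoef_ge0.
Qed.

(** By induction the inner simplex is a series, [exp_beta] integrates its terms, and the Cauchy
    product adds one factor to [dirP]. The two exponentials of [hfun] are carried together, so that
    their sum is split in the series and not in [simplex_int]; the weights k1 and k2 absorb the
    factors e^(c x) x^(lam - 1) of the outer variable. *)
Lemma simplex_exp n (cs ds : seq R) (c0 d0 k1 k2 s : R) :
  size cs = n -> size ds = n -> (0 < s)%R -> (0 <= k1)%R -> (0 <= k2)%R ->
  all (fun c => 0 <= c)%R (rcons cs c0) -> all (fun c => 0 <= c)%R (rcons ds d0) ->
  simplex_int n s (fun l =>
    ((k1 * expR (sexp c0 cs s l) + k2 * expR (sexp d0 ds s l)) * swt s l)%:E) =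
  \sum_(N <oo) ((k1 * P (rcons cs c0) N + k2 * P (rcons ds d0) N) * sterm n N s)%:E.
Proof.
elim: n cs ds k1 k2 s => [|n IH] [|c cs] [|d ds] //= k1 k2 s.
  move=> _ _ s0 k10 k20 /andP[c00 _] /andP[d00 _].
  have e (c : R) : (0 <= c)%R -> (expR (c * s) * s `^ (lam - 1))%:E =
      \sum_(N <oo) (P [:: c] N * sterm 0 N s)%:E.
    move=> c00'; rewrite mulrC EFinM expR_nneseries -nneseriesZl; last first.
      by move=> i _; rewrite lee_fin divr_ge0 // exprn_ge0 // mulr_ge0 // ltW.
    apply: eq_eseriesr => N _; rewrite -EFinM; congr EFin.
    have -> : P [:: c] N = bcoef lam c N.
      rewrite /= /conv big_ord_recr /= subnn eqxx mulr1 big1 ?add0r // => i _.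
      by rewrite subn_eq0 leqNgt ltn_ord mulr0.
    rewrite /sterm /bcoef mul1r expr1 Gamma_poch // powR_addn // exprMn.
    have n1 := lt0r_neq0 (Gamma_gt0 lam0); have n2 := lt0r_neq0 (poch_gt0 N lam0).
    have n3 : (N`!%:R != 0 :> R)%R by rewrite pnatr_eq0 -lt0n fact_gt0.
    by field; rewrite n1 n2 n3.
  have Pc N : (0 <= P [:: c0] N)%R by apply: dirP_seq_ge0; rewrite /= c00.
  have Pd N : (0 <= P [:: d0] N)%R by apply: dirP_seq_ge0; rewrite /= d00.
  rewrite mulrDl -!mulrA EFinD (EFinM k1) (EFinM k2) !e // -!nneseriesZl; last 2 first.
  - by move=> N _; rewrite lee_fin mulr_ge0 ?sterm_ge0.
  - by move=> N _; rewrite lee_fin mulr_ge0 ?sterm_ge0.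
  rewrite -nneseriesD; last 2 first.
  - by move=> N _ _; rewrite -EFinM lee_fin mulr_ge0 // mulr_ge0 ?sterm_ge0.
  - by move=> N _ _; rewrite -EFinM lee_fin mulr_ge0 // mulr_ge0 ?sterm_ge0.
  by apply: eq_eseriesr => N _; rewrite -!EFinM -EFinD mulrDl !mulrA.
move=> [scs] [sds] s0 k10 k20 /andP[c00 ac] /andP[d00 ad].
set Pc := P (rcons cs c0); set Pd := P (rcons ds d0).
have Pc0 N : (0 <= Pc N)%R by exact: dirP_seq_ge0.
have Pd0 N : (0 <= Pd N)%R by exact: dirP_seq_ge0.
pose q (c b : R) (x : R) : R := (x `^ (lam - 1) * expR (c * x) * (s - x) `^ (b - 1))%R.
have q0 c' b x : (0 <= q c' b x)%R by rewrite /q !mulr_ge0 ?powR_ge0 ?expR_ge0.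
have mq c' b : measurable_fun [set: R] (q c' b).
  apply: measurable_funM; first apply: measurable_funM.
  - exact: measurable_powR.
  - by apply: (measurableT_comp (@measurable_expR R)); apply: measurable_funM.
  - apply: (measurableT_comp (measurable_powR (b - 1))).
    by apply: measurable_funB => //; exact: measurable_cst.
pose b (N : nat) : R := (n.+1%:R * lam + N%:R)%R.
have b0 N : (0 < b N)%R by exact: bn_gt0.
pose G (N : nat) : R := (Gamma lam ^+ n.+1 / Gamma (b N))%R.
have G0 N : (0 <= G N)%R.
  by rewrite divr_ge0 ?exprn_ge0 //; apply: ltW; exact: Gamma_gt0.
pose h (N : nat) (x : R) : \bar R :=
  (k1 * Pc N * G N)%:E * (q c (b N) x)%:E + (k2 * Pd N * G N)%:E * (q d (b N) x)%:E.
have h0 N x : 0 <= h N x.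
  by rewrite /h -!EFinM -EFinD lee_fin addr_ge0 // mulr_ge0 // mulr_ge0 // mulr_ge0.
have mh N (D : set R) : measurable_fun D (h N).
  by apply: emeasurable_funD; apply: measurable_funeM; apply/measurable_EFinP;
     apply: measurable_funTS; exact: mq.
have inner (x : R) : (0 < x < s)%R ->
  simplex_int n (s - x) (fun l =>
    ((k1 * expR (c * x + sexp c0 cs (s - x) l) + k2 * expR (d * x + sexp d0 ds (s - x) l)) *
     (x `^ (lam - 1) * swt (s - x) l))%:E) = \sum_(N <oo) h N x.
  move=> /andP[x0 xs]; have sx0 : (0 < s - x)%R by rewrite subr_gt0.
  pose k1' := (k1 * expR (c * x) * x `^ (lam - 1))%R.
  pose k2' := (k2 * expR (d * x) * x `^ (lam - 1))%R.
  rewrite (_ : (fun l => _) = fun l =>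
    ((k1' * expR (sexp c0 cs (s - x) l) + k2' * expR (sexp d0 ds (s - x) l)) *
     swt (s - x) l)%:E); last first.
    apply/funext => l; congr EFin; rewrite !expRD /k1' /k2'; ring.
  rewrite IH //; last 2 first.
  - by rewrite /k1' !mulr_ge0 ?expR_ge0 ?powR_ge0.
  - by rewrite /k2' !mulr_ge0 ?expR_ge0 ?powR_ge0.
  apply: eq_eseriesr => N _; rewrite /h -!EFinM -EFinD; congr EFin.
  rewrite /sterm -/(b N) -/(G N) /k1' /k2' /q -/Pc -/Pd; ring.
have itv_inner (x : R) : x \in `]0%R, s[%classic -> (0 < x < s)%R.
  by rewrite inE /= in_itv.
(* The endpoints are removed because the inner formula needs s - x > 0; measurability of the inner
   integral is read off its series. *)
rewrite integral_itv_bndoo; last first.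
  apply: (eq_measurable_fun (fun x => \sum_(N <oo) h N x)).
    by move=> x xi; rewrite inner //; exact: itv_inner.
  by apply: ge0_emeasurable_sum => // N x _ _.
transitivity (\int[mu]_(x in `]0%R, s[) \sum_(N <oo) h N x).
  by apply: eq_integral => x xi; apply: inner; exact: itv_inner.
rewrite integral_nneseries //.
have hint N : \int[mu]_(x in `]0%R, s[) h N x = \sum_(i <oo)
    ((k1 * Pc N * bcoef lam c i + k2 * Pd N * bcoef lam d i) * sterm n.+1 (N + i)%N s)%:E.
  rewrite ge0_integralD //; last 4 first.
  - by move=> x _; rewrite -EFinM lee_fin mulr_ge0 // mulr_ge0 // mulr_ge0.
  - by apply: measurable_funeM; apply/measurable_EFinP; apply: measurable_funTS; exact: mq.
  - by move=> x _; rewrite -EFinM lee_fin mulr_ge0 // mulr_ge0 // mulr_ge0.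
  - by apply: measurable_funeM; apply/measurable_EFinP; apply: measurable_funTS; exact: mq.
  have one (c' K : R) : (0 <= c')%R -> (0 <= K)%R ->
      \int[mu]_(x in `]0%R, s[) ((K * G N)%:E * (q c' (b N) x)%:E) =
      \sum_(i <oo) (K * bcoef lam c' i * sterm n.+1 (N + i)%N s)%:E.
    move=> c'0 K0; rewrite ge0_integralZl_EFin; last 4 first.
    - exact: measurable_itv.
    - by move=> x _; rewrite lee_fin.
    - by apply/measurable_EFinP; apply: measurable_funTS; exact: mq.
    - by rewrite mulr_ge0.
    rewrite exp_beta // -nneseriesZl; last first.
      move=> i _; rewrite lee_fin mulr_ge0 ?powR_ge0 // mulr_ge0 //.
        by rewrite mulr_ge0 ?exprn_ge0 // divr_ge0 // ltW // poch_gt0.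
      rewrite divr_ge0 // ?mulr_ge0 // ltW //; apply: Gamma_gt0 => //.
      by rewrite ltr_pwDl // addr_gt0.
    apply: eq_eseriesr => i _; rewrite -EFinM; congr EFin.
    have -> : (lam + b N + i%:R = n.+2%:R * lam + (N + i)%:R)%R.
      by rewrite /b -[(n.+2%:R)%R]natr1 natrD; ring.
    rewrite /sterm /G [(Gamma lam ^+ n.+2)%R]exprS.
    have n1 : (Gamma (b N) != 0)%R by rewrite lt0r_neq0 // Gamma_gt0.
    have n2 : (Gamma (n.+2%:R * lam + (N + i)%:R) != 0)%R.
      by rewrite lt0r_neq0 // Gamma_gt0.
    move: n1 n2; move: (Gamma (b N)) (Gamma (_ + _)) (_ `^ _)%R (bcoef _ _ _) (Gamma lam).
    by move=> g1 g2 p bb gl n1 n2; field; rewrite n1 n2.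
  rewrite !one ?mulr_ge0 // -nneseriesD; last 2 first.
  - by move=> i _ _; rewrite lee_fin mulr_ge0 ?sterm_ge0 // mulr_ge0 ?bcoef_ge0 // mulr_ge0.
  - by move=> i _ _; rewrite lee_fin mulr_ge0 ?sterm_ge0 // mulr_ge0 ?bcoef_ge0 // mulr_ge0.
  by apply: eq_eseriesr => i _; rewrite -EFinD mulrDl.
- under eq_eseriesr do rewrite hint.
  rewrite nneseries_cauchy; last first.
    move=> N i; rewrite lee_fin mulr_ge0 ?sterm_ge0 // addr_ge0 //.
      by rewrite mulr_ge0 ?bcoef_ge0 // mulr_ge0.
    by rewrite mulr_ge0 ?bcoef_ge0 // mulr_ge0.
  apply: eq_eseriesr => N _; rewrite sumEFin; congr EFin.
  rewrite (convC (bcoef lam c)) (convC (bcoef lam d)) /conv !mulr_sumr -big_split mulr_suml /=.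
  apply: eq_bigr => i _; rewrite subnKC; last by rewrite -ltnS.
  by rewrite !mulrA.
- by move=> N; exact: mh.
Qed.

End Simplex.

(** * Roots, simplex integral and the function h *)

Section Assembly.
Variable R : realType.

Lemma cexpn_polar (r th : R) n : cexpn (polar r th) n = polar (r ^+ n) (n%:R * th).
Proof.
elim: n => [|n IH]; first by rewrite /cexpn /= /polar mul0r cos0 sin0 mulr1 mulr0.
rewrite /cexpn /= -/(cexpn _ n) IH /polar /cmul /= exprS -natr1 mulrDl mul1r.
by rewrite cosD sinD; congr (_, _); ring.
Qed.

(** As the second coordinate is nonnegative, the number is r^k e^(i acos xi) with principal argument
    acos xi. For r = 0 [carg] takes its default value, but the root itself is 0. *)
Lemma croot_re (k j : nat) (r xi : R) : (0 < k)%N -> 0 <= r -> -1 <= xi <= 1 ->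
  cre (croot k (r ^+ k * xi, Num.sqrt (r ^+ (2 * k) - (r ^+ k * xi) ^+ 2)) j) =
  r * cos ((acos xi + 2 * pi * j%:R) / k%:R).
Proof.
move=> k0 r0 xi1; have rk0 : 0 <= r ^+ k by rewrite exprn_ge0.
have xi2 : xi ^+ 2 <= 1 by rewrite -[xi ^+ 2]real_normK ?num_real // expr_le1 // ler_norml.
have hn : cnorm (r ^+ k * xi, Num.sqrt (r ^+ (2 * k) - (r ^+ k * xi) ^+ 2)) = r ^+ k.
  rewrite /cnorm /= sqr_sqrtr.
    by rewrite addrCA subrr addr0 mulnC exprM sqrtr_sqr ger0_norm.
  by rewrite mulnC exprM exprMn -{1}[(r ^+ k) ^+ 2]mulr1 -mulrBr mulr_ge0 ?sqr_ge0 // subr_ge0.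
rewrite /croot hn /cre /=.
have -> : (r ^+ k) `^ (k%:R^-1) = r.
  rewrite -powR_mulrn // -powRrM divff ?pnatr_eq0 -?lt0n // powRr1 //.
have [->|rn0] := eqVneq r 0; first by rewrite !mul0r.
rewrite /carg hn expf_eq0 (negbTE rn0) andbF /= sqrtr_ge0.
by rewrite mulrAC divff ?mul1r // expf_neq0.
Qed.

Lemma eq_simplex_int n (s : R) (F F' : seq R -> \bar R) :
  (forall l, size l = n -> F l = F' l) -> simplex_int n s F = simplex_int n s F'.
Proof.
elim: n s F F' => [|n IH] s F F' h /=; first exact: h.
by apply: eq_integral => x _; apply: IH => l hl; apply: h => /=; rewrite hl.
Qed.

Lemma sexp_sum (c0 : R) (cs : seq R) (s : R) (l : seq R) : size l = size cs ->
  sexp c0 cs s l = c0 * (s - \sum_(x <- l) x) + \sum_(j < size cs) nth 0 cs j * nth 0 l j.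
Proof.
elim: cs s l => [|c cs IH] s [|x l] //=; first by rewrite big_nil big_ord0 subr0 addr0.
by move=> [hl]; rewrite IH // big_cons big_ord_recl /=; ring.
Qed.

Lemma swt_prod (lam s : R) (l : seq R) :
  swt lam s l = (s - \sum_(x <- l) x) `^ (lam - 1) *
    \prod_(j < size l) (nth 0 l j) `^ (lam - 1).
Proof.
elim: l s => [|x l IH] s /=; first by rewrite big_nil big_ord0 subr0 mulr1.
by rewrite IH big_cons big_ord_recl /= opprD addrA mulrCA.
Qed.

Lemma dirP_map (lam : R) (I : Type) (c : I -> R) (s : seq I) :
  dirP lam (@idfun R) (map c s) = dirP lam c s.
Proof. by elim: s => //= i s ->. Qed.

(** The product is symmetric in its factors; the eliminated variable t_0 comes last in [simplex_exp]
    but belongs to the first root. *)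
Lemma dirP_rcons (lam : R) (cs : seq R) (c : R) :
  dirP lam (@idfun R) (rcons cs c) = dirP lam (@idfun R) (c :: cs).
Proof. by elim: cs => //= d cs ->; rewrite /= convCA. Qed.

Lemma dirP_scale (lam r : R) (I : Type) (c : I -> R) (s : seq I) n :
  dirP lam (fun i => r * c i) s n = r ^+ n * dirP lam c s n.
Proof.
elim: s n => [|i s IH] n /=.
  by case: n => [|n]; rewrite ?expr0 ?mul1r // mulr0.
rewrite /conv mulr_sumr; apply: eq_bigr => j _; rewrite IH /bcoef exprMn.
have jn : (j <= n)%N by rewrite -ltnS.
have -> : r ^+ n = r ^+ j * r ^+ (n - j) by rewrite -exprD subnKC.
by ring.
Qed.

(** Apply 2 p q <= p^2 + q^2 to the cosines and to the sines. The bound makes xi a cosine and D^2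
    nonnegative. *)
Lemma xi_itv (a b u v : R) : -1 <= u <= 1 -> -1 <= v <= 1 ->
  -1 <= v * (cos a * cos b) + u * (sin a * sin b) <= 1.
Proof.
rewrite -!ler_norml => u1 v1; apply: (le_trans (ler_normD _ _)).
rewrite !normrM; have := cos2Dsin2 a; have := cos2Dsin2 b.
rewrite -[cos a ^+ 2]real_normK ?num_real // -[cos b ^+ 2]real_normK ?num_real //.
rewrite -[sin a ^+ 2]real_normK ?num_real // -[sin b ^+ 2]real_normK ?num_real //.
have := normr_ge0 (cos a); have := normr_ge0 (cos b).
have := normr_ge0 (sin a); have := normr_ge0 (sin b).
move: `|cos a| `|cos b| `|sin a| `|sin b| => p q s t t0 s0 q0 p0 h1 h2.
have hv : `|v| * (p * q) <= p * q by rewrite ler_piMl // mulr_ge0.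
have hu : `|u| * (s * t) <= s * t by rewrite ler_piMl // mulr_ge0.
have := sqr_ge0 (p - q); have := sqr_ge0 (s - t); nra.
Qed.

Section Kernel.
Variables (k : nat) (lam : R).
Hypotheses (k2 : (2 <= k)%N) (lam0 : 0 < lam).
Local Notation f := (fun N => amode k lam N 0).

(** Positivity is visible in the Dirichlet form: the points 1 + cos are nonnegative, hence so are
    the coefficients of prod_j (1 - c_j s)^(-lam). *)
Lemma amode0_ge0 N xi : -1 <= xi <= 1 -> 0 <= (f N).[xi].
Proof.
move=> xi1; have xiI : xi \in `[(-1), 1] by rewrite in_itv.
rewrite -(acosK xiI) (amode0_eval k2 lam0 1%g) /dirG divr_ge0 //; last first.
  rewrite ltW // poch_gt0 // mulr_gt0 // ltr0n.
  by rewrite -[index_enum _]enumT -cardE card_ord (ltn_trans _ k2).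
by apply: dirP_ge0 => // j; exact: onecos_ge0.
Qed.

Definition roots_list (s : 'S_k) (r xi : R) : seq R :=
  [seq r * rc s j (acos xi) | j <- index_enum 'I_k].

Lemma dirP_roots (s : 'S_k) (r xi : R) N : -1 <= xi <= 1 ->
  dirP lam (@idfun R) (roots_list s r xi) N = r ^+ N * ((f N).[xi] * poch (k%:R * lam) N).
Proof.
move=> xi1; have xiI : xi \in `[(-1), 1] by rewrite in_itv.
rewrite dirP_map dirP_scale -[in RHS](acosK xiI) (amode0_eval k2 lam0 s) /dirG.
have -> : size (index_enum 'I_k) = k by rewrite -[index_enum _]enumT -cardE card_ord.
by rewrite divfK // lt0r_neq0 // poch_gt0 // mulr_gt0 // ltr0n (ltn_trans _ k2).
Qed.

End Kernel.

Section Hfun.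
Variables (n : nat) (lam : R).
Hypotheses (k2 : (2 <= n.+1)%N) (lam0 : 0 < lam).

Let hd (s : 'S_n.+1) (r xi : R) : R := r * rc s ord0 (acos xi).
Let tl (s : 'S_n.+1) (r xi : R) : seq R :=
  [seq r * rc s (lift ord0 j) (acos xi) | j <- enum 'I_n].

Let size_tl s r xi : size (tl s r xi) = n.
Proof. by rewrite size_map -cardE card_ord. Qed.

Let roots_listE s r xi : roots_list s r xi = hd s r xi :: tl s r xi.
Proof. by rewrite /roots_list -[index_enum _]enumT enum_ordSl /= -map_comp. Qed.

Let roots_ge0 s r xi : 0 <= r -> all (fun c => 0 <= c) (rcons (tl s r xi) (hd s r xi)).
Proof.
move=> r0; rewrite all_rcons mulr_ge0 ?onecos_ge0 //=.
by apply/allP => _ /mapP[j _ ->]; rewrite mulr_ge0 ?onecos_ge0.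
Qed.

Let sum_tvec (l : seq R) : size l = n -> \sum_(j < n.+1) tvec l j = 1.
Proof.
move=> hl; rewrite big_ord_recl /tvec /=.
rewrite [X in _ - X](big_nth 0) big_mkord hl.
by rewrite -[RHS](subrK (\sum_(j < n) nth 0 l j)); congr (_ + _).
Qed.

(** Since the t_j add up to 1, replacing cos by 1 + cos costs only the constant r, the source of
    e^(-r) in [simplex_hfun]. *)
Let sum_roots (s : 'S_n.+1) r xi (l : seq R) : size l = n ->
  \sum_(j < n.+1) tvec l j * (r * cos ((acos xi + 2 * pi * (s j)%:R) / n.+1%:R)) =
  sexp (hd s r xi) (tl s r xi) 1 l - r.
Proof.
move=> hl; rewrite sexp_sum ?size_tl //.
have -> : \sum_(j < n.+1) tvec l j * (r * cos ((acos xi + 2 * pi * (s j)%:R) / n.+1%:R)) =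
  \sum_(j < n.+1) tvec l j * (r * rc s j (acos xi)) - \sum_(j < n.+1) tvec l j * r.
  by rewrite -sumrB; apply: eq_bigr => j _; rewrite /rc /rphi; ring.
rewrite -mulr_suml sum_tvec // mul1r; congr (_ - _).
rewrite big_ord_recl mulrC; congr (_ + _); apply: eq_bigr => j _.
by rewrite (nth_map j) ?nth_ord_enum // -?cardE ?card_ord // mulrC.
Qed.

Let prod_tvec (l : seq R) : size l = n ->
  \prod_(j < n.+1) (tvec l j) `^ (lam - 1) = swt lam 1 l.
Proof.
move=> hl; rewrite swt_prod hl big_ord_recl; congr (_ * _).
Qed.

(** Here R = (|z| |w|)^k xi, and D does not change under R -> -R, so the second exponential is the
    first at - xi, reached by changing the signs of A and B. The Pochhammer factor of [dirP_roots]
    cancels the one in [sterm]. *)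
Lemma simplex_hfun (s1 s2 : 'S_n.+1) (rx ry th ph u v : R) :
  0 <= rx -> 0 <= ry -> -1 <= u <= 1 -> -1 <= v <= 1 ->
  let A := cos (n.+1%:R * th) * cos (n.+1%:R * ph) in
  let B := sin (n.+1%:R * th) * sin (n.+1%:R * ph) in
  (simplex_int n 1 (fun l => (hfun s1 s2 u v (tvec l) (polar rx th) (polar ry ph) *
      \prod_(j < n.+1) (tvec l j) `^ (lam - 1))%:E) =
   \sum_(N <oo) (expR (- (rx * ry)) * (Gamma lam ^+ n.+1 / Gamma (n.+1%:R * lam)) *
      (rx * ry) ^+ N *
      ((amode n.+1 lam N 0).[v * A + u * B] +
       (amode n.+1 lam N 0).[v * (- A) + u * (- B)]))%:E)%E.
Proof.
move=> rx0 ry0 u1 v1 A B; set r := rx * ry.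
have r0 : 0 <= r by rewrite mulr_ge0.
pose xi := v * A + u * B.
have xi1 : -1 <= xi <= 1 by exact: xi_itv.
have xiN : -1 <= - xi <= 1 by rewrite lerNl opprK lerNl andbC.
have -> : v * - A + u * - B = - xi by rewrite /xi; ring.
have hE l : size l = n -> (hfun s1 s2 u v (tvec l) (polar rx th) (polar ry ph) *
      \prod_(j < n.+1) (tvec l j) `^ (lam - 1))%:E =
   ((expR (- r) * expR (sexp (hd s1 r xi) (tl s1 r xi) 1 l) +
     expR (- r) * expR (sexp (hd s2 r (- xi)) (tl s2 r (- xi)) 1 l)) * swt lam 1 l)%:E.
  move=> hl; rewrite prod_tvec //; congr (EFin (_ * _)).
  have nE x t : 0 <= x -> cnorm (polar x t) = x :> R.
    move=> x0; rewrite /cnorm /polar /= !exprMn -mulrDr cos2Dsin2 mulr1 sqrtr_sqr ger0_norm //.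
  rewrite /hfun !cexpn_polar !nE // -/r.
  have RE : cre (cmul (v * cre (polar (rx ^+ n.+1) (n.+1%:R * th)),
      u * cim (polar (rx ^+ n.+1) (n.+1%:R * th)))
      (cconj (polar (ry ^+ n.+1) (n.+1%:R * ph)))) = r ^+ n.+1 * xi.
    by rewrite /cre /cim /cmul /cconj /polar /= /r exprMn /xi /A /B; ring.
  rewrite RE.
  have e1 : \sum_(j < n.+1) tvec l j * cre (croot n.+1 (r ^+ n.+1 * xi,
      Num.sqrt (r ^+ (2 * n.+1) - (r ^+ n.+1 * xi) ^+ 2)) (s1 j)) =
      sexp (hd s1 r xi) (tl s1 r xi) 1 l - r.
    by rewrite -sum_roots //; apply: eq_bigr => j _; rewrite croot_re.
  have e2 : \sum_(j < n.+1) tvec l j * cre (croot n.+1 (- (r ^+ n.+1 * xi),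
      Num.sqrt (r ^+ (2 * n.+1) - (r ^+ n.+1 * xi) ^+ 2)) (s2 j)) =
      sexp (hd s2 r (- xi)) (tl s2 r (- xi)) 1 l - r.
    rewrite -sum_roots //; apply: eq_bigr => j _.
    by rewrite -[(_ * xi) ^+ 2]sqrrN -mulrN croot_re.
  by rewrite e1 e2 !expRD ![expR (- r) * _]mulrC.
rewrite (eq_simplex_int _ hE) simplex_exp ?size_tl ?ltr01 ?expR_ge0 ?roots_ge0 //.
apply: eq_eseriesr => N _; congr EFin.
rewrite !dirP_rcons -!roots_listE !dirP_roots // /sterm powR1 Gamma_poch; last by rewrite mulr_gt0.
have k0 : 0 < n.+1%:R * lam by rewrite mulr_gt0.
have n1 := lt0r_neq0 (Gamma_gt0 k0); have n2 := lt0r_neq0 (poch_gt0 N k0).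
move: n1 n2; move: (Gamma (n.+1%:R * lam)) (poch (n.+1%:R * lam) N) (Gamma lam ^+ n.+1).
move: (amode _ _ _ _).[_] (amode _ _ _ _).[_] (expR _) => a b c x y z x0 y0.
by field; rewrite x0 y0.
Qed.

End Hfun.
End Assembly.

(** * Termwise integration against nu^a *)

Section NuSeries.
Variable R : realType.
Local Notation mu := (@lebesgue_measure R).
Local Open Scope ereal_scope.

Lemma nu_dens_ge0 (a u : R) : (0 < a)%R -> (0 <= nu_dens a u)%R.
Proof.
move=> a0; rewrite nu_densE mulr_ge0 ?dens_ge0 // /nu_cst divr_ge0 //.
  by rewrite ltW // Gamma_gt0 // addr_gt0 // half_gt0.
by rewrite mulr_ge0 ?sqrtr_ge0 // ltW // Gamma_gt0.
Qed.

Lemma has_nuD (a : R) F F' m m' : has_nu a F m -> has_nu a F' m' ->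
  has_nu a (fun u => F u + F' u)%R (m + m').
Proof.
move=> h h'.
have := @has_nu_sum R a bool [:: true; false] (fun b => if b then F else F')
  (fun b => if b then m else m').
move=> /(_ ltac:(by case)) H; apply: has_nu_eq H.
  by move=> u; rewrite !big_cons big_nil addr0.
by rewrite !big_cons big_nil addr0.
Qed.

Lemma has_nu_ge0 (a : R) F m : (0 < a)%R ->
  (forall u, (-1 <= u <= 1)%R -> (0 <= F u)%R) -> has_nu a F m -> (0 <= m)%R.
Proof.
move=> a0 F0 [_ h]; rewrite -lee_fin -h; apply: integral_ge0 => u /=.
by rewrite in_itv /= => u1; rewrite lee_fin mulr_ge0 ?nu_dens_ge0 // F0.
Qed.

Lemma nu_series (a : R) (F : nat -> R -> R) (m : nat -> R) : (0 < a)%R ->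
  (forall N u, (-1 <= u <= 1)%R -> (0 <= F N u)%R) ->
  (forall N, has_nu a (F N) (m N)) ->
  \int[mu]_(u in `[(-1)%R, 1%R]) ((nu_dens a u)%:E * \sum_(N <oo) (F N u)%:E) =
  \sum_(N <oo) (m N)%:E.
Proof.
move=> a0 F0 h.
transitivity (\int[mu]_(u in `[(-1)%R, 1%R]) \sum_(N <oo) (nu_dens a u * F N u)%:E).
  apply: eq_integral => u; rewrite inE /= in_itv /= => u1.
  rewrite -nneseriesZl; last by move=> N _; rewrite lee_fin F0.
  by apply: eq_eseriesr => N _; rewrite EFinM.
rewrite integral_nneseries; last 3 first.
- exact: measurable_itv.
- by move=> N; have [/measurable_int] := h N.
- by move=> N u /=; rewrite in_itv /= => u1; rewrite lee_fin mulr_ge0 ?nu_dens_ge0 // F0.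
by apply: eq_eseriesr => N _; have [] := h N.
Qed.

End NuSeries.

(** * The integral formula for the generalized Bessel function *)

Local Open Scope classical_set_scope.
Local Open Scope ring_scope.

Theorem mainTheorem10 (R : realType) (k : nat) (al be : R)
    (E : cplx R -> cplx R -> R) (s1 s2 : 'S_k) :
  (2 <= k)%N -> 0 < al -> 0 < be -> is_dunkl_kernel k al be E ->
  forall z w : cplx R,
    ((bessel k E z w)%:E =
     (Gamma (k%:R * (al + be)) / (2 * Gamma (al + be) ^+ k))%:E *
     \int[lebesgue_measure]_(u in `[(-1)%R, 1%R]%classic)
       \int[lebesgue_measure]_(v in `[(-1)%R, 1%R]%classic)
         ((nu_dens al u * nu_dens be v)%:E *
          simplex_int k.-1 1
            (fun l => (hfun s1 s2 u v (tvec l) z w *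
                       \prod_(j < k) powR (tvec l j) (al + be - 1))%:E)))%E.
Proof.
case: k s1 s2 => [//|n] s1 s2 k2 al0 be0 dE z w.
have [rx [th [rx0 _ ->]]] := polarP z; have [ry [ph [ry0 _ ->]]] := polarP w.
have lam0 : 0 < al + be by exact: addr_gt0.
pose A := cos (n.+1%:R * th) * cos (n.+1%:R * ph).
pose B := sin (n.+1%:R * th) * sin (n.+1%:R * ph).
pose r := rx * ry; have r0 : 0 <= r by rewrite mulr_ge0.
(* The prefactor of the formula is 1 / (2 C); the two exponentials supply the missing 2. *)
pose C := Gamma (al + be) ^+ n.+1 / Gamma (n.+1%:R * (al + be)).
have C0 : 0 < C by rewrite divr_gt0 ?exprn_gt0 ?Gamma_gt0 // mulr_gt0.
pose c N := expR (- r) * C * r ^+ N.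
have c0 N : 0 <= c N by apply: mulr_ge0 (exprn_ge0 N r0); exact: mulr_ge0 (expR_ge0 _) (ltW C0).
pose f N := amode n.+1 (al + be) N 0.
pose F N u v := c N * ((f N).[v * A + u * B] + (f N).[v * - A + u * - B]).
have F0 N u v : -1 <= u <= 1 -> -1 <= v <= 1 -> 0 <= F N u v.
  move=> u1 v1; have xi1 := xi_itv (n.+1%:R * th) (n.+1%:R * ph) u1 v1.
  rewrite mulr_ge0 // addr_ge0 // amode0_ge0 // !mulrN -opprD lerNl opprK lerNl.
  by rewrite andbC.
have [G hG] : exists G, forall N, (forall u, has_nu be (F N u) (G N u)) /\
    has_nu al (G N) (2 * c N * bessel_coef n.+1 al be N th ph).
  suff /choice[G hG] : forall N, exists g, (forall u, has_nu be (F N u) (g u)) /\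
    has_nu al g (2 * c N * bessel_coef n.+1 al be N th ph) by exists G.
  move=> N; have [g1 [h1 h1']] := nu_double A B (f N) al0 be0.
  have [g2 [h2 h2']] := nu_double (- A) (- B) (f N) al0 be0.
  exists (fun u => c N * (g1 u + g2 u)); split.
    by move=> u; apply: has_nuZ; exact: has_nuD.
  (* Both exponentials contribute equally: (u, v) -> (-u, -v) undoes the change of sign of A and
     B. *)
  have -> : 2 * c N * bessel_coef n.+1 al be N th ph =
      c N * (Tmom al be A B 0 0 (f N) + Tmom al be (- A) (- B) 0 0 (f N)).
    rewrite /bessel_coef -/A -/B -/(f N).
    rewrite -[- A]mulN1r -[- B]mulN1r -[-1]expr1 Tmom_signA Tmom_signB !muln0 !expr0 !mul1r.
    by ring.
  by apply: has_nuZ; exact: has_nuD.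
have G0 N u : -1 <= u <= 1 -> 0 <= G N u.
  by move=> u1; apply: has_nu_ge0 be0 _ ((hG N).1 u) => v v1; exact: F0.
have -> : (\int[lebesgue_measure]_(u in `[(-1)%R, 1%R]%classic)
       \int[lebesgue_measure]_(v in `[(-1)%R, 1%R]%classic)
         ((nu_dens al u * nu_dens be v)%:E *
          simplex_int n 1
            (fun l => (hfun s1 s2 u v (tvec l) (polar rx th) (polar ry ph) *
                       \prod_(j < n.+1) powR (tvec l j) (al + be - 1))%:E)) =
   \sum_(N <oo) (2 * c N * bessel_coef n.+1 al be N th ph)%:E)%E.
  rewrite -(nu_series al0 (m := fun N => 2 * c N * bessel_coef n.+1 al be N th ph) G0
    (fun N => (hG N).2)).
  apply: eq_integral => u; rewrite inE /= in_itv /= => u1.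
  rewrite -nneseriesZl; last by move=> N _; rewrite lee_fin G0.
  transitivity (\sum_(N <oo) (nu_dens al u * G N u)%:E)%E; last first.
    by apply: eq_eseriesr => N _; rewrite EFinM.
  rewrite -(@nu_series R be (fun N v => nu_dens al u * F N u v)
    (fun N => nu_dens al u * G N u) be0); last 2 first.
  - by move=> N v v1; rewrite mulr_ge0 ?nu_dens_ge0 // F0.
  - by move=> N; apply: has_nuZ; exact: (hG N).1.
  apply: eq_integral => v; rewrite inE /= in_itv /= => v1.
  rewrite (simplex_hfun k2 lam0 s1 s2 th ph rx0 ry0 u1 v1) -/A -/B.
  rewrite mulrC EFinM -muleA; congr (_ * _)%E.
  rewrite -nneseriesZl; last by move=> N _; rewrite lee_fin; exact: F0.
  by apply: eq_eseriesr => N _; rewrite EFinM.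
have sE : (\sum_(N <oo) (2 * c N * bessel_coef n.+1 al be N th ph)%:E =
    (2 * C * bessel n.+1 E (polar rx th) (polar ry ph))%:E)%E.
  apply/cvg_lim => //.
  have -> : (fun N => \sum_(0 <= i < N) (2 * c i * bessel_coef n.+1 al be i th ph)%:E)%E =
    EFin \o (fun N => 2 * C * expR (- r) *
      \sum_(i < N) r ^+ i * bessel_coef n.+1 al be i th ph).
    apply/funext => N /=; rewrite sumEFin big_mkord mulr_sumr; congr EFin.
    by apply: eq_bigr => i _; rewrite /c; ring.
  apply: cvg_EFin; first by near=> N.
  have -> : 2 * C * bessel n.+1 E (polar rx th) (polar ry ph) = 2 * C * expR (- r) *
      (expR r * bessel n.+1 E (polar rx th) (polar ry ph)).
    by rewrite mulrA -(mulrA (2 * C)) -expRD addNr expR0 mulr1.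
  by apply: cvgM; [exact: cvg_cst|exact: bessel_series].
rewrite sE -EFinM; congr EFin; rewrite mulrA /C.
have k0 : 0 < n.+1%:R * (al + be) by rewrite mulr_gt0.
have n1 := lt0r_neq0 (Gamma_gt0 k0); have n2 := lt0r_neq0 (exprn_gt0 n.+1 (Gamma_gt0 lam0)).
move: n1 n2; move: (Gamma (n.+1%:R * (al + be))) (Gamma (al + be) ^+ n.+1) => x y x0 y0.
by field; rewrite x0 y0.
Unshelve. all: by end_near. Qed.
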